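(* Let $Q(x)=\begin{pmatrix}0&q_2(x)\\ q_3(x)&0\end{pmatrix}$, where $q_2,q_3$ are complex-valued functions with $q_j\in L_1[0,\pi]$, $q_j(x+\pi)=q_j(x)$ and $q_j(-x)=\overline{q_j(x)}$ for all $x\in\mathbb{R}$, $j=2,3$, and let $L(Q)$ be the associated Dirac operator on the line. Then: (a) The spectrum of $L(Q)$ has finitely many gaps if and only if the number of $2\pi$-periodic eigenvalues that are simple and real is finite. (b) The spectrum of $L(Q)$ has finitely many gaps if and only if all but finitely many $2\pi$-periodic eigenvalues are either double eigenvalues or nonreal eigenvalues.
   Context: $L(Q)$ is the operator generated in $L_2^2(-\infty,\infty)$ (square-integrable $\mathbb{C}^2$-valued functions) by the differential expression $l(Q)\mathbf y=\begin{pmatrix}-i&0\\0&i\end{pmatrix}\mathbf y'+Q\mathbf y$. For $t\in(-1,1]$, $L_t(Q)$ is the operator generated in $L_2^2[0,\pi]$ by $l(Q)$ and the boundary condition $\mathbf y(\pi)=e^{i\pi t}\mathbf y(0)$; its spectrum consists of eigenvalues. It is known that $\sigma(L(Q))=\bigcup_{t\in(-1,1]}\sigma(L_t(Q))=\bigcup_{t\in[0,1]}\sigma(L_t(Q))$. Let $E(x,\lambda)$ be the $2\times2$ fundamental matrix of $\begin{pmatrix}-i&0\\0&i\end{pmatrix}\mathbf y'+Q\mathbf y=\lambda\mathbf y$ with $E(0,\lambda)=I$, and let $F(\lambda)=\operatorname{tr}E(\pi,\lambda)$, an entire function. Then $\lambda$ is an eigenvalue of $L_t(Q)$ if and only if $F(\lambda)=2\cos\pi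 t$. The multiplicity of an eigenvalue $\lambda$ of $L_t(Q)$ is its multiplicity as a root of this equation; ''simple'' and ''double'' mean multiplicity one and two. The $2\pi$-periodic eigenvalues are the eigenvalues of $L_0(Q)$ (periodic eigenvalues) together with the eigenvalues of $L_1(Q)$ (antiperiodic eigenvalues). A gap in the spectrum of $L(Q)$ means a gap in the real part of the spectrum, i.e. a connected component (maximal open interval) of $\mathbb{R}\setminus\sigma(L(Q))$. *)

(* Defs.v *)
From HB Require Import structures.
From mathcomp Require Import all_boot all_order all_algebra.
From mathcomp Require Import complex.
From mathcomp Require Import all_classical all_reals all_analysis.

Set Implicit Arguments.
Unset Strict Implicit.
Unset Printing Implicit Defensive.

Import Order.TTheory GRing.Theory Num.Theory.
Import numFieldNormedType.Exports.

Local Open Scope classical_set_scope.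
Local Open Scope complex_scope.
Local Open Scope ring_scope.

Section ComplexValued.
Context {R : realType}.
Local Notation mu := (@lebesgue_measure R).

Definition measurable_complex (D : set R) (f : R -> R[i]) : Prop :=
  measurable_fun D (fun x => complex.Re (f x)) /\
  measurable_fun D (fun x => complex.Im (f x)).

Definition integrable_complex (D : set R) (f : R -> R[i]) : Prop :=
  mu.-integrable D (fun x => (complex.Re (f x))%:E) /\
  mu.-integrable D (fun x => (complex.Im (f x))%:E).

Definition integral_complex (D : set R) (f : R -> R[i]) : R[i] :=
  (\int[mu]_(x in D) complex.Re (f x))%R +i*
  (\int[mu]_(x in D) complex.Im (f x))%R.

(* [f] is locally absolutely continuous on the interval [D] with a.e.
   derivative [g], i.e. [f] is an indefinite Lebesgue integral of [g]. *)
Definition ac_derivative (D : set R) (f g : R -> R[i]) : Prop :=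
  forall a b : R, a <= b -> `[a, b] `<=` D ->
    integrable_complex `[a, b] g /\
    f b - f a = integral_complex `[a, b] g.

End ComplexValued.

Section SquareIntegrable.
Context {R : realType}.
Local Notation mu := (@lebesgue_measure R).

Definition sqnorm (v : 'cV[R[i]]_2) : R :=
  \sum_(k < 2) (complex.Re (v k 0) ^+ 2 + complex.Im (v k 0) ^+ 2).

Definition sqnormL2 (D : set R) (y : R -> 'cV[R[i]]_2) : \bar R :=
  (\int[mu]_(x in D) (sqnorm (y x))%:E)%E.

Definition inL2 (D : set R) (y : R -> 'cV[R[i]]_2) : Prop :=
  (forall k, measurable_complex D (fun x => y x k 0)) /\
  (sqnormL2 D y < +oo)%E.

Definition ae_eq_on (D : set R) (y z : R -> 'cV[R[i]]_2) : Prop :=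
  {ae mu, forall x, D x -> y x = z x}.

(* An unbounded operator in L_2^2(D) is given by its graph: [T y f] means that
   [y] is a representative of an element of the domain and [f] of its image. *)
Definition eigenvalue_of (D : set R)
    (T : (R -> 'cV[R[i]]_2) -> (R -> 'cV[R[i]]_2) -> Prop) (l : R[i]) : Prop :=
  exists y, ~ ae_eq_on D y (fun=> 0) /\ T y (fun x => l *: y x).

(* [T - l] is a bijection from the domain onto L_2^2(D) with bounded inverse. *)
Definition resolvent_set (D : set R)
    (T : (R -> 'cV[R[i]]_2) -> (R -> 'cV[R[i]]_2) -> Prop) : set R[i] :=
  [set l | (forall y, T y (fun x => l *: y x) -> ae_eq_on D y (fun=> 0)) /\
    exists K : R, forall f, inL2 D f ->
      exists y, T y (fun x => f x + l *: y x) /\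
        (sqnormL2 D y <= K%:E * sqnormL2 D f)%E].

Definition spectrum_of (D : set R)
    (T : (R -> 'cV[R[i]]_2) -> (R -> 'cV[R[i]]_2) -> Prop) : set R[i] :=
  ~` resolvent_set D T.

End SquareIntegrable.

Section Dirac.
Context {R : realType}.
Local Notation mu := (@lebesgue_measure R).

Definition offdiag (q2 q3 : R -> R[i]) (x : R) : 'M[R[i]]_2 :=
  @block_mx _ 1 1 1 1 0 (q2 x)%:M (q3 x)%:M 0.

Definition dirac_J : 'M[R[i]]_2 :=
  @block_mx _ 1 1 1 1 (- 'i%C)%:M 0 0 'i%C%:M.

(* [Y] is locally absolutely continuous on [D] and [l(Q) Y = G] a.e. on [D];
   the column count is 1 for vector functions, 2 for matrix solutions. *)
Definition dirac_expr (m : nat) (D : set R) (Q : R -> 'M[R[i]]_2)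
    (Y G : R -> 'M[R[i]]_(2, m)) : Prop :=
  exists Y' : R -> 'M[R[i]]_(2, m),
    (forall j k, ac_derivative D (fun x => Y x j k) (fun x => Y' x j k)) /\
    {ae mu, forall x, D x -> dirac_J *m Y' x + Q x *m Y x = G x}.

Definition L_line (Q : R -> 'M[R[i]]_2) (y f : R -> 'cV[R[i]]_2) : Prop :=
  [/\ inL2 setT y, inL2 setT f & dirac_expr setT Q y f].

Definition L_t (Q : R -> 'M[R[i]]_2) (t : R) (y f : R -> 'cV[R[i]]_2) : Prop :=
  [/\ inL2 `[0, pi] y, inL2 `[0, pi] f, dirac_expr `[0, pi] Q y f &
      y pi = (cos (pi * t) +i* sin (pi * t)) *: y 0].

Definition is_fundamental_matrix (Q : R -> 'M[R[i]]_2) (l : R[i])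
    (E : R -> 'M[R[i]]_2) : Prop :=
  E 0 = 1%:M /\ dirac_expr setT Q E (fun x => l *: E x).

(* The fundamental matrix exists and is unique for locally integrable [Q];
   the default value of [xget] is then irrelevant. *)
Definition fundamental_matrix (Q : R -> 'M[R[i]]_2) (l : R[i]) :
    R -> 'M[R[i]]_2 :=
  xget (fun=> 1%:M) [set E | is_fundamental_matrix Q l E].

Definition hill_F (Q : R -> 'M[R[i]]_2) (l : R[i]) : R[i] :=
  \tr (fundamental_matrix Q l pi).

(* Order of vanishing at [l] of the (entire) function [f], the derivatives
   being complex derivatives. *)
Definition root_multiplicity (f : R[i] -> R[i]) (l : R[i]) (m : nat) : Prop :=
  (forall k, (k < m)%N -> derive1n k (f : R[i] -> R[i]^o) l = 0) /\
  derive1n m (f : R[i] -> R[i]^o) l <> 0.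

Definition eigenvalue_Lt (Q : R -> 'M[R[i]]_2) (t : R) (l : R[i]) : Prop :=
  eigenvalue_of `[0, pi] (L_t Q t) l.

Definition eigenvalue_mult (Q : R -> 'M[R[i]]_2) (t : R) (l : R[i])
    (m : nat) : Prop :=
  eigenvalue_Lt Q t l /\
  root_multiplicity (fun z => hill_F Q z - (2 * cos (pi * t))%:C) l m.

Definition eigenvalue_2pi (Q : R -> 'M[R[i]]_2) : set R[i] :=
  [set l | eigenvalue_Lt Q 0 l \/ eigenvalue_Lt Q 1 l].

Definition mult_2pi (Q : R -> 'M[R[i]]_2) (l : R[i]) (m : nat) : Prop :=
  eigenvalue_mult Q 0 l m \/ eigenvalue_mult Q 1 l m.

Definition spectral_gaps (Q : R -> 'M[R[i]]_2) : set (set R) :=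
  let S := [set x : R | ~ spectrum_of setT (L_line Q) x%:C] in
  [set connected_component S x | x in S].

End Dirac.

(* Main.v *)
(** By the symmetry [q (- x) = conj (q x)] the discriminant [F] is real on the real
    line, and [x] lies in the spectrum iff [|F x| <= 2]: if [|F x| <= 2], cutting off a
    bounded Bloch solution slowly gives approximate eigenfunctions; if [|F x| > 2], the
    two Floquet multipliers split the equation into scalar equations
    [w' = -+ k w + h], which are solved in [L_2] by an energy estimate. So the gaps
    are the components of [{|F| > 2}], and the real [2 pi]-periodic eigenvalues are
    the roots of [F ^ 2 = 4].

    The Taylor coefficients of [F] at a real point are bounded uniformly in that
    point, and [F x - 2 cos (pi x)] tends to [0] at infinity (Riemann-Lebesgue).
    Comparing second differences with those of [2 cos (pi x)], a root of [F ^ 2 = 4]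
    with [F' = 0] that is far from [0] satisfies [F F'' < 0]: it is double and is not
    an endpoint of a gap.  A simple root is an endpoint of a gap.  As real roots
    of [F ^ 2 = 4] do not accumulate, each of the sets involved is finite iff it is
    bounded, and all of them are bounded simultaneously. *)

(* Absolute continuity enters only as an indefinite integral with a prescribed derivative, so almost
   everywhere differentiation never occurs: estimates compare the increments of two such functions,
   and the product rule is the one rule of calculus that takes real work. The coefficient matrices
   have trace zero. Hence fundamental matrices have determinant 1 and their inverse is the adjugate,
   which is linear in the entries; conserved quantities then give uniqueness without a Gronwall
   argument. Uniformity in the real base point is decisive: a second difference whose step is chosen
   once and for all must beat the Taylor remainder at every far root. The uniformity comes from
   removing the free flow, unimodular at real spectral parameter, before the Picard series is
   estimated. Gaps are not matched one to one with simple roots. Near the origin, end points of gaps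
   with [F' = 0] and roots of higher multiplicity are not excluded, but they lie in a bounded set,
   which contains finitely many roots. This is why boundedness is compared instead of
   cardinalities. *)
Require Import Defs.
From mathcomp Require Import all_boot all_order all_algebra.
From mathcomp Require Import complex ring lra.
From mathcomp Require Import all_classical all_reals all_analysis.
From mathcomp Require Import measurable_realfun.

Set Implicit Arguments.
Unset Strict Implicit.
Unset Printing Implicit Defensive.

Import Order.TTheory GRing.Theory Num.Theory.
Import numFieldNormedType.Exports.
Local Open Scope classical_set_scope.
Local Open Scope complex_scope.
Local Open Scope ring_scope.

(** * Absolutely continuous functions *)

Section AbsolutelyContinuous.
Context {R : realType}.
Local Notation mu := (@lebesgue_measure R).
Implicit Types (D : set R) (f g F G : R -> R) (a b c x : R).

Definition locint D g :=
  forall a b, a <= b -> `[a, b] `<=` D -> mu.-integrable `[a, b] (EFin \o g).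

(** The derivative is a datum that is seen only through its integrals; this is the real component of
    [ac_derivative]. *)
Definition ac D f g := forall a b, a <= b -> `[a, b] `<=` D ->
  mu.-integrable `[a, b] (EFin \o g) /\
  f b - f a = \int[mu]_(x in `[a, b]) g x.

Lemma itvcc_sub a b s t : a <= s -> t <= b -> `[s, t] `<=` `[a, b].
Proof.
move=> as_ tb x /=; rewrite !in_itv/= => /andP[sx xt].
by rewrite (le_trans as_ sx) (le_trans xt tb).
Qed.

Lemma ac_sub D D' f g : D' `<=` D -> ac D f g -> ac D' f g.
Proof. by move=> DD h a b ab abD; apply: h => //; exact: subset_trans DD. Qed.

Lemma locint_sub D D' g : D' `<=` D -> locint D g -> locint D' g.
Proof. by move=> DD h a b ab abD; apply: h => //; exact: subset_trans DD. Qed.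

Lemma ac_locint D f g : ac D f g -> locint D g.
Proof. by move=> h a b ab /(h _ _ ab)[]. Qed.

Lemma locintT_itv g : (forall n : nat, mu.-integrable `[- n%:R, n%:R] (EFin \o g)) ->
  locint setT g.
Proof.
move=> h a b ab _.
have [n hn] : exists n : nat, `|a| + `|b| <= n%:R.
  exists (Num.truncn (`|a| + `|b|)).+1.
  by apply/ltW; rewrite truncnS_gt.
apply: integrableS (h n) => //; apply: itvcc_sub.
  rewrite lerNl (le_trans _ hn)// (le_trans (ler_norm _))// normrN.
  by rewrite lerDl.
by rewrite (le_trans _ hn)// (le_trans (ler_norm _))// lerDr.
Qed.

Lemma memL a b : a <= b -> `[a, b]%classic a.
Proof. by move=> ab /=; rewrite in_itv/= lexx. Qed.

Lemma memR a b : a <= b -> `[a, b]%classic b.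
Proof. by move=> ab /=; rewrite in_itv/= lexx andbT. Qed.

Lemma ac_eq D f g f' g' : (forall x, D x -> f x = f' x) ->
  (forall x, D x -> g x = g' x) -> ac D f g -> ac D f' g'.
Proof.
move=> ff gg h a b ab abD; have [ig fE] := h a b ab abD.
have gab : {in `[a, b]%classic, g =1 g'}.
  by move=> x /set_mem /abD; exact: gg.
split.
  apply: eq_integrable ig => //.
  by move=> x xab /=; rewrite (gab x).
rewrite -!ff; [|exact: abD (memL ab)|exact: abD (memR ab)].
by rewrite fE; exact: eq_Rintegral.
Qed.

Lemma ac_cst D c : ac D (fun=> c) (fun=> 0).
Proof.
move=> a b ab _; split; last by rewrite subrr Rintegral_cst// mul0r.
by apply: eq_integrable (integrable0 _ _) => //.
Qed.

Lemma acD D f g F G : ac D f F -> ac D g G ->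
  ac D (fun x => f x + g x) (fun x => F x + G x).
Proof.
move=> hf hg a b ab abD.
have [iF fE] := hf a b ab abD; have [iG gE] := hg a b ab abD.
split; first exact: (@integrableD _ _ _ mu _ _ (EFin \o F) (EFin \o G)).
by rewrite RintegralD// -fE -gE; ring.
Qed.

Lemma acZ D k f F : ac D f F -> ac D (fun x => k * f x) (fun x => k * F x).
Proof.
move=> hf a b ab abD; have [iF fE] := hf a b ab abD.
split; first exact: (@integrableZl _ _ _ mu _ _ k (EFin \o F)).
by rewrite RintegralZl// -fE; ring.
Qed.

Lemma acN D f F : ac D f F -> ac D (fun x => - f x) (fun x => - F x).
Proof.
move=> /(acZ (-1)); apply: ac_eq => x _; exact: mulN1r.
Qed.

Lemma acB D f g F G : ac D f F -> ac D g G ->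
  ac D (fun x => f x - g x) (fun x => F x - G x).
Proof. by move=> hf /acN; exact: acD. Qed.

Lemma ac_continuous_itv a b f F : a <= b -> ac `[a, b] f F ->
  {within `[a, b], continuous f}.
Proof.
move=> ab hf; have [iF _] := hf a b ab (fun=> id).
apply: (@subspace_eq_continuous _ _ _
  (fun x => f a + \int[mu]_(t in `[a, x]) F t)).
  move=> x /set_mem xab; have /andP[ax xb] : a <= x <= b.
    by move: xab; rewrite /= in_itv.
  have [_ <-] := hf a x ax (itvcc_sub (lexx _) xb).
  by rewrite addrC subrK.
move=> x; apply: cvgD; first exact: cvg_cst.
exact: parameterized_integral_continuous.
Qed.

Lemma ac_continuous f F : ac setT f F -> continuous f.
Proof.
move=> hf x.
have xx : x - 1 < x + 1 by lra.
have := ac_continuous_itv (ltW xx) (ac_sub (@subsetT _ _) hf).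
move=> /(continuous_within_itvP _ xx)[+ _ _]; apply.
by rewrite in_itv/=; apply/andP; split; lra.
Qed.

Lemma within_continuous_measurable a b f : {within `[a, b], continuous f} ->
  measurable_fun `[a, b] f.
Proof. exact: subspace_continuous_measurable_fun. Qed.

Lemma ac_measurable_itv a b f F : a <= b -> ac `[a, b] f F ->
  measurable_fun `[a, b] f.
Proof.
by move=> ab h; apply: within_continuous_measurable; apply: ac_continuous_itv h.
Qed.

Lemma integrable_continuousM a b f g : {within `[a, b], continuous f} ->
  mu.-integrable `[a, b] (EFin \o g) ->
  mu.-integrable `[a, b] (EFin \o (fun x => f x * g x)).
Proof.
move=> cf ig.
have /compact_bounded bf := continuous_compact cf (@segment_compact _ a b).
apply: (@integrableMr _ _ _ mu _ _ f (EFin \o g)) => //.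
  exact: within_continuous_measurable.
have [M [Mr MP]] := bf; exists M; split => // y /MP My x xab.
by apply: My; exists x.
Qed.

Lemma locint_acM D f F g : ac D f F -> locint D g ->
  locint D (fun x => f x * g x).
Proof.
move=> hf hg a b ab abD; apply: integrable_continuousM; last exact: hg.
by apply: ac_continuous_itv ab _; apply: ac_sub hf.
Qed.

Lemma locintD D f g : locint D f -> locint D g -> locint D (fun x => f x + g x).
Proof.
move=> hf hg a b ab abD.
by apply: (@integrableD _ _ _ mu _ _ (EFin \o f) (EFin \o g)) => //;
  [exact: hf|exact: hg].
Qed.

Lemma locintZ D k f : locint D f -> locint D (fun x => k * f x).
Proof.
move=> hf a b ab abD.
by apply: (@integrableZl _ _ _ mu _ _ k (EFin \o f)) => //; exact: hf.
Qed.

Lemma locint_norm D f : locint D f -> locint D (fun x => `|f x|).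
Proof. by move=> hf a b ab abD; apply: integrable_norm; exact: hf. Qed.

Lemma continuous_locint D g : continuous g -> locint D g.
Proof.
move=> cg a b ab _; apply: continuous_compact_integrable; first exact: segment_compact.
exact: continuous_subspaceT.
Qed.

Lemma locint_cst D k : locint D (fun=> k).
Proof. by apply: continuous_locint => x; exact: cvg_cst. Qed.

Lemma ac_chasles a x y g : mu.-integrable `[a, y] (EFin \o g) -> a <= x -> x <= y ->
  \int[mu]_(t in `[a, y]) g t - \int[mu]_(t in `[a, x]) g t =
  \int[mu]_(t in `[x, y]) g t.
Proof.
move=> ig ax xy; rewrite Rintegral_itvB ?bnd_simp//.
rewrite Rintegral_itv_obnd_cbnd//.
apply: integrableS ig => // z /=; rewrite !in_itv/= => /andP[xz ->].
by rewrite (le_trans ax (ltW xz)).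
Qed.

Lemma ac_primitive_itv a b g : mu.-integrable `[a, b] (EFin \o g) ->
  ac `[a, b] (fun x => \int[mu]_(t in `[a, x]) g t) g.
Proof.
move=> ig s t st sub.
have /andP[as_ sb] : a <= s <= b by have := sub _ (memL st); rewrite /= in_itv.
have /andP[at_ tb] : a <= t <= b by have := sub _ (memR st); rewrite /= in_itv.
split; first by apply: integrableS ig.
by rewrite ac_chasles//; apply: integrableS ig => //; exact: itvcc_sub.
Qed.

(** The oriented integral from 0: intervals carry no orientation, hence the sign on the left of
    0. *)
Definition primitive g x : R :=
  if 0 <= x then \int[mu]_(t in `[0, x]) g t else - \int[mu]_(t in `[x, 0]) g t.

Lemma primitive0 g : primitive g 0 = 0.
Proof. by rewrite /primitive lexx set_itv1 Rintegral_set1. Qed.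

Lemma ac_primitive g : locint setT g -> ac setT (primitive g) g.
Proof.
move=> ig a b ab _; split; first exact: ig.
have igab s t : s <= t -> mu.-integrable `[s, t] (EFin \o g) by move=> st; exact: ig.
rewrite /primitive; case: ifPn => [b0|]; case: ifPn => [a0|].
- by rewrite ac_chasles ?igab.
- rewrite -ltNge => a0; rewrite opprK -(@ac_chasles a 0 b)//; last exact: ltW.
    ring.
  exact: igab.
- by rewrite -ltNge => b0; have := lt_le_trans b0 a0; lra.
- rewrite -!ltNge => a0 b0; rewrite -(@ac_chasles a b 0)//; last exact: ltW.
    ring.
  by apply: igab; exact: ltW.
Qed.

Lemma ac_le D f F g G a b : a <= b -> `[a, b] `<=` D -> ac D f F -> ac D g G ->
  (forall x, a <= x <= b -> F x <= G x) -> f b - f a <= g b - g a.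
Proof.
move=> ab abD hf hg FG.
have [iF ->] := hf _ _ ab abD; have [iG ->] := hg _ _ ab abD.
apply: le_Rintegral => // x; exact: FG.
Qed.

Lemma ac_le_norm D f F g G a b : a <= b -> `[a, b] `<=` D -> ac D f F -> ac D g G ->
  (forall x, a <= x <= b -> `|F x| <= G x) -> `|f b - f a| <= g b - g a.
Proof.
move=> ab abD hf hg FG; rewrite ler_norml; apply/andP; split.
  rewrite lerNl.
  have -> : - (f b - f a) = - f b - - f a by ring.
  apply: (ac_le ab abD (acN hf) hg) => x xab.
  by apply: le_trans (FG x xab); rewrite -normrN ler_norm.
apply: (ac_le ab abD hf hg) => x xab.
by apply: le_trans (FG x xab); rewrite ler_norm.
Qed.

Lemma ac_mono D f F a b : a <= b -> `[a, b] `<=` D -> ac D f F ->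
  (forall x, a <= x <= b -> 0 <= F x) -> f a <= f b.
Proof.
move=> ab abD hf F0; rewrite -subr_ge0 -[X in X <= _](subrr 0).
exact: ac_le ab abD (@ac_cst _ 0) hf F0.
Qed.

Lemma ac_const a b f : a <= b -> ac `[a, b] f (fun=> 0) -> f b = f a.
Proof.
move=> ab hf; have [_] := hf _ _ ab (fun=> id).
by rewrite Rintegral_cst// mul0r => /eqP; rewrite subr_eq0 => /eqP.
Qed.

Lemma ae_mono (P Q : R -> Prop) : {ae mu, forall x, P x} ->
  (forall x, P x -> Q x) -> {ae mu, forall x, Q x}.
Proof. by move=> h PQ; apply: negligibleS h => x /= nQ Px; apply/nQ/PQ. Qed.

Lemma ac_ae D f F G : (forall a b, a <= b -> `[a, b] `<=` D ->
    measurable_fun `[a, b] G) ->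
  {ae mu, forall x, D x -> F x = G x} -> ac D f F -> ac D f G.
Proof.
move=> mG FG hf a b ab abD; have [iF fE] := hf a b ab abD.
have mGab := mG a b ab abD.
have mF : measurable_fun `[a, b] F.
  by have /integrableP[/measurable_EFinP] := iF.
have FGab : ae_eq mu (`[a, b]%classic) (EFin \o F) (EFin \o G).
  by apply: (@ae_mono (fun x => D x -> F x = G x) _ FG) => x h xab /=; rewrite h//; exact: abD.
split.
  apply/integrableP; split; first exact/measurable_EFinP.
  have /integrableP[_] := iF; congr (_ < _)%E.
  apply: ae_eq_integral => //.
  - by apply: measurableT_comp => //; exact/measurable_EFinP.
  - by apply: measurableT_comp => //; exact/measurable_EFinP.
  - apply: (@ae_mono (fun x => `[a, b]%classic x -> (F x)%:E = (G x)%:E) _ FGab).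
    by move=> x h xab /=; have /= [->] := h xab.
rewrite fE /Rintegral; congr fine; apply: ae_eq_integral => //.
- exact/measurable_EFinP.
- exact/measurable_EFinP.
Qed.

Lemma ac_ivt a b f F c : a <= b -> ac `[a, b] f F -> f a <= c <= f b ->
  exists2 x, a <= x <= b & f x = c.
Proof.
move=> ab hf /andP[ac_ cb].
have [|x xab fx] := @IVT R f a b c ab (ac_continuous_itv ab hf).
  by rewrite ge_min ac_ le_max cb orbT.
by exists x => //; move: xab; rewrite in_itv.
Qed.

(* The defect of the product rule is additive and bounded by the square of
   the variation; bisecting the variation halves this bound. *)
Lemma additive_sqr_bound0 (V : R -> R) (W : R -> R) (H : R -> R -> R) a b :
  a <= b -> ac `[a, b] V W ->
  (forall x, a <= x <= b -> 0 <= W x) ->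
  (forall s t u, a <= s -> s <= t -> t <= u -> u <= b -> H s u = H s t + H t u) ->
  (forall s t, a <= s -> s <= t -> t <= b -> `|H s t| <= (V t - V s) ^+ 2) ->
  H a b = 0.
Proof.
move=> ab hV W0 Hadd Hle.
have key n : forall s t, a <= s -> s <= t -> t <= b ->
    `|H s t| <= (V t - V s) ^+ 2 / 2 ^+ n.
  elim: n => [|n IH] s t as_ st tb; first by rewrite expr0 divr1; exact: Hle.
  have sub : `[s, t] `<=` `[a, b] by exact: itvcc_sub.
  have Vst : V s <= V t.
    apply: (ac_mono st sub hV) => x /andP[sx xt].
    by apply: W0; rewrite (le_trans as_ sx) (le_trans xt tb).
  have [|m /andP[sm mt] Vm] := ac_ivt st (ac_sub sub hV) (c := (V s + V t) / 2).
    by apply/andP; split; lra.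
  rewrite (Hadd s m t)//.
  have h1 := IH s m as_ sm (le_trans mt tb).
  have h2 := IH m t (le_trans as_ sm) mt tb.
  apply: le_trans (ler_normD _ _) _; apply: le_trans (lerD h1 h2) _.
  rewrite Vm [2 ^+ n.+1]exprS invfM; set z := (2 ^+ n)^-1.
  rewrite le_eqVlt; apply/orP; left; apply/eqP; by field.
have h0 : `|H a b| <= 0.
  apply/ler_addgt0Pl => e e0; rewrite addr0.
  set v := (V b - V a) ^+ 2.
  have v0 : 0 <= v by exact: sqr_ge0.
  pose n := Num.truncn (v / e).
  apply: le_trans (key n.+1 a b (lexx _) ab (lexx _)) _.
  rewrite -/v ler_pdivrMr ?exprn_gt0// mulrC -ler_pdivrMr//.
  apply: (@le_trans _ _ n.+1%:R); first by apply/ltW; rewrite truncnS_gt.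
  by rewrite -natrX ler_nat; apply: ltnW; exact: ltn_expl.
by apply/eqP; rewrite -normr_le0.
Qed.

(** With [P] the primitive of the expected derivative, the defect [H s t] of the product rule is
    additive in the interval; [additive_sqr_bound0] makes it vanish, the variation being the
    primitive [V] of [|F| + |G|]. *)
Lemma acM D f g F G : ac D f F -> ac D g G ->
  ac D (fun x => f x * g x) (fun x => F x * g x + f x * G x).
Proof.
move=> hf hg a b ab abD.
have {}hf := ac_sub abD hf; have {}hg := ac_sub abD hg.
have cf := ac_continuous_itv ab hf; have cg := ac_continuous_itv ab hg.
pose K x := F x * g x + f x * G x.
have lK : locint `[a, b] K.
  apply: locintD; last exact: locint_acM hf (ac_locint hg).
  have := locint_acM hg (ac_locint hf); congr locint.
  by apply/funext => x; rewrite mulrC.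
have iK : mu.-integrable `[a, b] (EFin \o K) by exact: lK.
split => //.
pose P x := \int[mu]_(t in `[a, x]) K t.
have hP : ac `[a, b] P K by exact: ac_primitive_itv.
pose W x := `|F x| + `|G x|.
have lW : locint `[a, b] W.
  by apply: locintD; apply: locint_norm; apply: ac_locint; [exact: hf|exact: hg].
pose V x := \int[mu]_(t in `[a, x]) W t.
have hV : ac `[a, b] V W by apply: ac_primitive_itv; exact: lW.
have -> : \int[mu]_(x in `[a, b]) (F x * g x + f x * G x) = P b - P a.
  by rewrite /P set_itv1 Rintegral_set1 subr0.
apply/eqP; rewrite -subr_eq0; apply/eqP.
pose H s t := f t * g t - f s * g s - (P t - P s).
apply: (@additive_sqr_bound0 V W H) => //.
- by move=> x _; rewrite addr_ge0.
- by move=> s t u _ _ _ _; rewrite /H; ring.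
move=> s t as_ st tb.
have sub : `[s, t] `<=` `[a, b] by exact: itvcc_sub.
(* [H s t] is the increment of an absolutely continuous function whose
   derivative only involves the oscillations of [f] and [g] on [s, t]. *)
pose h x := f t * g x + g s * f x - P x.
have hh : ac `[a, b] h (fun x => f t * G x + g s * F x - K x).
  by apply: acB => //; apply: acD; apply: acZ.
have -> : H s t = h t - h s by rewrite /H /h; ring.
(* Read as the increment of [(V t - V s) * V], the bound can be compared derivative by derivative:
   one factor bounds the oscillation of [f] and [g], the other integrates [|F| + |G|]. *)
have -> : (V t - V s) ^+ 2 = (V t - V s) * V t - (V t - V s) * V s by ring.
apply: (ac_le_norm st sub hh (acZ (V t - V s) hV)) => x /andP[sx xt].
have sub1 : `[x, t] `<=` `[a, b] by exact: itvcc_sub (le_trans as_ sx) tb.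
have sub2 : `[s, x] `<=` `[a, b] by exact: itvcc_sub as_ (le_trans xt tb).
have mono y z : a <= y -> y <= z -> z <= b -> V y <= V z.
  move=> ay yz zb; apply: (ac_mono yz (itvcc_sub ay zb) hV) => u _.
  by rewrite addr_ge0.
have fx : `|f t - f x| <= V t - V s.
  apply: (@le_trans _ _ (V t - V x)).
    by apply: (ac_le_norm xt sub1 hf hV) => u _; rewrite lerDl.
  by rewrite lerD2l lerN2 mono// (le_trans xt tb).
have gx : `|g s - g x| <= V t - V s.
  apply: (@le_trans _ _ (V x - V s)).
    rewrite distrC; apply: (ac_le_norm sx sub2 hg hV) => u _.
    by rewrite lerDr.
  by rewrite lerD2r mono// (le_trans as_ sx).
have -> : f t * G x + g s * F x - K x = (f t - f x) * G x + (g s - g x) * F x.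
  by rewrite /K; ring.
apply: le_trans (ler_normD _ _) _; rewrite !normrM /W mulrDr addrC.
by apply: lerD; apply: ler_wpM2r.
Qed.

Lemma ac_derive D f g : (forall x, is_derive x (1 : R) f (g x)) -> continuous g ->
  ac D f g.
Proof.
move=> df cg a b ab _.
have ig : mu.-integrable `[a, b] (EFin \o g) := continuous_locint cg ab (fun=> id).
split => //; move: ab; rewrite le_eqVlt => /predU1P[<-|ab].
  by rewrite set_itv1 Rintegral_set1 subrr.
have cf x : {for x, continuous f}.
  apply: differentiable_continuous; apply/derivable1_diffP.
  by have [] := df x.
rewrite /Rintegral (@continuous_FTC2 _ g f)//.
- exact: continuous_subspaceT.
- split.
  + by move=> x _; have [] := df x.
  + by apply: cvg_at_right_filter; exact: cf.
  + by apply: cvg_at_left_filter; exact: cf.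
- by move=> x _; rewrite derive1E; have [_] := df x.
Qed.

Lemma ac_linear D (l : R) : ac D (fun x => l * x) (fun=> l).
Proof.
apply: ac_derive => [x|x]; last exact: cvg_cst.
have := @is_derive_id _ _ x (1 : R).
move=> h; have := is_deriveZ l h.
by rewrite /GRing.scale/= mulr1.
Qed.

Lemma Rintegral_dominated a b (F_ : nat -> R -> R) F (B : R -> R) :
  (forall n, measurable_fun `[a, b] (F_ n)) -> mu.-integrable `[a, b] (EFin \o B) ->
  (forall n x, a <= x <= b -> `|F_ n x| <= B x) ->
  (forall x, a <= x <= b -> (fun n => F_ n x) @ \oo --> F x) ->
  mu.-integrable `[a, b] (EFin \o F) /\
  (fun n => \int[mu]_(x in `[a, b]) F_ n x) @ \oo --> \int[mu]_(x in `[a, b]) F x.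
Proof.
move=> mFn iB FB cF.
have inab x : `[a, b]%classic x -> a <= x <= b by rewrite /= in_itv.
have mF : measurable_fun `[a, b] F.
  by apply: (@measurable_fun_cvg _ _ _ _ F_) => // x /inab; exact: cF.
have [|||||iF _ cvI] := @dominated_convergence _ _ _ mu `[a, b]%classic
  (measurable_itv _) (fun n => EFin \o F_ n) (EFin \o F) (EFin \o B).
- by move=> n; apply/measurable_EFinP; exact: mFn.
- exact/measurable_EFinP.
- by apply: aeW => x /inab xab; apply/fine_cvgP; split; [exact: nearW|exact: cF].
- exact: iB.
- by apply: aeW => x n /inab xab; rewrite /= lee_fin FB.
split => //.
by apply: fine_cvg; rewrite fineK//; apply: integrable_fin_num.
Qed.

Lemma ac_lim D (f_ F_ : nat -> R -> R) f F (B : R -> R) :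
  (forall n, ac D (f_ n) (F_ n)) -> locint D B ->
  (forall n x, D x -> `|F_ n x| <= B x) ->
  (forall x, D x -> (fun n => f_ n x) @ \oo --> f x) ->
  (forall x, D x -> (fun n => F_ n x) @ \oo --> F x) ->
  ac D f F.
Proof.
move=> hn lB FB cf cF a b ab abD.
have abD' x : a <= x <= b -> D x by move=> xab; apply: abD; rewrite /= in_itv.
have [||||iF c2] := @Rintegral_dominated a b F_ F B.
- by move=> n; have [/integrableP[/measurable_EFinP]] := hn n a b ab abD.
- exact: lB.
- by move=> n x /abD'; exact: FB.
- by move=> x /abD'; exact: cF.
split => //.
have c1 : (fun n => f_ n b - f_ n a) @ \oo --> f b - f a.
  by apply: cvgB; apply: cf; apply: abD; [exact: memR|exact: memL].
have e : (fun n => f_ n b - f_ n a) = (fun n => \int[mu]_(x in `[a, b]) F_ n x).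
  by apply/funext => n; have [_] := hn n a b ab abD.
by rewrite e in c1; exact: cvg_unique c1 c2.
Qed.

Lemma ac_sqr_locint D f F : ac setT f F -> locint D (fun x => f x ^+ 2).
Proof.
move=> hf; have := ac_continuous (acM hf hf) => cf.
by apply: continuous_locint => x; have := cf x; under eq_fun do rewrite -expr2.
Qed.

Section ChangeOfVariable.
Variable phi : R -> measurableTypeR R.
Hypothesis mphi : measurable_fun setT phi.
Hypothesis phi_mu : forall A, measurable A -> pushforward mu phi A = mu A.

Lemma integral_comp A g : measurable A -> mu.-integrable A (EFin \o g) ->
  mu.-integrable (phi @^-1` A) (EFin \o (g \o phi)) /\
  \int[mu]_(x in phi @^-1` A) g (phi x) = \int[mu]_(x in A) g x.
Proof.
move=> mA ig.
have mA' : measurable (phi @^-1` A).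
  by rewrite -[X in measurable X]setTI; exact: mphi.
have mg : measurable_fun A g by have /integrableP[/measurable_EFinP] := ig.
(* Extended by zero off [A], the function is measurable on the whole line, so that its composition
   with [phi] is measurable too. *)
have mgT : measurable_fun setT (g \_ A) by apply/(measurable_restrictT g).
have eqA : {in A, EFin \o g =1 EFin \o g \_ A}.
  by move=> x xA /=; rewrite patchE xA.
have eqA' : {in phi @^-1` A, EFin \o (g \o phi) =1 (EFin \o g \_ A) \o phi}.
  by move=> x /set_mem xA /=; rewrite patchE mem_set.
have mEg : measurable_fun setT (EFin \o g \_ A) by exact/measurable_EFinP.
have ig' : mu.-integrable (phi @^-1` A) ((EFin \o g \_ A) \o phi).
  apply/integrableP; split.
    by apply: measurable_funTS; apply: measurableT_comp.
  have -> : (\int[mu]_(x in phi @^-1` A) `|((EFin \o g \_ A) \o phi) x|)%E =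
      (\int[pushforward mu phi]_(x in A) `|(EFin \o g \_ A) x|)%E.
    rewrite ge0_integral_pushforward//.
    by apply: measurable_funTS; apply: measurableT_comp.
  have -> : (\int[pushforward mu phi]_(x in A) `|(EFin \o g \_ A) x|)%E =
      (\int[mu]_(x in A) `|(EFin \o g \_ A) x|)%E.
    by apply: eq_measure_integral => //= B mB _; exact: phi_mu.
  have /integrableP[_] := ig; congr (_ < _)%E.
  by apply: eq_integral => x xA; rewrite eqA.
split; first by apply: eq_integrable ig' => // x xA; rewrite eqA'.
rewrite /Rintegral; congr fine.
transitivity (\int[mu]_(x in phi @^-1` A) ((EFin \o g \_ A) \o phi) x)%E.
  by apply: eq_integral => x xA; rewrite -eqA'.
rewrite -integral_pushforward//.
transitivity (\int[mu]_(x in A) ((EFin \o g \_ A) x))%E.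
  by apply: eq_measure_integral => //= B mB _; exact: phi_mu.
by apply: eq_integral => x xA; rewrite -eqA.
Qed.

End ChangeOfVariable.

Lemma measurable_shift c : measurable_fun setT (fun x : R => x + c).
Proof. by apply: measurable_funD => //; exact: measurable_cst. Qed.

Lemma lebesgue_measure_shift c (A : set R) : measurable A ->
  pushforward mu ((fun x => x + c) : R -> measurableTypeR R) A = mu A.
Proof.
move=> mA; apply/esym/lebesgue_measure_unique => //=; first exact: measurable_shift.
move=> _ _ [[s t] /= _ <-]; rewrite /pushforward.
have -> : (fun x => x + c) @^-1` `]s, t]%classic = `]s - c, t - c]%classic.
  apply/seteqP; split => x /=; rewrite !in_itv/= => /andP[? ?];
    by apply/andP; split; lra.
rewrite !lebesgue_measure_itv/= !lte_fin ltrD2r -!EFinB.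
by case: ifP => // _; congr (_%:E); lra.
Qed.

Lemma preimage_shift c a b : (fun x : R => x + c) @^-1` `[a, b]%classic = `[a - c, b - c]%classic.
Proof.
apply/seteqP; split => x /=; rewrite !in_itv/= => /andP[? ?];
  by apply/andP; split; lra.
Qed.

Lemma preimage_opp a b : (fun x : R => - x) @^-1` `[a, b]%classic = `[- b, - a]%classic.
Proof.
apply/seteqP; split => x /=; rewrite !in_itv/= => /andP[? ?];
  by apply/andP; split; lra.
Qed.

Lemma integral_shift c a b g : mu.-integrable `[a, b] (EFin \o g) ->
  mu.-integrable `[a - c, b - c] (EFin \o (fun x => g (x + c))) /\
  \int[mu]_(x in `[a - c, b - c]) g (x + c) = \int[mu]_(x in `[a, b]) g x.
Proof.
move=> ig.
have := integral_comp (measurable_shift c) (@lebesgue_measure_shift c)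
  (measurable_itv _) ig.
by rewrite preimage_shift.
Qed.

Lemma integral_opp a b g : mu.-integrable `[a, b] (EFin \o g) ->
  mu.-integrable `[- b, - a] (EFin \o (fun x => g (- x))) /\
  \int[mu]_(x in `[- b, - a]) g (- x) = \int[mu]_(x in `[a, b]) g x.
Proof.
move=> ig.
have := integral_comp (@oppr_measurable R setT) (@lebesgue_measureN R)
  (measurable_itv _) ig.
by rewrite preimage_opp.
Qed.

Lemma ac_shift c f g : ac setT f g ->
  ac setT (fun x => f (x + c)) (fun x => g (x + c)).
Proof.
move=> h a b ab _; have [ig fE] := h (a + c) (b + c) (lerD ab (lexx _)) (@subsetT _ _).
by have := integral_shift c ig; rewrite !addrK fE => -[? ->].
Qed.

Lemma ac_opp f g : ac setT f g ->
  ac setT (fun x => f (- x)) (fun x => - g (- x)).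
Proof.
move=> h a b ab _; have ba : - b <= - a by rewrite lerN2.
have [ig fE] := h _ _ ba (@subsetT _ _).
have := integral_opp ig; rewrite !opprK => -[ig' gE].
split; first exact: (@integrableN _ _ _ mu _ (EFin \o (fun x => g (- x)))).
have := @RintegralZl _ _ _ mu `[a, b]%classic (fun x => g (- x)) (-1)
  (measurable_itv _) ig'.
have -> : (fun x => - g (- x)) = (fun x => -1 * g (- x)).
  by apply/funext => x; rewrite mulN1r.
by move=> ->; rewrite gE -fE; ring.
Qed.

End AbsolutelyContinuous.

(** * Complex-valued absolutely continuous functions *)

Section ComplexAC.
Context {R : realType}.
Local Notation mu := (@lebesgue_measure R).
Implicit Types (D : set R) (z w : R[i]) (f g F G : R -> R[i]).

Lemma cReD z w : complex.Re (z + w) = complex.Re z + complex.Re w.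
Proof. by case: z; case: w. Qed.

Lemma cImD z w : complex.Im (z + w) = complex.Im z + complex.Im w.
Proof. by case: z; case: w. Qed.

Lemma cReN z : complex.Re (- z) = - complex.Re z.
Proof. by case: z. Qed.

Lemma cImN z : complex.Im (- z) = - complex.Im z.
Proof. by case: z. Qed.

Lemma cReM z w : complex.Re (z * w) =
  complex.Re z * complex.Re w - complex.Im z * complex.Im w.
Proof. by case: z; case: w. Qed.

Lemma cImM z w : complex.Im (z * w) =
  complex.Re z * complex.Im w + complex.Im z * complex.Re w.
Proof. by case: z; case: w => *; rewrite /=; ring. Qed.

Lemma complex_ext z w : complex.Re z = complex.Re w ->
  complex.Im z = complex.Im w -> z = w.
Proof. by case: z; case: w => a b c d /= -> ->. Qed.

Lemma Re_sum (I : Type) (s : seq I) (P : pred I) (t : I -> R[i]) :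
  complex.Re (\sum_(i <- s | P i) t i) = \sum_(i <- s | P i) complex.Re (t i).
Proof. by elim/big_ind2 : _ => // x1 x2 y1 y2 <- <-; rewrite cReD. Qed.

Lemma Im_sum (I : Type) (s : seq I) (P : pred I) (t : I -> R[i]) :
  complex.Im (\sum_(i <- s | P i) t i) = \sum_(i <- s | P i) complex.Im (t i).
Proof. by elim/big_ind2 : _ => // x1 x2 y1 y2 <- <-; rewrite cImD. Qed.

(* The l1 norm: real and imaginary parts are estimated separately. *)
Definition cn z : R := `|complex.Re z| + `|complex.Im z|.

Lemma cn_ge0 z : 0 <= cn z. Proof. exact: addr_ge0. Qed.

Lemma cn0 : cn 0 = 0. Proof. by rewrite /cn /= normr0 addr0. Qed.

Lemma cn1 : cn 1 = 1. Proof. by rewrite /cn /= normr0 addr0 normr1. Qed.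


Lemma cnD z w : cn (z + w) <= cn z + cn w.
Proof.
rewrite /cn cReD cImD; have := ler_normD (complex.Re z) (complex.Re w).
have := ler_normD (complex.Im z) (complex.Im w); lra.
Qed.

Lemma cnN z : cn (- z) = cn z.
Proof. by rewrite /cn cReN cImN !normrN. Qed.

Lemma cnM z w : cn (z * w) <= cn z * cn w.
Proof.
rewrite /cn cReM cImM mulrDl !mulrDr.
have h1 := ler_normB (complex.Re z * complex.Re w) (complex.Im z * complex.Im w).
have h2 := ler_normD (complex.Re z * complex.Im w) (complex.Im z * complex.Re w).
by move: h1 h2; rewrite !normrM; lra.
Qed.

Lemma cnX z n : cn (z ^+ n) <= cn z ^+ n.
Proof.
elim: n => [|n IH]; first by rewrite !expr0 cn1.
by rewrite !exprS (le_trans (cnM _ _))// ler_wpM2l ?cn_ge0.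
Qed.

Lemma cn_Re z : `|complex.Re z| <= cn z. Proof. by rewrite lerDl. Qed.

Lemma cn_Im z : `|complex.Im z| <= cn z. Proof. by rewrite lerDr. Qed.

Lemma cn_i z : cn ('i%C * z) = cn z.
Proof. by rewrite /cn cReM cImM /= !mul0r !mul1r sub0r add0r normrN addrC. Qed.

Lemma cn_realM (r : R) z : cn (r%:C * z) = `|r| * cn z.
Proof. by rewrite /cn cReM cImM /= !mul0r subr0 addr0 !normrM mulrDr. Qed.

Lemma cn_sum (I : Type) (s : seq I) (P : pred I) (t : I -> R[i]) :
  cn (\sum_(i <- s | P i) t i) <= \sum_(i <- s | P i) cn (t i).
Proof.
elim/big_ind2 : _ => [|x1 x2 y1 y2 h1 h2|//]; first by rewrite cn0.
exact: le_trans (cnD _ _) (lerD h1 h2).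
Qed.

Lemma ac_derivativeP D f g : ac_derivative D f g <->
  ac D (fun x => complex.Re (f x)) (fun x => complex.Re (g x)) /\
  ac D (fun x => complex.Im (f x)) (fun x => complex.Im (g x)).
Proof.
split=> [h|[h1 h2] a b ab abD].
  split=> a b ab abD; have [[i1 i2] e] := h a b ab abD.
  - by split => //; rewrite -cReN -cReD e.
  - by split => //; rewrite -cImN -cImD e.
have [i1 e1] := h1 a b ab abD; have [i2 e2] := h2 a b ab abD.
by split => //; apply: complex_ext; rewrite ?cReD ?cReN ?cImD ?cImN /=.
Qed.

Lemma cac_sub D D' f g : D' `<=` D -> ac_derivative D f g -> ac_derivative D' f g.
Proof.
by move=> DD /ac_derivativeP[h1 h2]; apply/ac_derivativeP; split; exact: ac_sub DD _.
Qed.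

Lemma cac_eq D f g F G : (forall x, D x -> f x = F x) ->
  (forall x, D x -> g x = G x) -> ac_derivative D f g -> ac_derivative D F G.
Proof.
move=> fF gG /ac_derivativeP[h1 h2]; apply/ac_derivativeP; split.
  by apply: ac_eq h1 => x Dx; rewrite ?fF ?gG.
by apply: ac_eq h2 => x Dx; rewrite ?fF ?gG.
Qed.

Lemma cac_cst D (c : R[i]) : ac_derivative D (fun=> c) (fun=> 0).
Proof. by apply/ac_derivativeP; split; exact: ac_cst. Qed.

Lemma cacD D f g F G : ac_derivative D f F -> ac_derivative D g G ->
  ac_derivative D (fun x => f x + g x) (fun x => F x + G x).
Proof.
move=> /ac_derivativeP[h1 h2] /ac_derivativeP[k1 k2]; apply/ac_derivativeP; split.
  by apply: ac_eq (acD h1 k1) => x _; rewrite cReD.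
by apply: ac_eq (acD h2 k2) => x _; rewrite cImD.
Qed.

Lemma cacN D f F : ac_derivative D f F ->
  ac_derivative D (fun x => - f x) (fun x => - F x).
Proof.
move=> /ac_derivativeP[h1 h2]; apply/ac_derivativeP; split.
  by apply: ac_eq (acN h1) => x _; rewrite cReN.
by apply: ac_eq (acN h2) => x _; rewrite cImN.
Qed.

Lemma cacM D f g F G : ac_derivative D f F -> ac_derivative D g G ->
  ac_derivative D (fun x => f x * g x) (fun x => F x * g x + f x * G x).
Proof.
move=> /ac_derivativeP[h1 h2] /ac_derivativeP[k1 k2]; apply/ac_derivativeP; split.
  apply: ac_eq (acB (acM h1 k1) (acM h2 k2)) => x _; first by rewrite cReM.
  by rewrite cReD !cReM; ring.
apply: ac_eq (acD (acM h1 k2) (acM h2 k1)) => x _; first by rewrite cImM.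
by rewrite cImD !cImM; ring.
Qed.

Lemma cacZ D (c : R[i]) f F : ac_derivative D f F ->
  ac_derivative D (fun x => c * f x) (fun x => c * F x).
Proof.
move=> /(cacM (@cac_cst D c)); apply: cac_eq => // x _.
by rewrite mul0r add0r.
Qed.

Lemma cac_sum D (I : Type) (s : seq I) (f F : I -> R -> R[i]) :
  (forall i, ac_derivative D (f i) (F i)) ->
  ac_derivative D (fun x => \sum_(i <- s) f i x) (fun x => \sum_(i <- s) F i x).
Proof.
move=> h; elim: s => [|i s IH].
  by apply: cac_eq (@cac_cst D 0) => x _; rewrite big_nil.
by apply: cac_eq (cacD (h i) IH) => x _; rewrite big_cons.
Qed.

Lemma cac_real D (f F : R -> R) : ac D f F ->
  ac_derivative D (fun x => (f x)%:C) (fun x => (F x)%:C).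
Proof. by move=> h; apply/ac_derivativeP; split => //; exact: ac_cst. Qed.

Lemma cac_conj D f F : ac_derivative D f F ->
  ac_derivative D (fun x => conjc (f x)) (fun x => conjc (F x)).
Proof.
move=> /ac_derivativeP[h1 h2]; apply/ac_derivativeP; split.
  by apply: ac_eq h1 => x _ /=; [case: (f x)|case: (F x)].
by apply: ac_eq (acN h2) => x _ /=; [case: (f x)|case: (F x)].
Qed.

Lemma cac_shift c f F : ac_derivative setT f F ->
  ac_derivative setT (fun x => f (x + c)) (fun x => F (x + c)).
Proof.
move=> /ac_derivativeP[h1 h2]; apply/ac_derivativeP; split.
  exact: ac_shift h1.
exact: ac_shift h2.
Qed.

Lemma cac_opp f F : ac_derivative setT f F ->
  ac_derivative setT (fun x => f (- x)) (fun x => - F (- x)).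
Proof.
move=> /ac_derivativeP[h1 h2]; apply/ac_derivativeP; split.
  by apply: ac_eq (ac_opp h1) => x _ //; rewrite cReN.
by apply: ac_eq (ac_opp h2) => x _ //; rewrite cImN.
Qed.

Definition clocint D g := forall a b, a <= b -> `[a, b] `<=` D ->
  integrable_complex `[a, b] g.

Lemma clocintP D g : clocint D g <->
  locint D (fun x => complex.Re (g x)) /\ locint D (fun x => complex.Im (g x)).
Proof.
split=> [h|[h1 h2] a b ab abD]; last by split; [exact: h1|exact: h2].
by split=> a b ab abD; have [] := h a b ab abD.
Qed.

Lemma clocint_eq D f g : (forall x, f x = g x) -> clocint D f -> clocint D g.
Proof. by move=> /funext ->. Qed.


Lemma clocint_sub D D' g : D' `<=` D -> clocint D g -> clocint D' g.
Proof. by move=> DD h a b ab abD; apply: h => //; exact: subset_trans DD. Qed.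

Lemma clocintD D f g : clocint D f -> clocint D g ->
  clocint D (fun x => f x + g x).
Proof.
move=> /clocintP[h1 h2] /clocintP[k1 k2]; apply/clocintP; split.
  have := locintD h1 k1; congr locint; apply/funext => x; exact/esym/cReD.
have := locintD h2 k2; congr locint; apply/funext => x; exact/esym/cImD.
Qed.

Lemma clocintM D f F g : ac_derivative D f F -> clocint D g ->
  clocint D (fun x => f x * g x).
Proof.
move=> /ac_derivativeP[h1 h2] /clocintP[k1 k2]; apply/clocintP; split.
  have := locintD (locint_acM h1 k1) (locintZ (-1) (locint_acM h2 k2)).
  by congr locint; apply/funext => x; rewrite cReM mulN1r.
have := locintD (locint_acM h1 k2) (locint_acM h2 k1).
by congr locint; apply/funext => x; rewrite cImM.
Qed.

Lemma clocintZ D (c : R[i]) g : clocint D g -> clocint D (fun x => c * g x).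
Proof. exact: clocintM (@cac_cst D c). Qed.

Lemma clocint_cst D c : clocint D (fun=> c).
Proof. by apply/clocintP; split; exact: locint_cst. Qed.

Lemma clocint_cac D f F : ac_derivative D f F -> clocint D f.
Proof.
move=> h; have := clocintM h (@clocint_cst D 1).
by congr clocint; apply/funext => x; rewrite mulr1.
Qed.

Lemma locint_cn D g : clocint D g -> locint D (fun x => cn (g x)).
Proof.
by move=> /clocintP[h1 h2]; apply: locintD; apply: locint_norm.
Qed.

Definition cprimitive g x : R[i] :=
  primitive (fun t => complex.Re (g t)) x +i* primitive (fun t => complex.Im (g t)) x.

Lemma cprimitive0 g : cprimitive g 0 = 0.
Proof. by rewrite /cprimitive !primitive0. Qed.

Lemma cac_primitive g : clocint setT g -> ac_derivative setT (cprimitive g) g.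
Proof.
by move=> /clocintP[h1 h2]; apply/ac_derivativeP; split; exact: ac_primitive.
Qed.

Lemma clocint_measurable D g a b : clocint D g -> a <= b -> `[a, b] `<=` D ->
  measurable_complex `[a, b] g.
Proof.
move=> h ab /(h a b ab)[i1 i2].
by split; [have /integrableP[/measurable_EFinP] := i1
          |have /integrableP[/measurable_EFinP] := i2].
Qed.

Lemma cac_ae D f F G : clocint D G ->
  {ae mu, forall x, D x -> F x = G x} -> ac_derivative D f F -> ac_derivative D f G.
Proof.
move=> lG FG /ac_derivativeP[h1 h2]; apply/ac_derivativeP; split.
- apply: ac_ae h1.
    by move=> a b ab abD; have [] := clocint_measurable lG ab abD.
  apply: (@ae_mono _ (fun x => D x -> F x = G x)
    (fun x => D x -> complex.Re (F x) = complex.Re (G x)) FG).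
  by move=> x h Dx; rewrite h.
- apply: ac_ae h2.
    by move=> a b ab abD; have [] := clocint_measurable lG ab abD.
  apply: (@ae_mono _ (fun x => D x -> F x = G x)
    (fun x => D x -> complex.Im (F x) = complex.Im (G x)) FG).
  by move=> x h Dx; rewrite h.
Qed.

Lemma cac_const a b f : a <= b -> ac_derivative `[a, b] f (fun=> 0) -> f b = f a.
Proof.
move=> ab /ac_derivativeP[h1 h2]; apply: complex_ext.
  exact: ac_const ab h1.
exact: ac_const ab h2.
Qed.

(* The factor 2 comes from the l1 norm. *)
Lemma cac_le D f F (g G : R -> R) a b : a <= b -> `[a, b] `<=` D ->
  ac_derivative D f F -> ac D g G ->
  (forall x, a <= x <= b -> cn (F x) <= G x) -> cn (f b - f a) <= 2 * (g b - g a).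
Proof.
move=> ab abD /ac_derivativeP[h1 h2] hg FG.
have e1 : `|complex.Re (f b) - complex.Re (f a)| <= g b - g a.
  apply: ac_le_norm ab abD h1 hg _ => x xab.
  exact: le_trans (cn_Re _) (FG x xab).
have e2 : `|complex.Im (f b) - complex.Im (f a)| <= g b - g a.
  apply: ac_le_norm ab abD h2 hg _ => x xab.
  exact: le_trans (cn_Im _) (FG x xab).
by rewrite /cn cReD cReN cImD cImN; lra.
Qed.

Lemma cac_continuous f F : ac_derivative setT f F ->
  continuous (fun x => complex.Re (f x)) /\ continuous (fun x => complex.Im (f x)).
Proof.
by move=> /ac_derivativeP[h1 h2]; split; [exact: ac_continuous h1|exact: ac_continuous h2].
Qed.

End ComplexAC.

(** * Complex series and matrix functions *)

Section ComplexSequences.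
Context {R : realType}.
Implicit Types (u v t : nat -> R[i]) (s : R[i]).

Lemma cvg_le_const (u : nat -> R) l B : u @ \oo --> l -> (forall n, u n <= B) -> l <= B.
Proof.
move=> ul uB; rewrite -(cvg_lim _ ul)//; apply: limr_le; first exact: cvgP ul.
exact: nearW.
Qed.

Lemma eq_cvgn (u v : nat -> R) (l : R) : u =1 v -> u @ \oo --> l -> v @ \oo --> l.
Proof. by move=> /funext ->. Qed.

(** Componentwise convergence, in line with the l1 norm [cn]: limits and dominated convergence are
    only taken for real sequences. *)
Definition ccvg u s := (fun n => complex.Re (u n)) @ \oo --> complex.Re s /\
  (fun n => complex.Im (u n)) @ \oo --> complex.Im s.

Lemma ccvg_unique u s s' : ccvg u s -> ccvg u s' -> s = s'.
Proof.
move=> [a b] [c d]; apply: complex_ext; [exact: cvg_unique a c|exact: cvg_unique b d].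
Qed.

Lemma ccvg_cst s : ccvg (fun=> s) s.
Proof. by split; exact: cvg_cst. Qed.

Lemma ccvg_eq u v s : u =1 v -> ccvg u s -> ccvg v s.
Proof. by move=> /funext ->. Qed.

Lemma ccvgD u v s s' : ccvg u s -> ccvg v s' -> ccvg (fun n => u n + v n) (s + s').
Proof.
move=> [a b] [c d]; split.
  by rewrite cReD; apply: eq_cvgn (cvgD a c) => n /=; rewrite cReD.
by rewrite cImD; apply: eq_cvgn (cvgD b d) => n /=; rewrite cImD.
Qed.

Lemma ccvgM u v s s' : ccvg u s -> ccvg v s' -> ccvg (fun n => u n * v n) (s * s').
Proof.
move=> [a b] [c d]; split.
  by rewrite cReM; apply: eq_cvgn (cvgB (cvgM a c) (cvgM b d)) => n /=; rewrite cReM.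
by rewrite cImM; apply: eq_cvgn (cvgD (cvgM a d) (cvgM b c)) => n /=; rewrite cImM.
Qed.

Lemma ccvg_sum (I : Type) (r : seq I) (u : I -> nat -> R[i]) (s : I -> R[i]) :
  (forall i, ccvg (u i) (s i)) ->
  ccvg (fun n => \sum_(i <- r) u i n) (\sum_(i <- r) s i).
Proof.
move=> h; elim: r => [|i r IH].
  by rewrite big_nil; apply: ccvg_eq (ccvg_cst 0) => n; rewrite big_nil.
rewrite big_cons; apply: ccvg_eq (ccvgD (h i) IH) => n.
by rewrite big_cons.
Qed.

Lemma ccvg_le u s B : ccvg u s -> (forall n, cn (u n) <= B) -> cn s <= B.
Proof.
move=> [a b]; apply: cvg_le_const; apply: cvgD; exact: cvg_norm.
Qed.

Lemma ccvgS u s : ccvg u s -> ccvg (fun n => u n.+1) s.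
Proof. move=> [a b]; split.
  by have := a; rewrite -(cvg_shiftS (fun n => complex.Re (u n))).
by have := b; rewrite -(cvg_shiftS (fun n => complex.Im (u n))). Qed.

Definition csums t s := ccvg (fun N => \sum_(k < N) t k) s.

Lemma csums_eq t t' s : t =1 t' -> csums t s -> csums t' s.
Proof. by move=> /funext ->. Qed.

Lemma csums_unique t s s' : csums t s -> csums t s' -> s = s'.
Proof. exact: ccvg_unique. Qed.

Lemma csumsD t t' s s' : csums t s -> csums t' s' ->
  csums (fun k => t k + t' k) (s + s').
Proof.
by move=> h h'; apply: ccvg_eq (ccvgD h h') => N; rewrite big_split.
Qed.

Lemma csumsZ c t s : csums t s -> csums (fun k => c * t k) (c * s).
Proof.
by move=> h; apply: ccvg_eq (ccvgM (ccvg_cst c) h) => N; rewrite mulr_sumr.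
Qed.

Lemma csums_shift t s : csums (fun k => t k.+1) s -> csums t (t 0%N + s).
Proof.
move=> h.
have [a b] : ccvg (fun N => \sum_(k < N.+1) t k) (t 0%N + s).
  by apply: ccvg_eq (ccvgD (ccvg_cst _) h) => N; rewrite big_ord_recl.
split.
  by rewrite -(cvg_shiftS (fun N => complex.Re (\sum_(k < N) t k))).
by rewrite -(cvg_shiftS (fun N => complex.Im (\sum_(k < N) t k))).
Qed.

Lemma csums_exists t (b : nat -> R) : (forall k, cn (t k) <= b k) ->
  cvgn (series b) -> exists s, csums t s.
Proof.
move=> tb cb.
have b0 k : 0 <= b k by exact: le_trans (cn_ge0 _) (tb k).
have aux (u : nat -> R) : (forall k, `|u k| <= b k) -> exists l : R,
    (fun N => \sum_(k < N) u k) @ \oo --> l.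
  move=> ub; have := normed_cvg (series_le_cvg (fun=> normr_ge0 _) b0 ub cb).
  move=> /cvg_ex[l hl]; exists l; apply: eq_cvgn hl => N.
  by rewrite /series/= big_mkord.
have [x hx] := aux _ (fun k => le_trans (cn_Re _) (tb k)).
have [y hy] := aux _ (fun k => le_trans (cn_Im _) (tb k)).
exists (x +i* y); split.
  by apply: eq_cvgn hx => N; rewrite Re_sum.
by apply: eq_cvgn hy => N; rewrite Im_sum.
Qed.

Lemma csums_le t s B : csums t s -> (forall N, \sum_(k < N) cn (t k) <= B) -> cn s <= B.
Proof.
by move=> h hB; apply: ccvg_le h _ => N; exact: le_trans (cn_sum _ _ _) (hB N).
Qed.

Lemma exp_series_cvg (c x : R) : cvgn (series (fun k => c * (x ^+ k / k`!%:R))).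
Proof.
have := @is_cvg_seriesZ _ (exp_coeff x) c (is_cvg_series_exp_coeff x).
by congr (cvgn _).
Qed.

Lemma exp_series_le (c x : R) N : 0 <= c -> 0 <= x ->
  \sum_(k < N) c * (x ^+ k / k`!%:R) <= c * expR x.
Proof.
move=> c0 x0; rewrite -mulr_sumr ler_wpM2l//.
rewrite /expR; apply: le_trans (nondecreasing_cvgn_le _ (is_cvg_series_exp_coeff x) N).
  by rewrite /series/= big_mkord.
by apply: nondecreasing_series => k _ _; exact: exp_coeff_ge0.
Qed.

End ComplexSequences.

(** * Norms and calculus of matrix functions *)

Section MatrixNorm.
Context {R : realType}.
Variables (m n p : nat).
Implicit Types (M : 'M[R[i]]_(m, n)) (N : 'M[R[i]]_(n, p)).

(** The entrywise l1 norm: submultiplicative, and visibly locally integrable when the entries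
    are. *)
Definition mnorm (q r : nat) (M : 'M[R[i]]_(q, r)) : R := \sum_i \sum_j cn (M i j).

Lemma mnorm_ge0 M : 0 <= mnorm M.
Proof. by apply: sumr_ge0 => i _; apply: sumr_ge0 => j _; exact: cn_ge0. Qed.

Lemma mnorm_entry M i j : cn (M i j) <= mnorm M.
Proof.
rewrite /mnorm (bigD1 i)//= (bigD1 j)//= -addrA lerDl.
by apply: addr_ge0; [|apply: sumr_ge0 => k _]; apply: sumr_ge0 => l _; exact: cn_ge0.
Qed.

Lemma mnorm_le M B : (forall i j, cn (M i j) <= B) -> mnorm M <= (m * n)%:R * B.
Proof.
move=> h; apply: (@le_trans _ _ (\sum_(i < m) \sum_(j < n) B)).
  by apply: ler_sum => i _; apply: ler_sum.
by rewrite sumr_const card_ord sumr_const card_ord -mulrnA mulr_natl mulnC.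
Qed.

Lemma mnormM M N : mnorm (M *m N) <= mnorm M * mnorm N.
Proof.
rewrite /mnorm mulr_suml; apply: ler_sum => i _.
rewrite mulr_suml.
apply: (@le_trans _ _ (\sum_(j < p) \sum_(k < n) cn (M i k) * cn (N k j))).
  apply: ler_sum => j _; rewrite mxE; apply: le_trans (cn_sum _ _ _) _.
  by apply: ler_sum => k _; exact: cnM.
rewrite exchange_big/=; apply: ler_sum => k _.
rewrite -mulr_sumr ler_wpM2l ?cn_ge0// (bigD1 k)//= lerDl.
by apply: sumr_ge0 => l _; apply: sumr_ge0 => j _; exact: cn_ge0.
Qed.

Lemma mnormD M M' : mnorm (M + M') <= mnorm M + mnorm M'.
Proof.
rewrite /mnorm -big_split; apply: ler_sum => i _; rewrite -big_split.
by apply: ler_sum => j _; rewrite mxE; exact: cnD.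
Qed.

End MatrixNorm.

Section MatrixAC.
Context {R : realType}.
Local Notation mu := (@lebesgue_measure R).
Implicit Types (D : set R) (m n p : nat).

Definition mac m n D (F f : R -> 'M[R[i]]_(m, n)) :=
  forall i j, ac_derivative D (fun x => F x i j) (fun x => f x i j).

Definition mlocint m n D (f : R -> 'M[R[i]]_(m, n)) :=
  forall i j, clocint D (fun x => f x i j).

Lemma mac_sub m n D D' (F f : R -> 'M[R[i]]_(m, n)) : D' `<=` D ->
  mac D F f -> mac D' F f.
Proof. by move=> DD h i j; exact: cac_sub DD (h i j). Qed.

Lemma mac_eq m n D (F f G g : R -> 'M[R[i]]_(m, n)) :
  (forall x, D x -> F x = G x) -> (forall x, D x -> f x = g x) ->
  mac D F f -> mac D G g.
Proof.
move=> FG fg h i j; apply: cac_eq (h i j) => x Dx; first by rewrite FG.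
by rewrite fg.
Qed.

Lemma mac_cst m n D (C : 'M[R[i]]_(m, n)) : mac D (fun=> C) (fun=> 0).
Proof.
move=> i j; apply: cac_eq (@cac_cst _ D (C i j)) => x _ //.
by rewrite mxE.
Qed.

Lemma macD m n D (F f G g : R -> 'M[R[i]]_(m, n)) : mac D F f -> mac D G g ->
  mac D (fun x => F x + G x) (fun x => f x + g x).
Proof.
by move=> h k i j; apply: cac_eq (cacD (h i j) (k i j)) => x _; rewrite mxE.
Qed.

Lemma macN m n D (F f : R -> 'M[R[i]]_(m, n)) : mac D F f ->
  mac D (fun x => - F x) (fun x => - f x).
Proof. by move=> h i j; apply: cac_eq (cacN (h i j)) => x _; rewrite mxE. Qed.

Lemma macM m n p D (F f : R -> 'M[R[i]]_(m, n)) (G g : R -> 'M[R[i]]_(n, p)) :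
  mac D F f -> mac D G g ->
  mac D (fun x => F x *m G x) (fun x => f x *m G x + F x *m g x).
Proof.
move=> h k i j.
apply: cac_eq (@cac_sum _ D _ (index_enum 'I_n) _ _
  (fun l => cacM (h i l) (k l j))) => x _; rewrite !mxE//.
by rewrite big_split/=.
Qed.

Lemma macMl m n p D (C : 'M[R[i]]_(m, n)) (G g : R -> 'M[R[i]]_(n, p)) :
  mac D G g -> mac D (fun x => C *m G x) (fun x => C *m g x).
Proof.
by move=> h; apply: mac_eq (macM (@mac_cst _ _ D C) h) => // x _; rewrite mul0mx add0r.
Qed.

Lemma macMr m n p D (F f : R -> 'M[R[i]]_(m, n)) (C : 'M[R[i]]_(n, p)) :
  mac D F f -> mac D (fun x => F x *m C) (fun x => f x *m C).
Proof.
by move=> h; apply: mac_eq (macM h (@mac_cst _ _ D C)) => // x _; rewrite mulmx0 addr0.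
Qed.

Lemma macZ m n D (c c' : R -> R[i]) (F f : R -> 'M[R[i]]_(m, n)) :
  ac_derivative D c c' -> mac D F f ->
  mac D (fun x => c x *: F x) (fun x => c' x *: F x + c x *: f x).
Proof.
by move=> hc h i j; apply: cac_eq (cacM hc (h i j)) => x _; rewrite !mxE.
Qed.


Lemma mlocint_mac m n D (F f : R -> 'M[R[i]]_(m, n)) : mac D F f -> mlocint D F.
Proof. by move=> h i j; exact: clocint_cac (h i j). Qed.

Lemma mlocint_sub m n D D' (f : R -> 'M[R[i]]_(m, n)) : D' `<=` D ->
  mlocint D f -> mlocint D' f.
Proof. by move=> DD h i j; exact: clocint_sub DD (h i j). Qed.

Lemma clocint_sum D (I : Type) (s : seq I) (f : I -> R -> R[i]) :
  (forall i, clocint D (f i)) -> clocint D (fun x => \sum_(i <- s) f i x).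
Proof.
move=> h; elim: s => [|i s IH].
  by have := @clocint_cst _ D 0; congr clocint; apply/funext => x; rewrite big_nil.
by have := clocintD (h i) IH; congr clocint; apply/funext => x; rewrite big_cons.
Qed.

Lemma mlocintMl m n p D (A : R -> 'M[R[i]]_(m, n)) (F f : R -> 'M[R[i]]_(n, p)) :
  mlocint D A -> mac D F f -> mlocint D (fun x => A x *m F x).
Proof.
move=> hA hF i j.
have := @clocint_sum D _ (index_enum 'I_n) _ (fun l => clocintM (hF l j) (hA i l)).
congr clocint; apply/funext => x; rewrite mxE; apply: eq_bigr => l _.
exact: mulrC.
Qed.

Lemma mlocintMr m n p D (F f : R -> 'M[R[i]]_(m, n)) (A : R -> 'M[R[i]]_(n, p)) :
  mlocint D A -> mac D F f -> mlocint D (fun x => F x *m A x).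
Proof.
move=> hA hF i j.
have := @clocint_sum D _ (index_enum 'I_n) _ (fun l => clocintM (hF i l) (hA l j)).
by congr clocint; apply/funext => x; rewrite mxE.
Qed.

Lemma mlocintD m n D (f g : R -> 'M[R[i]]_(m, n)) : mlocint D f -> mlocint D g ->
  mlocint D (fun x => f x + g x).
Proof.
move=> hf hg i j; have := clocintD (hf i j) (hg i j).
by congr clocint; apply/funext => x; rewrite mxE.
Qed.

Lemma mlocintMc m n p D (C : 'M[R[i]]_(m, n)) (f : R -> 'M[R[i]]_(n, p)) :
  mlocint D f -> mlocint D (fun x => C *m f x).
Proof.
move=> h; exact: mlocintMr h (@mac_cst _ _ D C).
Qed.

Lemma locint_mnorm m n D (f : R -> 'M[R[i]]_(m, n)) : mlocint D f ->
  locint D (fun x => mnorm (f x)).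
Proof.
move=> h.
have aux (I : Type) (s : seq I) (g : I -> R -> R) : (forall i, locint D (g i)) ->
    locint D (fun x => \sum_(i <- s) g i x).
  move=> hg; elim: s => [|i s IH].
    by have := @locint_cst _ D 0; congr locint; apply/funext => x; rewrite big_nil.
  by have := locintD (hg i) IH; congr locint; apply/funext => x; rewrite big_cons.
by apply: (aux) => i; apply: (aux) => j; apply: locint_cn; exact: h.
Qed.

Lemma mlocintZ m n D z (f : R -> 'M[R[i]]_(m, n)) : mlocint D f ->
  mlocint D (fun x => z *: f x).
Proof.
by move=> h i j; apply: clocint_eq (clocintZ z (h i j)) => x; rewrite mxE.
Qed.

Lemma mac_ae m n D (F f g : R -> 'M[R[i]]_(m, n)) : mlocint D g ->
  {ae mu, forall x, D x -> f x = g x} -> mac D F f -> mac D F g.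
Proof.
move=> lg fg h i j; apply: cac_ae (h i j); first exact: lg.
apply: (@ae_mono _ (fun x => D x -> f x = g x)
  (fun x => D x -> f x i j = g x i j) fg) => x hx Dx.
by rewrite hx.
Qed.

Lemma mac_primitive m n (f : R -> 'M[R[i]]_(m, n)) : mlocint setT f ->
  mac setT (fun x => \matrix_(i, j) cprimitive (fun t => f t i j) x) f.
Proof.
move=> h i j; apply: cac_eq (cac_primitive (h i j)) => // x _.
by rewrite mxE.
Qed.

Lemma mac_const m n a b (F : R -> 'M[R[i]]_(m, n)) : a <= b ->
  mac `[a, b] F (fun=> 0) -> F b = F a.
Proof.
move=> ab h; apply/matrixP => i j.
apply: (@cac_const _ a b (fun x => F x i j)) => //.
by apply: cac_eq (h i j) => // x _; rewrite mxE.
Qed.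

(** The factor 2 is that of [cac_le], and [m * n] counts the entries, which are estimated one by
    one. *)
Lemma mac_le m n D (F f : R -> 'M[R[i]]_(m, n)) (g G : R -> R) a b : a <= b ->
  `[a, b] `<=` D -> mac D F f -> ac D g G ->
  (forall x, a <= x <= b -> mnorm (f x) <= G x) ->
  mnorm (F b - F a) <= (2 * (m * n))%:R * (g b - g a).
Proof.
move=> ab abD h hg fG; rewrite natrM mulrC mulrA mulrC.
apply: (@le_trans _ _ ((m * n)%:R * (2 * (g b - g a)))).
  apply: mnorm_le => i j.
  rewrite !mxE; apply: cac_le ab abD (h i j) hg _ => x xab.
  exact: le_trans (mnorm_entry _ _ _) (fG x xab).
by rewrite le_eqVlt; apply/orP; left; apply/eqP; ring.
Qed.

Lemma mac_shift m n c (F f : R -> 'M[R[i]]_(m, n)) : mac setT F f ->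
  mac setT (fun x => F (x + c)) (fun x => f (x + c)).
Proof. by move=> h i j; exact: cac_shift (h i j). Qed.

Lemma mac_opp m n (F f : R -> 'M[R[i]]_(m, n)) : mac setT F f ->
  mac setT (fun x => F (- x)) (fun x => - f (- x)).
Proof.
by move=> h i j; apply: cac_eq (cac_opp (h i j)) => x _ //; rewrite mxE.
Qed.

Lemma mac_conj m n D (F f : R -> 'M[R[i]]_(m, n)) : mac D F f ->
  mac D (fun x => map_mx conjc (F x)) (fun x => map_mx conjc (f x)).
Proof.
by move=> h i j; apply: cac_eq (cac_conj (h i j)) => x _; rewrite mxE.
Qed.

End MatrixAC.

(** * Linear systems and the Picard series *)

Section MatrixMisc.
Context {R : realType}.

Lemma ac_exprS D (L l : R -> R) k : ac D L l ->
  ac D (fun x => L x ^+ k.+1) (fun x => k.+1%:R * (L x ^+ k * l x)).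
Proof.
move=> hL; elim: k => [|k IH].
  by apply: ac_eq hL => x _; rewrite ?expr1 ?expr0 ?mul1r.
apply: ac_eq (acM hL IH) => x _; first by rewrite -exprS.
by rewrite [L x ^+ k.+1]exprS -[k.+2%:R]natr1; ring.
Qed.

Lemma mnorm1 n : mnorm (1%:M : 'M[R[i]]_n) = n%:R.
Proof.
rewrite /mnorm (eq_bigr (fun=> 1)) ?sumr_const ?card_ord// => i _.
rewrite (bigD1 i)//= big1 => [|j ji]; first by rewrite mxE eqxx addr0 cn1.
by rewrite mxE eq_sym (negbTE ji) cn0.
Qed.

Lemma mnormN m n (M : 'M[R[i]]_(m, n)) : mnorm (- M) = mnorm M.
Proof. by apply: eq_bigr => i _; apply: eq_bigr => j _; rewrite mxE cnN. Qed.

Lemma mnorm_sum m n (I : Type) (s : seq I) (M : I -> 'M[R[i]]_(m, n)) :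
  mnorm (\sum_(i <- s) M i) <= \sum_(i <- s) mnorm (M i).
Proof.
elim: s => [|i s IH]; last by rewrite !big_cons (le_trans (mnormD _ _))// lerD2l.
rewrite !big_nil /mnorm big1// => i _; rewrite big1// => j _.
by rewrite mxE cn0.
Qed.

Lemma mac_sum m n D (I : Type) (s : seq I) (F f : I -> R -> 'M[R[i]]_(m, n)) :
  (forall i, mac D (F i) (f i)) ->
  mac D (fun x => \sum_(i <- s) F i x) (fun x => \sum_(i <- s) f i x).
Proof.
move=> h; elim: s => [|i s IH].
  by apply: mac_eq (@mac_cst _ _ _ D 0) => x _; rewrite big_nil.
by apply: mac_eq (macD (h i) IH) => x _; rewrite big_cons.
Qed.

Lemma mac_unique m n (F G f : R -> 'M[R[i]]_(m, n)) : mac setT F f -> mac setT G f ->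
  F 0 = G 0 -> F =1 G.
Proof.
move=> hF hG FG0.
have h : mac setT (fun x => F x + - G x) (fun=> 0).
  by apply: mac_eq (macD hF (macN hG)) => x _ //; rewrite subrr.
move=> x; apply/eqP; rewrite -subr_eq0; apply/eqP.
have h0 : F 0 - G 0 = 0 by rewrite FG0 subrr.
have [x0|x0] := leP 0 x.
  by rewrite (mac_const x0 (mac_sub (@subsetT _ _) h)).
by rewrite -(mac_const (ltW x0) (mac_sub (@subsetT _ _) h)).
Qed.

End MatrixMisc.

Section Picard.
Context {R : realType}.
Variables (n : nat) (A : R -> 'M[R[i]]_n).
Hypothesis hA : mlocint setT A.

(** The terms of the Peano-Baker (Dyson) series of [Y' = A Y], [Y 0 = 1]. Single terms are kept
    rather than partial sums because the k-th one is homogeneous of degree k in [A]; see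
    [picardZ]. *)
Fixpoint picard (k : nat) (x : R) : 'M[R[i]]_n :=
  if k is k'.+1 then \matrix_(i, j) cprimitive (fun t => (A t *m picard k' t) i j) x
  else 1%:M.

Lemma mac_picard k : mac setT (picard k)
  (fun x => if k is k'.+1 then A x *m picard k' x else 0).
Proof.
elim: k => [|k IH]; first exact: mac_cst.
apply: mac_primitive; exact: mlocintMl hA IH.
Qed.

Lemma picard_at0 k : picard k.+1 0 = 0.
Proof. by apply/matrixP => i j; rewrite !mxE cprimitive0. Qed.

Definition mass : R -> R := primitive (fun t => mnorm (A t)).

Lemma ac_mass : ac setT mass (fun t => mnorm (A t)).
Proof. exact/ac_primitive/locint_mnorm. Qed.

Lemma mass0 : mass 0 = 0. Proof. exact: primitive0. Qed.

Lemma mass_mono x y : x <= y -> mass x <= mass y.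
Proof.
move=> xy.
by apply: (ac_mono xy (@subsetT _ _) ac_mass) => t _; exact: mnorm_ge0.
Qed.

(** The constant of [mac_le] for square matrices, paid once per integration. *)
Let K : R := (2 * (n * n))%:R.

(** Induction on [k] against the comparison function [c * mass ^+ k.+1], whose derivative is
    [c * (k.+1 * mass ^+ k * |A|)]; to the left of 0 the same is done with [- mass]. The leading [n]
    is the norm of the identity. *)
Lemma picard_bound k x :
  mnorm (picard k x) <= n%:R * ((K * `|mass x|) ^+ k / k`!%:R).
Proof.
elim: k x => [|k IH] x; first by rewrite /= mnorm1 expr0 fact0 divr1 mulr1.
have h := mac_picard k.+1.
have kN0 : k`!%:R != 0 :> R by rewrite pnatr_eq0 -lt0n fact_gt0.
have kSN0 : k.+1%:R != 0 :> R by rewrite pnatr_eq0.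
pose c : R := n%:R * (K ^+ k / k.+1`!%:R).
have cE : c * k.+1%:R = n%:R * (K ^+ k / k`!%:R).
  rewrite /c factS natrM; move: kN0 kSN0; move: (k`!%:R : R) (k.+1%:R : R).
  by move=> p q p0 q0; field; rewrite p0 q0.
have bnd t : mnorm (A t *m picard k t) <= c * (k.+1%:R * (`|mass t| ^+ k * mnorm (A t))).
  apply: le_trans (mnormM _ _) _; rewrite [X in _ <= X](_ : _ =
    mnorm (A t) * (n%:R * ((K * `|mass t|) ^+ k / k`!%:R))).
    by apply: ler_wpM2l (IH t); exact: mnorm_ge0.
  by rewrite [LHS]mulrA cE exprMn; ring.
have fin y : K * (c * y ^+ k.+1) = n%:R * ((K * y) ^+ k.+1 / k.+1`!%:R).
  by rewrite /c exprMn [K ^+ k.+1]exprS; ring.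
have [x0|x0] := leP 0 x.
  have m0 : 0 <= mass x by rewrite -mass0 mass_mono.
  rewrite ger0_norm// -fin.
  have := mac_le x0 (@subsetT _ _) h (acZ c (ac_exprS k ac_mass)).
  rewrite picard_at0 subr0 mass0 expr0n/= mulr0 subr0; apply => t /andP[t0 _].
  have := bnd t; rewrite ger0_norm//.
  by rewrite -mass0 mass_mono.
have m0 : mass x <= 0 by rewrite -mass0 mass_mono// ltW.
rewrite ler0_norm// -fin.
have := mac_le (ltW x0) (@subsetT _ _) h (acZ (- c) (ac_exprS k (acN ac_mass))).
rewrite picard_at0 mass0 oppr0 expr0n/= mulr0 sub0r mulNr opprK.
rewrite mnormN add0r; apply => t /andP[_ t0].
have := bnd t; rewrite ler0_norm; last by rewrite -mass0 mass_mono.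
by congr (_ <= _); ring.
Qed.

Lemma picard_partial_bound N x :
  \sum_(k < N) mnorm (picard k x) <= n%:R * expR (K * `|mass x|).
Proof.
apply: (@le_trans _ _ (\sum_(k < N) n%:R * ((K * `|mass x|) ^+ k / k`!%:R))).
  by apply: ler_sum => k _; exact: picard_bound.
by apply: exp_series_le => //; rewrite mulr_ge0.
Qed.

Lemma mac_picard_sum N : mac setT (fun x => \sum_(k < N.+1) picard k x)
  (fun x => A x *m \sum_(k < N) picard k x).
Proof.
apply: mac_eq (mac_sum (index_enum 'I_N.+1) (fun k : 'I_N.+1 => mac_picard k)) => // x _.
by rewrite big_ord_recl/= add0r mulmx_sumr.
Qed.

Theorem picard_solution : exists Y : R -> 'M[R[i]]_n,
  [/\ mac setT Y (fun x => A x *m Y x), Y 0 = 1%:M,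
    forall x i j, csums (fun k => picard k x i j) (Y x i j) &
    forall x, mnorm (Y x) <= (n * n)%:R * (n%:R * expR (K * `|mass x|))].
Proof.
have ex x i j : exists s, csums (fun k => picard k x i j) s.
  have cv := @exp_series_cvg R n%:R (K * `|mass x|).
  apply: (csums_exists _ cv) => k.
  exact: le_trans (mnorm_entry _ i j) (picard_bound k x).
pose Y x : 'M[R[i]]_n := \matrix_(i, j) projT1 (cid (ex x i j)).
have hY x i j : csums (fun k => picard k x i j) (Y x i j).
  by rewrite mxE; exact: projT2 (cid (ex x i j)).
exists Y; split => //; first last.
- move=> x; apply: mnorm_le => i j; apply: csums_le (hY x i j) _ => N.
  apply: le_trans (picard_partial_bound N x); apply: ler_sum => k _.
  exact: mnorm_entry.
- apply/matrixP => i j; apply: csums_unique (hY 0 i j) _.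
  have := @csums_shift _ (fun k => picard k 0 i j) 0; rewrite addr0; apply.
  by apply: ccvg_eq (ccvg_cst 0) => N; rewrite big1// => k _; rewrite picard_at0 mxE.
move=> i j.
have cY x : ccvg (fun N => (\sum_(k < N) picard k x) i j) (Y x i j).
  by apply: ccvg_eq (hY x i j) => N; rewrite summxE.
have cAY x : ccvg (fun N => (A x *m \sum_(k < N) picard k x) i j) ((A x *m Y x) i j).
  rewrite mxE; apply: ccvg_eq (ccvg_sum (index_enum 'I_n) (fun l =>
    ccvgM (ccvg_cst (A x i l)) (hY x l j))) => N.
  by rewrite mxE; apply: eq_bigr => l _; rewrite summxE.
suff H a b : a <= b -> ac_derivative `[a, b] (fun x => Y x i j) (fun x => (A x *m Y x) i j).
  by move=> a b ab _; exact: (H a b ab).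
move=> ab.
(* The function [mass] is monotone, so [L] bounds it on [[a, b]]; the derivatives of all partial
   sums are then dominated there by the one integrable function [B]. *)
pose L := `|mass a| + `|mass b|.
have massL x : a <= x <= b -> `|mass x| <= L.
  move=> /andP[ax xb]; have h1 := mass_mono ax; have h2 := mass_mono xb.
  have h3 := ler_norm (- mass a); have h4 := ler_norm (mass b).
  have h5 := normr_ge0 (mass a); have h6 := normr_ge0 (mass b).
  by rewrite normrN in h3; rewrite /L ler_norml; apply/andP; split; lra.
pose B x := n%:R * expR (K * L) * mnorm (A x).
have lB : locint `[a, b] B.
  by apply: locintZ; apply: locint_sub (@subsetT _ _) (locint_mnorm hA).
have FB N x : `[a, b]%classic x -> cn ((A x *m \sum_(k < N) picard k x) i j) <= B x.
  rewrite /= in_itv/= => xab.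
  apply: le_trans (mnorm_entry _ _ _) _; apply: le_trans (mnormM _ _) _.
  rewrite mulrC /B ler_wpM2r ?mnorm_ge0//.
  apply: le_trans (mnorm_sum _ _) _; apply: le_trans (picard_partial_bound N x) _.
  by rewrite ler_wpM2l// ler_expR ler_wpM2l// massL.
(* The sum of [N.+1] terms has as derivative [A] times the sum of [N] terms. The shift is harmless
   in the limit, by [ccvgS]. *)
have hS N : ac_derivative `[a, b] (fun x => (\sum_(k < N.+1) picard k x) i j)
    (fun x => (A x *m \sum_(k < N) picard k x) i j).
  exact: cac_sub (@subsetT _ _) (mac_picard_sum N i j).
apply/ac_derivativeP; split.
- apply: (ac_lim (fun N => (iffLR (ac_derivativeP _ _ _) (hS N)).1) lB).
  + by move=> N x xab; apply: le_trans (cn_Re _) (FB N x xab).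
  + by move=> x _; exact: (ccvgS (cY x)).1.
  + by move=> x _; exact: (cAY x).1.
- apply: (ac_lim (fun N => (iffLR (ac_derivativeP _ _ _) (hS N)).2) lB).
  + by move=> N x xab; apply: le_trans (cn_Im _) (FB N x xab).
  + by move=> x _; exact: (ccvgS (cY x)).2.
  + by move=> x _; exact: (cAY x).2.
Qed.

End Picard.

Section PicardScale.
Context {R : realType}.

(** Turns the Picard series of a coefficient proportional to [z] into a power series in [z]. *)
Lemma picardZ n (A : R -> 'M[R[i]]_n) z k x : mlocint setT A ->
  picard (fun t => z *: A t) k x = z ^+ k *: picard A k x.
Proof.
move=> hA; have hzA := mlocintZ z hA.
elim: k x => [|k IH] x; first by rewrite expr0 scale1r.
apply: (@mac_unique _ _ _ _ (fun t => z ^+ k.+1 *: picard A k.+1 t) _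
  (mac_picard hzA k.+1)).
  apply: mac_eq (macZ (@cac_cst _ _ (z ^+ k.+1)) (mac_picard hA k.+1)) => // t _.
  by rewrite IH scale0r add0r -scalemxAl -scalemxAr scalerA -exprS.
by rewrite !picard_at0 scaler0.
Qed.

End PicardScale.

(** * Two by two matrices and the adjugate *)

Section Matrix22.
Context {R : comNzRingType}.
Implicit Types M N : 'M[R]_2.

Lemma ord2P (P : 'I_2 -> Prop) : P 0 -> P 1 -> forall i, P i.
Proof.
move=> P0 P1 [[|[|//]] h]; [have -> : Ordinal h = 0|have -> : Ordinal h = 1] => //;
  exact: val_inj.
Qed.

Lemma sum2 (V : nmodType) (f : 'I_2 -> V) : \sum_i f i = f 0 + f 1.
Proof.
rewrite big_ord_recl big_ord_recl big_ord0 addr0; congr (_ + f _); exact: val_inj.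
Qed.

Lemma matrix22P M N : M 0 0 = N 0 0 -> M 0 1 = N 0 1 -> M 1 0 = N 1 0 ->
  M 1 1 = N 1 1 -> M = N.
Proof. by move=> *; apply/matrixP; apply: ord2P; apply: ord2P. Qed.

Lemma mul22E n p (M : 'M[R]_(n, 2)) (N : 'M[R]_(2, p)) i j :
  (M *m N) i j = M i 0 * N 0 j + M i 1 * N 1 j.
Proof. by rewrite mxE sum2. Qed.

Lemma tr22E M : \tr M = M 0 0 + M 1 1. Proof. exact: sum2. Qed.

Lemma det22E M : \det M = M 0 0 * M 1 1 - M 0 1 * M 1 0.
Proof.
rewrite (expand_det_row _ 0) sum2 /cofactor !det_mx11 !mxE.
have e1 : lift 0 0 = 1 :> 'I_2 by exact: val_inj.
have e0 : lift 1 0 = 0 :> 'I_2 by exact: val_inj.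
by rewrite e1 e0 /= addn0 addn1 expr0 expr1 mul1r mulN1r mulrN.
Qed.

(* The adjugate, in a form that is visibly linear in [M]. *)
Definition adj2 M : 'M[R]_2 := (\tr M)%:M - M.

Lemma adj2E M : [/\ adj2 M 0 0 = M 1 1, adj2 M 0 1 = - M 0 1,
  adj2 M 1 0 = - M 1 0 & adj2 M 1 1 = M 0 0].
Proof. by split; rewrite !mxE tr22E /=; ring. Qed.

Lemma adj2_mul M N : adj2 (M *m N) = adj2 N *m adj2 M.
Proof.
have [a b c d] := adj2E (M *m N); have [a1 b1 c1 d1] := adj2E M.
have [a2 b2 c2 d2] := adj2E N.
by apply: matrix22P; rewrite ?a ?b ?c ?d !mul22E ?a1 ?b1 ?c1 ?d1 ?a2 ?b2 ?c2 ?d2; ring.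
Qed.

Lemma mul_adj2 M : M *m adj2 M = (\det M)%:M.
Proof.
have [a b c d] := adj2E M.
by apply: matrix22P; rewrite !mul22E ?a ?b ?c ?d det22E !mxE /=; ring.
Qed.

Lemma adj2_mull M : adj2 M *m M = (\det M)%:M.
Proof.
have [a b c d] := adj2E M.
by apply: matrix22P; rewrite !mul22E ?a ?b ?c ?d det22E !mxE /=; ring.
Qed.

Lemma adj2_tr0 M : \tr M = 0 -> adj2 M = - M.
Proof. by rewrite /adj2 => ->; rewrite raddf0 sub0r. Qed.

Lemma adj2_1 : adj2 1%:M = 1%:M.
Proof. by apply: matrix22P; rewrite !mxE tr22E !mxE /=; ring. Qed.

End Matrix22.

(** * Linear systems with trace-free coefficient *)

Section TraceFree.
Context {R : realType}.

Lemma mnorm22 (M : 'M[R[i]]_2) : mnorm M = cn (M 0 0) + cn (M 0 1) + (cn (M 1 0) + cn (M 1 1)).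
Proof. by rewrite /mnorm !sum2. Qed.

Lemma mnorm_adj2 (M : 'M[R[i]]_2) : mnorm (adj2 M) = mnorm M.
Proof. by rewrite !mnorm22; have [-> -> -> ->] := adj2E M; rewrite !cnN; ring. Qed.

Lemma cn_tr (M : 'M[R[i]]_2) : cn (\tr M) <= mnorm M.
Proof.
rewrite tr22E mnorm22; apply: le_trans (cnD _ _) _.
by have := cn_ge0 (M 0 1); have := cn_ge0 (M 1 0); lra.
Qed.

Lemma mac_adj2 D (F f : R -> 'M[R[i]]_2) : mac D F f ->
  mac D (fun x => adj2 (F x)) (fun x => adj2 (f x)).
Proof.
move=> h; have E x := adj2E (F x); have e x := adj2E (f x).
apply: ord2P; apply: ord2P.
- by apply: cac_eq (h 1 1) => x _; [case: (E x)|case: (e x)].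
- by apply: cac_eq (cacN (h 0 1)) => x _; [case: (E x)|case: (e x)].
- by apply: cac_eq (cacN (h 1 0)) => x _; [case: (E x)|case: (e x)].
- by apply: cac_eq (h 0 0) => x _; [case: (E x)|case: (e x)].
Qed.

Variable A : R -> 'M[R[i]]_2.
Hypothesis hA : mlocint setT A.
Hypothesis trA : forall x, \tr (A x) = 0.

(** Trace zero gives [adj2 A = - A], so the derivative of [adj2 E] is [- adj2 E *m A] and cancels
    against that of [Z]. For [Z = E] this yields the constant determinant, for other [Z]
    uniqueness. *)
Lemma adj2_mul_const D (E Y : R -> 'M[R[i]]_2) n (Z : R -> 'M[R[i]]_(2, n)) :
  mac D E (fun x => A x *m E x) -> mac D Z (fun x => A x *m Z x) ->
  mac D (fun x => adj2 (E x) *m Z x) (fun=> 0).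
Proof.
move=> hE hZ; apply: mac_eq (macM (mac_adj2 hE) hZ) => // x _.
by rewrite adj2_mul (adj2_tr0 (trA x)) mulmxN mulNmx mulmxA addNr.
Qed.

Lemma trace_free_det (E : R -> 'M[R[i]]_2) : mac setT E (fun x => A x *m E x) ->
  E 0 = 1%:M -> forall x, \det (E x) = 1.
Proof.
move=> hE E0.
have h := adj2_mul_const E hE hE.
have hc : (fun x => adj2 (E x) *m E x) =1 (fun=> 1%:M).
  by apply: mac_unique h (@mac_cst _ _ _ _ 1%:M) _; rewrite E0 adj2_1 mulmx1.
move=> x; have := hc x; rewrite adj2_mull => /matrixP/(_ 0 0).
by rewrite !mxE.
Qed.

(** The quantity [adj2 E *m Z] keeps its value at 0, and [adj2 E] inverts [E]. The version on an
    interval serves the eigenfunctions of [L_t], which solve the equation on [[0, pi]] only. *)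
Lemma trace_free_rep (E : R -> 'M[R[i]]_2) n (Z : R -> 'M[R[i]]_(2, n)) a b x :
  mac setT E (fun x => A x *m E x) -> E 0 = 1%:M ->
  a <= 0 <= b -> a <= x <= b ->
  mac `[a, b] Z (fun x => A x *m Z x) -> Z x = E x *m Z 0.
Proof.
move=> hE E0 /andP[a0 b0] /andP[ax xb] hZ.
have h := adj2_mul_const E (mac_sub (@subsetT _ _) hE) hZ.
have dE := trace_free_det hE E0.
suff e : adj2 (E x) *m Z x = Z 0.
  by rewrite -e mulmxA mul_adj2 dE mul1mx.
transitivity (adj2 (E 0) *m Z 0); last by rewrite E0 adj2_1 mul1mx.
have [x0|x0] := leP 0 x.
  exact: (mac_const (F := fun x => adj2 (E x) *m Z x) x0 (mac_sub (itvcc_sub a0 xb) h)).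
by apply/esym; exact: (mac_const (F := fun x => adj2 (E x) *m Z x) (ltW x0)
  (mac_sub (itvcc_sub ax b0) h)).
Qed.

Lemma trace_free_repT (E : R -> 'M[R[i]]_2) n (Z : R -> 'M[R[i]]_(2, n)) x :
  mac setT E (fun x => A x *m E x) -> E 0 = 1%:M ->
  mac setT Z (fun x => A x *m Z x) -> Z x = E x *m Z 0.
Proof.
move=> hE E0 hZ.
apply: (@trace_free_rep E n Z (- `|x|) `|x| x hE E0).
- by rewrite oppr_le0 normr_ge0.
- by rewrite -ler_norml.
- exact: mac_sub (@subsetT _ _) hZ.
Qed.

Lemma trace_free_unique (E E' : R -> 'M[R[i]]_2) :
  mac setT E (fun x => A x *m E x) -> E 0 = 1%:M ->
  mac setT E' (fun x => A x *m E' x) -> E' 0 = 1%:M -> E = E'.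
Proof.
move=> hE E0 hE' E'0; apply/funext => x.
by rewrite (trace_free_repT x hE E0 hE') E'0 mulmx1.
Qed.

End TraceFree.

(* Reduction of order: [E] absorbs the part [A] of the coefficient. *)
Lemma mac_factor (R : realType) (A C E W : R -> 'M[R[i]]_2) :
  mac setT E (fun x => A x *m E x) -> (forall x, \det (E x) = 1) ->
  mac setT W (fun x => (adj2 (E x) *m C x *m E x) *m W x) ->
  mac setT (fun x => E x *m W x) (fun x => (A x + C x) *m (E x *m W x)).
Proof.
move=> hE dE hW; apply: mac_eq (macM hE hW) => // x _.
by rewrite !mulmxA mul_adj2 dE mul1mx -!mulmxA mulmxDl.
Qed.

(** * The Dirac system *)

Section Periodic.
Context {R : realType}.
Local Notation mu := (@lebesgue_measure R).

Lemma integrable_itv_cat (g : R -> R) (a c b : R) : a <= c -> c <= b ->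
  mu.-integrable `[a, c] (EFin \o g) -> mu.-integrable `[c, b] (EFin \o g) ->
  mu.-integrable `[a, b] (EFin \o g).
Proof.
move=> ac_ cb i1 i2.
have i1' : mu.-integrable `[a, c[ (EFin \o g).
  by apply: integrableS i1 => //; exact: subset_itv_co_cc.
have abE : `[a, b]%classic = `[a, c[%classic `|` `[c, b]%classic.
  apply/seteqP; split => x /=; rewrite !in_itv/=.
    by move=> /andP[ax xb]; have [xc|cx] := ltP x c; [left|right]; apply/andP.
  move=> [/andP[ax xc]|/andP[cx xb]]; apply/andP; split => //.
    exact: le_trans (ltW xc) cb.
  exact: le_trans ac_ cx.
have mg : measurable_fun (`[a, c[%classic `|` `[c, b]%classic) (EFin \o g).
  apply/measurable_funU => //; split; first by have /integrableP[] := i1'.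
  by have /integrableP[] := i2.
rewrite abE; apply/integrableP; split => //.
rewrite ge0_integral_setU//.
- by apply: lte_add_pinfty; [have /integrableP[_] := i1'|have /integrableP[_] := i2].
- by apply: measurableT_comp.
- apply/disj_setPS => x [/=]; rewrite !in_itv/= => /andP[_ xc] /andP[cx _].
  by have := lt_le_trans xc cx; rewrite ltxx.
Qed.

Lemma locint_periodic (g : R -> R) : mu.-integrable `[0, pi] (EFin \o g) ->
  (forall x, g (x + pi) = g x) -> locint setT g.
Proof.
move=> ig gper.
have pi0 : 0 <= pi :> R by exact: pi_ge0.
have gper' x : g (x - pi) = g x by rewrite -[LHS]gper subrK.
have pos n : mu.-integrable `[0, n%:R * pi] (EFin \o g) ->
    mu.-integrable `[0, n.+1%:R * pi] (EFin \o g).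
  move=> h; apply: (integrable_itv_cat pi0 _ ig).
    by rewrite -[X in X <= _]mul1r ler_wpM2r// ler1n.
  have [] := integral_shift (- pi) h.
  rewrite opprK add0r => + _; rewrite -natr1 mulrDl mul1r; congr (_.-integrable _ _).
  by apply/funext => x; rewrite /= gper'.
have neg n : mu.-integrable `[- (n%:R * pi), 0] (EFin \o g) ->
    mu.-integrable `[- (n.+1%:R * pi), 0] (EFin \o g).
  move=> h; apply: (@integrable_itv_cat _ _ (- pi)).
  - by rewrite lerN2 -[X in X <= _]mul1r ler_wpM2r// ler1n.
  - by rewrite oppr_le0.
  - have [] := integral_shift pi h.
    rewrite sub0r -opprD -[n.+1%:R]natr1 mulrDl mul1r => + _.
    by congr (_.-integrable _ _); apply/funext => x; rewrite /= gper.
  - have [] := integral_shift pi ig.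
    rewrite sub0r subrr => + _.
    by congr (_.-integrable _ _); apply/funext => x; rewrite /= gper.
have i0 : mu.-integrable `[0, 0] (EFin \o g).
  by apply: integrableS ig => //; exact: itvcc_sub.
apply: locintT_itv => n.
have h : mu.-integrable `[- (n%:R * pi), n%:R * pi] (EFin \o g).
  apply: (@integrable_itv_cat _ _ 0).
  - by rewrite oppr_le0 mulr_ge0.
  - by rewrite mulr_ge0.
  - elim: n => [|n IH]; last exact: neg.
    by rewrite mul0r oppr0.
  - elim: n => [|n IH]; last exact: pos.
    by rewrite mul0r.
apply: integrableS h => //.
(* As [pi >= 1], whole periods on both sides of 0 exhaust the line. *)
have : n%:R <= n%:R * pi :> R.
  rewrite -[X in X <= _]mulr1 ler_wpM2l//; have := @pi_ge2 R; lra.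
by move=> nn; apply: itvcc_sub; rewrite // lerN2.
Qed.

Lemma clocint_periodic (q : R -> R[i]) : integrable_complex `[0, pi] q ->
  (forall x, q (x + pi) = q x) -> clocint setT q.
Proof.
move=> [i1 i2] qper; apply/clocintP; split; apply: locint_periodic => // x.
  by rewrite qper.
by rewrite qper.
Qed.

End Periodic.

Section Dirac.
Context {R : realType}.
Local Notation mu := (@lebesgue_measure R).
Local Notation J := (@dirac_J R).

Lemma block22E (M1 M2 M3 M4 : 'M[R[i]]_1) (M : 'M[R[i]]_2 := @block_mx _ 1 1 1 1 M1 M2 M3 M4) :
  [/\ M 0 0 = M1 0 0, M 0 1 = M2 0 0, M 1 0 = M3 0 0 & M 1 1 = M4 0 0].
Proof.
have e0 : (0 : 'I_2) = lshift 1 (0 : 'I_1) by exact: val_inj.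
have e1 : (1 : 'I_2) = rshift 1 (0 : 'I_1) by exact: val_inj.
split.
- by rewrite -(block_mxEul M1 M2 M3 M4 0 0) -e0.
- by rewrite -(block_mxEur M1 M2 M3 M4 0 0) -e0 -e1.
- by rewrite -(block_mxEdl M1 M2 M3 M4 0 0) -e0 -e1.
- by rewrite -(block_mxEdr M1 M2 M3 M4 0 0) -e1.
Qed.

Lemma dirac_JE : [/\ J 0 0 = - 'i%C, J 0 1 = 0, J 1 0 = 0 & J 1 1 = 'i%C].
Proof.
have [a b c d] := block22E (- 'i%C)%:M 0 0 'i%C%:M.
by split; rewrite /dirac_J ?a ?b ?c ?d !mxE.
Qed.

Lemma offdiagE (q2 q3 : R -> R[i]) x : [/\ offdiag q2 q3 x 0 0 = 0,
  offdiag q2 q3 x 0 1 = q2 x, offdiag q2 q3 x 1 0 = q3 x & offdiag q2 q3 x 1 1 = 0].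
Proof.
have [a b c d] := block22E 0 (q2 x)%:M (q3 x)%:M 0.
by split; rewrite /offdiag ?a ?b ?c ?d !mxE.
Qed.

Lemma dirac_JJ : J *m J = - 1%:M.
Proof.
have [a b c d] := dirac_JE.
by apply: matrix22P; rewrite mul22E ?a ?b ?c ?d !mxE /=; simpc; rewrite ?oppr0 ?mul1r.
Qed.

Variables (q2 q3 : R -> R[i]).
Hypotheses (lq2 : clocint setT q2) (lq3 : clocint setT q3).
Local Notation Q := (offdiag q2 q3).

(** Since [J] squares to -1, the equation [J y' + Q y = l y] solved for [y'] reads
    [y' = J (Q - l) y]. *)
Definition dirac_A (l : R[i]) (x : R) : 'M[R[i]]_2 := J *m (Q x - l%:M).

Lemma dirac_AE l x : [/\ dirac_A l x 0 0 = 'i%C * l, dirac_A l x 0 1 = - 'i%C * q2 x,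
  dirac_A l x 1 0 = 'i%C * q3 x & dirac_A l x 1 1 = - 'i%C * l].
Proof.
have [a b c d] := dirac_JE; have [a' b' c' d'] := offdiagE q2 q3 x.
have e (M : 'M[R[i]]_2) i j : (M - l%:M) i j = M i j - l *+ (i == j).
  by rewrite !mxE.
by split; rewrite /dirac_A mul22E !e ?a ?b ?c ?d ?a' ?b' ?c' ?d' /= ?mulr1n ?mulr0n; ring.
Qed.

Lemma tr_dirac_A l x : \tr (dirac_A l x) = 0.
Proof. by rewrite tr22E; have [-> _ _ ->] := dirac_AE l x; ring. Qed.

Lemma mlocint_Q : mlocint setT Q.
Proof.
apply: ord2P; apply: ord2P.
- have := @clocint_cst R setT 0; congr clocint; apply/funext => x.
  by have [] := offdiagE q2 q3 x.
- by have := lq2; congr clocint; apply/funext => x; have [] := offdiagE q2 q3 x.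
- by have := lq3; congr clocint; apply/funext => x; have [] := offdiagE q2 q3 x.
- have := @clocint_cst R setT 0; congr clocint; apply/funext => x.
  by have [] := offdiagE q2 q3 x.
Qed.

Lemma mlocint_dirac_A l : mlocint setT (dirac_A l).
Proof.
apply: mlocintMc; apply: mlocintD; first exact: mlocint_Q.
exact: mlocint_mac (@mac_cst _ _ _ setT (- l%:M)).
Qed.

(** The derivative matters only up to null sets, so it may be replaced by the right-hand side of the
    equation solved for [Y']; the a.e. identity becomes an exact statement about [mac]. *)
Lemma dirac_exprP m D l (Y f : R -> 'M[R[i]]_(2, m)) : mlocint D f ->
  (dirac_expr D Q Y (fun x => f x + l *: Y x) <->
   mac D Y (fun x => dirac_A l x *m Y x - J *m f x)).
Proof.
have JK (X : 'M[R[i]]_(2, m)) : J *m (J *m X) = - X.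
  by rewrite mulmxA dirac_JJ mulNmx mul1mx.
have AE (Z F : 'M[R[i]]_(2, m)) x : dirac_A l x *m Z - J *m F =
    J *m (Q x *m Z - (F + l *: Z)).
  rewrite /dirac_A -mulmxA mulmxBl -mulmxBr; congr (_ *m _).
  by rewrite mul_scalar_mx -addrA opprD [- F + _]addrC.
move=> lf; split.
  move=> [Y' [hY eq]].
  have lAY : mlocint D (fun x => dirac_A l x *m Y x - J *m f x).
    have -> : (fun x => dirac_A l x *m Y x - J *m f x) =
        (fun x => dirac_A l x *m Y x + - J *m f x).
      by apply/funext => x; rewrite mulNmx.
    apply: mlocintD; last exact: mlocintMc.
    exact: mlocintMl (mlocint_sub (@subsetT _ D) (mlocint_dirac_A l)) hY.
  apply: mac_ae lAY _ hY.
  apply: (@ae_mono _ (fun x => D x -> J *m Y' x + Q x *m Y x = f x + l *: Y x)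
    (fun x => D x -> Y' x = dirac_A l x *m Y x - J *m f x) eq) => x h Dx.
  by rewrite AE -(h Dx) opprD addrCA subrr addr0 mulmxN JK opprK.
move=> hY; exists (fun x => dirac_A l x *m Y x - J *m f x); split => //.
apply: aeW => x Dx; rewrite AE JK opprB subrK//.
Qed.

Lemma dirac_expr0P m D l (Y : R -> 'M[R[i]]_(2, m)) :
  dirac_expr D Q Y (fun x => l *: Y x) <-> mac D Y (fun x => dirac_A l x *m Y x).
Proof.
have e1 : (fun x => l *: Y x) = (fun x => 0 + l *: Y x).
  by apply/funext => x; rewrite add0r.
have e2 : (fun x => dirac_A l x *m Y x) = (fun x => dirac_A l x *m Y x - J *m 0).
  by apply/funext => x; rewrite mulmx0 subr0.
rewrite e1 e2; apply: dirac_exprP.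
exact: mlocint_mac (@mac_cst _ _ _ D 0).
Qed.

Lemma fundamental_matrixP l (E := fundamental_matrix Q l) :
  mac setT E (fun x => dirac_A l x *m E x) /\ E 0 = 1%:M.
Proof.
suff [E0 hE] : is_fundamental_matrix Q l E.
  by split => //; exact/dirac_expr0P.
apply: xgetPex; have [Y [hY Y0 _ _]] := picard_solution (mlocint_dirac_A l).
by exists Y; split => //; apply/dirac_expr0P.
Qed.

End Dirac.

(** * The free equation, [Q = 0] *)

Section FreePropagator.
Context {R : realType}.
Local Notation J := (@dirac_J R).
Implicit Types (l x y : R).

Definition mx22 (a b c d : R[i]) : 'M[R[i]]_2 :=
  \matrix_(i, j) if i == 0 then (if j == 0 then a else b) else (if j == 0 then c else d).

Lemma mx22E a b c d : [/\ mx22 a b c d 0 0 = a, mx22 a b c d 0 1 = b,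
  mx22 a b c d 1 0 = c & mx22 a b c d 1 1 = d].
Proof. by split; rewrite mxE. Qed.

(** The exponential of [i y]. *)
Definition ce y : R[i] := cos y +i* sin y.

Lemma ceN_mul y : ce y * ce (- y) = 1.
Proof.
have h := cos2Dsin2 y.
apply: complex_ext; rewrite ?cReM ?cImM /= cosN sinN; last by ring.
by rewrite -h !expr2; ring.
Qed.

Lemma cn_ce y : cn (ce y) <= 2.
Proof.
rewrite /cn /=; have h1 : `|cos y| <= 1 by rewrite ler_norml cos_geN1 cos_le1.
have h2 : `|sin y| <= 1 by rewrite ler_norml sin_geN1 sin_le1.
lra.
Qed.

Lemma is_derive_scale (f f' : R -> R) l x : is_derive (l * x) (1 : R) f (f' (l * x)) ->
  is_derive x (1 : R) (fun x => f (l * x)) (l * f' (l * x)).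
Proof.
move=> h; have hl : is_derive x (1 : R) (fun x : R => l * x) l.
  by have := is_deriveZ l (@is_derive_id _ _ x (1 : R)); rewrite /GRing.scale/= mulr1.
by have := is_derive1_comp h hl; rewrite mulrC.
Qed.

Lemma continuous_scale (f : R -> R) l : continuous f -> continuous (fun x => f (l * x)).
Proof.
move=> cf x; apply: (@continuous_comp _ _ _ (fun x => l * x) f); last exact: cf.
by apply: cvgM; [exact: cvg_cst|exact: cvg_id].
Qed.

Lemma cac_ce D l : ac_derivative D (fun x => ce (l * x))
  (fun x => 'i%C * l%:C * ce (l * x)).
Proof.
apply/ac_derivativeP; split.
  apply: (@ac_eq _ D (fun x => cos (l * x)) (fun x => l * - sin (l * x))) => [//|x _|].
    by rewrite cReM /=; simpc; rewrite /=; ring.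
  apply: ac_derive => [x|].
    exact: (@is_derive_scale cos (fun y => - sin y)).
  move=> x; apply: cvgM; first exact: cvg_cst.
  by apply: cvgN; apply: continuous_scale; exact: continuous_sin.
apply: (@ac_eq _ D (fun x => sin (l * x)) (fun x => l * cos (l * x))) => [//|x _|].
  by rewrite cImM /=; simpc; rewrite /=; ring.
apply: ac_derive => [x|].
  exact: (@is_derive_scale sin cos).
move=> x; apply: cvgM; first exact: cvg_cst.
by apply: continuous_scale; exact: continuous_cos.
Qed.

Definition freeE l x : 'M[R[i]]_2 := mx22 (ce (l * x)) 0 0 (ce (- (l * x))).

Definition freeA l : 'M[R[i]]_2 := mx22 ('i%C * l%:C) 0 0 (- 'i%C * l%:C).

Lemma det_freeE l x : \det (freeE l x) = 1.
Proof.
have [a b c d] := mx22E (ce (l * x)) 0 0 (ce (- (l * x))).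
by rewrite det22E a b c d ceN_mul mul0r subr0.
Qed.

Lemma freeE0 l : freeE l 0 = 1%:M.
Proof.
have e0 : ce 0 = 1 by rewrite /ce cos0 sin0.
by apply: matrix22P; rewrite !mxE /= ?mulr0 ?oppr0 ?e0.
Qed.

Lemma mac_freeE l : mac setT (freeE l) (fun x => freeA l *m freeE l x).
Proof.
have [a b c d] := mx22E ('i%C * l%:C) 0 0 (- 'i%C * l%:C).
apply: ord2P; apply: ord2P.
- apply: cac_eq (@cac_ce setT l) => x _; first by rewrite mxE.
  by rewrite mul22E a b !mxE /=; ring.
- apply: cac_eq (@cac_cst _ setT 0) => x _; first by rewrite mxE.
  by rewrite mul22E a b !mxE /=; ring.
- apply: cac_eq (@cac_cst _ setT 0) => x _; first by rewrite mxE.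
  by rewrite mul22E c d !mxE /=; ring.
- apply: cac_eq (@cac_ce setT (- l)) => x _; first by rewrite mxE /= mulNr.
  by rewrite mul22E c d !mxE /= mulNr rmorphN; ring.
Qed.

Lemma mnorm_freeE l x : mnorm (freeE l x) <= 4.
Proof.
rewrite mnorm22 !mxE /= cn0; have := cn_ce (l * x); have := cn_ce (- (l * x)); lra.
Qed.

End FreePropagator.

(** * Interaction picture and Taylor expansion of the discriminant *)

Section Expansion.
Context {R : realType}.
Local Notation J := (@dirac_J R).
Variables (q2 q3 : R -> R[i]).
Hypotheses (lq2 : clocint setT q2) (lq3 : clocint setT q3).
Local Notation Q := (offdiag q2 q3).
Local Notation E := (fundamental_matrix Q).

Definition JQ (x : R) : 'M[R[i]]_2 := J *m Q x.

(** Writing [E = freeE *m U] removes the free part of the coefficient and leaves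
    [U' = interaction U]; [adj2 (freeE l x)] is the inverse of the free flow. *)
Definition interaction (l x : R) : 'M[R[i]]_2 :=
  adj2 (freeE l x) *m JQ x *m freeE l x.

Lemma mlocint_JQ : mlocint setT JQ.
Proof. exact: mlocintMc (mlocint_Q lq2 lq3). Qed.

Lemma mlocint_interaction l : mlocint setT (interaction l).
Proof.
have h := mac_freeE l.
exact: mlocintMl (mlocintMr mlocint_JQ (mac_adj2 h)) h.
Qed.

(** The constant is the square of the bound in [mnorm_freeE]. *)
Lemma mnorm_conj_freeE l x (M : 'M[R[i]]_2) :
  mnorm (adj2 (freeE l x) *m M *m freeE l x) <= 16 * mnorm M.
Proof.
apply: le_trans (mnormM _ _) _.
have h := mnorm_freeE l x; have h0 := mnorm_ge0 (freeE l x).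
have h1 := mnormM (adj2 (freeE l x)) M; rewrite mnorm_adj2 in h1.
have h2 := mnorm_ge0 M.
apply: (@le_trans _ _ (mnorm (freeE l x) * mnorm M * 4)).
  by apply: ler_pM => //; exact: mnorm_ge0.
have : mnorm (freeE l x) * mnorm M <= 4 * mnorm M by exact: ler_wpM2r.
lra.
Qed.

Lemma mnorm_interaction l x : mnorm (interaction l x) <= 16 * mnorm (JQ x).
Proof. exact: mnorm_conj_freeE. Qed.

Lemma dirac_A_split l x : dirac_A q2 q3 l%:C x = freeA l + JQ x.
Proof.
have [a b c d] := dirac_AE q2 q3 l%:C x.
have [a' b' c' d'] := mx22E ('i%C * l%:C) 0 0 (- 'i%C * l%:C).
have [a1 b1 c1 d1] := @dirac_JE R; have [a2 b2 c2 d2] := offdiagE q2 q3 x.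
rewrite /JQ; have e (M N : 'M[R[i]]_2) i j : (M + N) i j = M i j + N i j by rewrite mxE.
apply: matrix22P; rewrite ?a ?b ?c ?d e mul22E ?a1 ?b1 ?c1 ?d1 ?a2 ?b2 ?c2 ?d2.
- by rewrite /freeA a'; ring.
- by rewrite /freeA b'; ring.
- by rewrite /freeA c'; ring.
- by rewrite /freeA d'; ring.
Qed.

Let m0 := mass JQ pi.

Lemma interaction_mass (l x : R) : 0 <= x <= pi -> `|mass (interaction l) x| <= 16 * m0.
Proof.
move=> /andP[x0 xpi]; have hm := ac_mass (mlocint_interaction l).
have h0 : 0 <= mass (interaction l) x.
  by rewrite -(mass0 (interaction l)); exact: mass_mono (mlocint_interaction l) _ _ x0.
rewrite ger0_norm//.
apply: (@le_trans _ _ (16 * mass JQ x)); last first.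
  apply: ler_wpM2l; [exact: ler0n|exact: mass_mono mlocint_JQ _ _ xpi].
have := ac_le x0 (@subsetT _ _) hm (acZ 16 (ac_mass mlocint_JQ)).
rewrite !mass0 mulr0 !subr0; apply => t _.
exact: mnorm_interaction.
Qed.

(* In the interaction picture the real spectral parameter only appears in
   unimodular factors, so all bounds are uniform in it. *)
Lemma interaction_solution : exists2 C : R, 0 <= C & forall l : R,
  exists U : R -> 'M[R[i]]_2,
  [/\ mac setT U (fun x => interaction l x *m U x), U 0 = 1%:M,
    forall x, E l%:C x = freeE l x *m U x &
    forall x, 0 <= x <= pi -> mnorm (U x) <= C].
Proof.
exists ((2 * 2)%:R * (2%:R * expR ((2 * (2 * 2))%:R * (16 * m0)))).
  by rewrite !mulr_ge0// expR_ge0.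
move=> l; have [U [hU U0 _ bU]] := picard_solution (mlocint_interaction l).
exists U; split => //.
- have hEU : mac setT (fun x => freeE l x *m U x)
      (fun x => dirac_A q2 q3 l%:C x *m (freeE l x *m U x)).
    apply: mac_eq (mac_factor (mac_freeE l) (det_freeE l) hU) => // x _.
    by rewrite dirac_A_split.
  have [hE E0] := fundamental_matrixP lq2 lq3 l%:C.
  move=> x; rewrite (trace_free_unique (tr_dirac_A q2 q3 l%:C) hE E0 hEU)//.
  by rewrite freeE0 U0 mulmx1.
- move=> x x0pi; apply: le_trans (bU x) _.
  by rewrite !ler_wpM2l// ler_expR ler_wpM2l// interaction_mass.
Qed.

Lemma fundamental_bound : exists2 C : R, 0 <= C & forall (l x : R), 0 <= x <= pi ->
  mnorm (E l%:C x) <= C.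
Proof.
have [C C0 h] := interaction_solution; exists (4 * C); first exact: mulr_ge0.
move=> l x x0pi; have [U [_ _ -> bU]] := h l.
apply: le_trans (mnormM _ _) _; apply: ler_pM; rewrite ?mnorm_ge0//.
  exact: mnorm_freeE.
exact: bU.
Qed.

Lemma dirac_A_shift (l z : R[i]) (x : R) : dirac_A q2 q3 (l + z) x = dirac_A q2 q3 l x + z *: - J.
Proof.
rewrite /dirac_A; have -> : (l + z)%:M = l%:M + z%:M :> 'M[R[i]]_2.
  by apply/matrixP => i j; rewrite !mxE mulrnDl.
rewrite scalerN opprD addrA mulmxDr; congr (_ + _).
by rewrite mulmxN mul_mx_scalar.
Qed.

(** By reduction of order, [E (l + z) = E l *m W] with [W' = z B W]: the increment [z] of the
    spectral parameter enters linearly. *)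
Let B (l x : R) : 'M[R[i]]_2 := adj2 (E l%:C x) *m (- J) *m E l%:C x.

Let mlocint_B l : mlocint setT (B l).
Proof.
have [h _] := fundamental_matrixP lq2 lq3 l%:C.
exact: mlocint_mac (macM (macMr (- J) (mac_adj2 h)) h).
Qed.

Let mass_B : exists2 D : R, 0 <= D & forall l, `|mass (B l) pi| <= D.
Proof.
have [C C0 hC] := fundamental_bound.
have pi0 : 0 <= pi :> R by exact: pi_ge0.
exists (C * mnorm (- J) * C * pi) => [|l]; first by rewrite !mulr_ge0// mnorm_ge0.
have h0 : 0 <= mass (B l) pi.
  by rewrite -(mass0 (B l)); exact: mass_mono (mlocint_B l) _ _ pi0.
rewrite ger0_norm//.
have := ac_le pi0 (@subsetT _ _) (ac_mass (mlocint_B l))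
  (@ac_linear R setT (C * mnorm (- J) * C)).
rewrite mass0 mulr0 !subr0; apply => x x0pi.
apply: le_trans (mnormM _ _) _; apply: ler_pM; rewrite ?mnorm_ge0 ?hC//.
apply: le_trans (mnormM _ _) _.
by rewrite mnorm_adj2 ler_wpM2r ?mnorm_ge0 ?hC.
Qed.

(** By [picardZ] the Picard series of [W] at [pi] is a power series in [z], and [picard_bound]
    bounds its coefficients through the mass of [B], which [fundamental_bound] controls uniformly in
    the real point [l]. Hence [C] and [D] are chosen before [l]. *)
Theorem hill_F_expansion : exists C D : R, [/\ 0 <= C, 0 <= D &
  forall l : R, exists c : nat -> R[i],
    (forall z : R[i], csums (fun k => c k * z ^+ k) (hill_F Q (l%:C + z))) /\
    (forall k, cn (c k) <= C * (D ^+ k / k`!%:R))].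
Proof.
have [C C0 hC] := fundamental_bound; have [D D0 hD] := mass_B.
have pi0 : 0 <= pi :> R by exact: pi_ge0.
(* The factor 2 is the norm of the identity matrix, and [2 * (2 * 2)] is the constant [K] of the
   Picard bound. *)
exists (C * 2%:R), ((2 * (2 * 2))%:R * D); split; [by rewrite mulr_ge0|by rewrite mulr_ge0|].
move=> l; exists (fun k => \tr (E l%:C pi *m picard (B l) k pi)); split.
  move=> z; have hzB := mlocintZ z (mlocint_B l).
  have [W [hW W0 sW _]] := picard_solution hzB.
  have [hE E0] := fundamental_matrixP lq2 lq3 l%:C.
  have [hEz Ez0] := fundamental_matrixP lq2 lq3 (l%:C + z).
  have dE := trace_free_det (tr_dirac_A q2 q3 l%:C) hE E0.
  have hW' : mac setT W (fun x =>
      (adj2 (E l%:C x) *m (z *: - J) *m E l%:C x) *m W x).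
    by apply: mac_eq hW => // x _; rewrite -scalemxAr -!scalemxAl.
  have hEW : mac setT (fun x => E l%:C x *m W x)
      (fun x => dirac_A q2 q3 (l%:C + z) x *m (E l%:C x *m W x)).
    by apply: mac_eq (mac_factor hE dE hW') => // x _; rewrite dirac_A_shift.
  have EE : E (l%:C + z) = fun x => E l%:C x *m W x.
    apply: (trace_free_unique (tr_dirac_A q2 q3 (l%:C + z)) hEz Ez0 hEW).
    by rewrite E0 W0 mulmx1.
  have -> : hill_F Q (l%:C + z) = \sum_i \sum_j E l%:C pi i j * W pi j i.
    by rewrite /hill_F EE /mxtrace; apply: eq_bigr => i _; rewrite mxE.
  apply: ccvg_eq (ccvg_sum (index_enum 'I_2) (fun i => ccvg_sum (index_enum 'I_2)
    (fun j => ccvgM (ccvg_cst (E l%:C pi i j)) (sW pi j i)))) => N.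
  under eq_bigr do under eq_bigr do rewrite mulr_sumr.
  under eq_bigr do rewrite exchange_big/=.
  rewrite exchange_big/=; apply: eq_bigr => k _.
  rewrite (picardZ _ _ _ (mlocint_B l)) /mxtrace mulr_suml.
  apply: eq_bigr => i _; rewrite mxE mulr_suml; apply: eq_bigr => j _.
  by rewrite mxE; ring.
move=> k; apply: le_trans (cn_tr _) _; apply: le_trans (mnormM _ _) _.
rewrite -mulrA; apply: ler_pM; rewrite ?mnorm_ge0//.
  by apply: hC; rewrite pi0 lexx.
apply: le_trans (picard_bound (mlocint_B l) k pi) _.
rewrite ler_wpM2l// ler_wpM2r ?invr_ge0// lerXn2r ?nnegrE ?mulr_ge0//.
by rewrite ler_wpM2l.
Qed.

End Expansion.

(** * Asymptotics of the discriminant *)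

Section RiemannLebesgue.
Context {R : realType}.
Local Notation mu := (@lebesgue_measure R).
Local Notation pi := (@pi R).

Lemma primitive_pi (g : R -> R) : primitive g pi = \int[mu]_(x in `[0, pi]) g x.
Proof. by rewrite /primitive pi_ge0. Qed.

(** The approximants are the Steklov means [(G (x + e) - G x) / e] of [g]. They are absolutely
    continuous, converge pointwise because [g] is continuous, and dominated convergence gives the
    integral bound. *)
Lemma mollify_dense (g : R -> R) (d : R) : continuous g -> 0 < d ->
  exists h h', ac setT h h' /\ \int[mu]_(x in `[0, pi]) `|g x - h x| <= d.
Proof.
move=> cg d0.
pose G := primitive g; have hG : ac setT G g := ac_primitive (continuous_locint cg).
pose e n : R := n.+1%:R^-1.
have e0 n : 0 < e n by rewrite invr_gt0.
have e1 n : e n <= 1 by rewrite invf_le1// ler1n.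
pose h n x := (e n)^-1 * (G (x + e n) - G x).
have hh n : ac setT (h n) (fun x => (e n)^-1 * (g (x + e n) - g x)).
  by apply: acZ; apply: acB => //; exact: ac_shift.
(* The means at points of [[0, pi]] look ahead by [e n <= 1], so [g] has to be bounded on
   [[0, pi + 1]]. *)
have pi0 : 0 <= pi + 1 by rewrite addr_ge0// pi_ge0.
have [M hM] : exists M : R, forall x, 0 <= x <= pi + 1 -> `|g x| <= M.
  have cgn : {within `[0, pi + 1], continuous (fun x => `|g x|)}.
    by apply: continuous_subspaceT => x; apply: cvg_norm; exact: cg.
  have [c _ hc] := EVT_max pi0 cgn; exists `|g c| => x x01.
  by apply: hc; rewrite in_itv.
have hnear (x r eps : R) : (forall y, x <= y <= x + r -> `|g y - g x| <= eps) ->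
    forall n, e n <= r -> `|h n x - g x| <= eps.
  move=> hr n enr.
  have xe : x <= x + e n by rewrite lerDl ltW.
  have H := ac_le_norm xe (@subsetT _ _) (acB hG (@ac_linear R setT (g x)))
    (@ac_linear R setT eps).
  have -> : h n x - g x = (e n)^-1 * (G (x + e n) - g x * (x + e n) - (G x - g x * x)).
    by rewrite /h; field; rewrite gt_eqF.
  rewrite normrM gtr0_norm ?invr_gt0// mulrC ler_pdivrMr//.
  apply: (le_trans (H _)) => [y /andP[xy ye]|].
    by apply: hr; rewrite xy/=; apply: le_trans ye _; rewrite lerD2l.
  by rewrite -mulrBr addrAC subrr add0r.
have cv x : 0 <= x <= pi -> (fun n => `|g x - h n x|) @ \oo --> (0 : R).
  move=> x0pi; apply/cvgrPdist_le => eps eps0.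
  have /cvgrPdist_le/(_ _ eps0)[r /= r0 hr] := cg x.
  near=> n; rewrite sub0r normrN normr_id distrC; apply: (hnear x (r / 2)).
    move=> y /andP[xy yx]; rewrite distrC; apply: hr => /=.
    by rewrite distrC ger0_norm ?subr_ge0//; lra.
  near: n; have r20 : 0 < r / 2 by rewrite divr_gt0.
  by have := near_infty_natSinv_lt (PosNum r20); apply: filterS => n /= /ltW.
have hb n x : 0 <= x <= pi -> `|g x - h n x| <= 2 * M.
  move=> /andP[x0 xpi].
  rewrite distrC; apply: (hnear x (e n)) => // y /andP[xy yx].
  apply: le_trans (ler_normB _ _) _; have := hM x; have := hM y.
  rewrite x0 (le_trans x0 xy)/=.
  move=> h1 h2; have {}h1 := h1 _; have {}h2 := h2 _.
  have : y <= pi + 1 by have := e1 n; lra.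
  move=> /h1 gy; have /h2 gx : x <= pi + 1 by lra.
  lra.
have [||||iF /cvgrPdist_le/(_ _ d0)[N _ hN]] := @Rintegral_dominated R 0 pi
   (fun n x => `|g x - h n x|) (fun=> 0) (fun=> 2 * M).
- move=> n; have := locint_norm (locintD (continuous_locint cg)
    (locintZ (-1) (continuous_locint (ac_continuous (hh n))))).
  move=> /(_ setT 0 pi (pi_ge0 R) (@subsetT _ _))/integrableP[/measurable_EFinP + _].
  by congr measurable_fun; apply/funext => x; rewrite mulN1r.
- exact: locint_cst (pi_ge0 R) (@subsetT _ _).
- by move=> n x x0pi; rewrite normr_id; exact: hb.
- exact: cv.
exists (h N), (fun x => (e N)^-1 * (g (x + e N) - g x)); split; first exact: hh.
have := hN N (leqnn N); rewrite /= Rintegral_cst// mul0r sub0r normrN.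
by apply: le_trans; exact: ler_norm.
Unshelve. all: by end_near.
Qed.

Lemma ac_dense (f : R -> R) (d : R) : locint setT f -> 0 < d ->
  exists h h', ac setT h h' /\ \int[mu]_(x in `[0, pi]) `|f x - h x| <= d.
Proof.
move=> lf d0.
have pi0 := pi_ge0 R.
have [|g_ [cg ig]] := approximation_continuous_integrable (measurable_itv _) _
  (lf 0 pi pi0 (@subsetT _ _)).
  exact: compact_finite_measure (@segment_compact _ _ _).
have d20 : 0 < d / 2 by rewrite divr_gt0.
move=> /fine_cvgP[_] /cvgrPdist_le/(_ _ d20)[N _ hN].
have {hN} hN := hN N (leqnn N).
have [h [h' [hh hle]]] := mollify_dense (cg N) d20.
exists h, h'; split => //.
have lg : locint setT (g_ N) by exact: continuous_locint.
have lh : locint setT h by exact: continuous_locint (ac_continuous hh).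
have lB u v : locint setT u -> locint setT v -> locint setT (fun x => `|u x - v x|).
  move=> lu lv; apply: locint_norm.
  have := locintD lu (locintZ (-1) lv); congr locint.
  by apply/funext => x; rewrite mulN1r.
apply: (@le_trans _ _ (\int[mu]_(x in `[0, pi]) (`|f x - g_ N x| + `|g_ N x - h x|))).
  apply: le_Rintegral => //.
  - exact: lB.
  - by apply: locintD; [exact: lB|exact: lB|exact: pi0|exact: subsetT].
  - move=> x _; have -> : f x - h x = (f x - g_ N x) + (g_ N x - h x) by ring.
    exact: ler_normD.
rewrite RintegralD//; [|exact: lB|exact: lB].
rewrite [d]splitr; apply: lerD hle.
move: hN; rewrite /= sub0r normrN; apply: le_trans.
exact: ler_norm.
Qed.

(** The Riemann-Lebesgue property, uniform in the upper end point [x], as required of [K] in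
    [offdiag_small]. Quantifying over all primitives [P] makes it usable for whichever primitive is
    at hand. *)
Definition oscillates (q : R -> R[i]) := forall d : R, 0 < d -> exists N : R,
  forall (l : R) P, N < `|l| -> ac_derivative setT P (fun x => q x * ce (l * x)) ->
  forall x, 0 <= x <= pi -> cn (P x - P 0) <= d.

Lemma cac_oscillating q (l : R) : clocint setT q ->
  ac_derivative setT (cprimitive (fun x => q x * ce (l * x))) (fun x => q x * ce (l * x)).
Proof.
move=> lq; apply: cac_primitive.
by apply: clocint_eq (clocintM (@cac_ce _ setT l) lq) => t; exact: mulrC.
Qed.

(** Integration by parts: [i l P - h e^(ilx)] has derivative [- h' e^(ilx)], whose size does not
    depend on [l]. *)
Lemma oscillates_ac (h h' : R -> R) : ac setT h h' ->
  exists2 C : R, 0 <= C & forall (l : R) P,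
    ac_derivative setT P (fun x => (h x)%:C * ce (l * x)) ->
    forall x, 0 <= x <= pi -> `|l| * cn (P x - P 0) <= C.
Proof.
move=> hh; have pi0 := pi_ge0 R.
have cgn : {within `[0, pi], continuous (fun x => `|h x|)}.
  by apply: continuous_subspaceT => x; apply: cvg_norm; exact: ac_continuous hh x.
have [c c0pi hc] := EVT_max pi0 cgn; set M := `|h c| in hc.
have lh' : locint setT (fun x => 2 * `|h' x|) by exact/locintZ/locint_norm/(ac_locint hh).
pose V := primitive (fun x => 2 * `|h' x|).
have hV : ac setT V (fun x => 2 * `|h' x|) := ac_primitive lh'.
have Vmono x y : x <= y -> V x <= V y.
  by move=> xy; apply: (ac_mono xy (@subsetT _ _) hV) => t _; rewrite mulr_ge0.
have V0 : V 0 = 0 by exact: primitive0.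
exists (2 * V pi + (2 * M + 2 * M)).
  have := Vmono _ _ pi0; rewrite V0 => Vpi.
  by rewrite !addr_ge0// mulr_ge0// normr_ge0.
move=> l P hP x /andP[x0 xpi].
pose k x := 'i%C * l%:C * P x - (h x)%:C * ce (l * x).
have hk : ac_derivative setT k (fun x => - ((h' x)%:C * ce (l * x))).
  apply: cac_eq (cacD (cacZ ('i%C * l%:C) hP) (cacN (cacM (cac_real hh)
    (@cac_ce _ setT l)))) => t _; first by [].
  ring.
have h1 := cac_le x0 (@subsetT _ _) hk hV.
have {h1} : cn (k x - k 0) <= 2 * V pi.
  apply: (le_trans (h1 _)) => [t _|].
    rewrite cnN cn_realM mulrC; apply: ler_wpM2r => //; exact: cn_ce.
  by rewrite V0 subr0 ler_wpM2l// Vmono.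
have bh t : 0 <= t <= pi -> cn ((h t)%:C * ce (l * t)) <= 2 * M.
  move=> t0pi; rewrite cn_realM mulrC; apply: ler_pM => //; rewrite ?cn_ge0 ?cn_ce//.
  by apply: hc; rewrite in_itv.
have b1 := bh x; have b2 := bh 0; rewrite x0 xpi in b1; rewrite lexx pi0 in b2.
have {}b1 := b1 isT; have {}b2 := b2 isT.
move=> b3; rewrite -cn_realM -cn_i.
have -> : 'i%C * (l%:C * (P x - P 0)) = (k x - k 0) +
    ((h x)%:C * ce (l * x) + - ((h 0)%:C * ce (l * 0))) by rewrite /k; ring.
apply: le_trans (cnD _ _) _; apply: lerD => //.
by apply: le_trans (cnD _ _) _; rewrite cnN; apply: lerD.
Qed.

Lemma oscillates_real (f : R -> R) : locint setT f -> oscillates (fun x => (f x)%:C).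
Proof.
move=> lf d d0; have pi0 := pi_ge0 R.
(* The integral of [|f - h|] enters with a factor 4, namely 2 from [cac_le] times 2 from [cn_ce],
   and should cost at most [d / 2]. *)
have d80 : 0 < d / 8 by rewrite divr_gt0.
have [h [h' [hh hle]]] := ac_dense lf d80.
have [C C0 hC] := oscillates_ac hh.
exists (2 * C / d) => l P lN hP x x0pi; have /andP[x0 xpi] := x0pi.
have lh : clocint setT (fun x => (h x)%:C * ce (l * x)).
  exact: clocint_cac (cacM (cac_real hh) (@cac_ce _ setT l)).
have hP1 := cac_primitive lh; set P1 := cprimitive _ in hP1.
have e1 : cn (P1 x - P1 0) <= d / 2.
  have l0 : 0 < `|l| by apply: le_lt_trans lN; rewrite divr_ge0 ?mulr_ge0// ltW.
  rewrite -(ler_pM2l l0); apply: le_trans (hC l P1 hP1 x x0pi) _.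
  move: lN; rewrite ltr_pdivrMr// => /ltW; lra.
have lV : locint setT (fun x => `|f x - h x|).
  apply: locint_norm; have := locintD lf (locintZ (-1) (continuous_locint (ac_continuous hh))).
  by congr locint; apply/funext => t; rewrite mulN1r.
have hV := ac_primitive lV; set V := primitive _ in hV.
have Vx : V x <= d / 8.
  apply: le_trans hle; rewrite -primitive_pi -/V.
  by apply: (ac_mono xpi (@subsetT _ _) hV) => t _.
have e2 : cn ((P x - P1 x) - (P 0 - P1 0)) <= d / 2.
  have := cac_le x0 (@subsetT _ _) (cacD hP (cacN hP1)) (acZ 2 hV).
  move=> H; apply: (le_trans (H _)) => [t _|].
    have -> : (f t)%:C * ce (l * t) - (h t)%:C * ce (l * t) = (f t - h t)%:C * ce (l * t).
      by rewrite rmorphB; ring.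
    rewrite cn_realM mulrC; apply: ler_wpM2r => //; exact: cn_ce.
  rewrite {2}/V primitive0; lra.
have -> : P x - P 0 = ((P x - P1 x) - (P 0 - P1 0)) + (P1 x - P1 0) by ring.
apply: le_trans (cnD _ _) _; rewrite [d]splitr; exact: lerD.
Qed.

Lemma oscillatesZ (c : R[i]) q : clocint setT q -> oscillates q ->
  oscillates (fun x => c * q x).
Proof.
move=> lq hq d d0.
have c0 : 0 < cn c + 1 by rewrite ltr_wpDl// cn_ge0.
have [N hN] := hq (d / (cn c + 1)) (divr_gt0 d0 c0); exists N => l P lN hP x x0pi.
have hP1 := cac_oscillating l lq.
have h := hN l _ lN hP1 x x0pi; move: hP1 h; set P1 := cprimitive _ => hP1 h.
have := cacD hP (cacN (cacZ c hP1)) => hD.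
have {hD} hD : ac_derivative setT (fun x => P x - c * P1 x) (fun=> 0).
  by apply: cac_eq hD => // t _; rewrite mulrA subrr.
have x0 : 0 <= x by case/andP: x0pi.
have e := cac_const x0 (cac_sub (@subsetT _ _) hD).
have -> : P x - P 0 = c * (P1 x - P1 0) by move/eqP: e; rewrite subr_eq => /eqP ->; ring.
apply: le_trans (cnM _ _) _; rewrite ler_pdivlMr// in h.
have := cn_ge0 c; have := cn_ge0 (P1 x - P1 0); lra.
Qed.

Lemma oscillatesD q q' : clocint setT q -> clocint setT q' ->
  oscillates q -> oscillates q' -> oscillates (fun x => q x + q' x).
Proof.
move=> lq lq' hq hq' d d0; have d20 : 0 < d / 2 by rewrite divr_gt0.
have [N hN] := hq _ d20; have [N' hN'] := hq' _ d20.
exists (Num.max N N') => l P; rewrite gt_max => /andP[lN lN'] hP x x0pi.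
have hP1 := cac_oscillating l lq.
have h := hN l _ lN hP1 x x0pi; move: hP1 h; set P1 := cprimitive _ => hP1 h.
have hP2 : ac_derivative setT (fun x => P x - P1 x) (fun x => q' x * ce (l * x)).
  by apply: cac_eq (cacD hP (cacN hP1)) => // t _; ring.
have h' := hN' l _ lN' hP2 x x0pi.
have -> : P x - P 0 = (P1 x - P1 0) + ((P x - P1 x) - (P 0 - P1 0)) by ring.
by apply: le_trans (cnD _ _) _; rewrite [d]splitr; exact: lerD.
Qed.

Lemma oscillates_locint q : clocint setT q -> oscillates q.
Proof.
move=> lq; have /clocintP[l1 l2] := lq.
have c1 : clocint setT (fun x => (complex.Re (q x))%:C).
  by apply/clocintP; split => //; exact: locint_cst.
have c2 : clocint setT (fun x => (complex.Im (q x))%:C).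
  by apply/clocintP; split => //; exact: locint_cst.
have := oscillatesD c1 (clocintZ 'i%C c2) (oscillates_real l1)
  (oscillatesZ 'i%C c2 (oscillates_real l2)).
by congr oscillates; apply/funext => x; rewrite -complexE.
Qed.

End RiemannLebesgue.

(** The coefficient [b] oscillates without being small; only its primitive [K] is small. Integration
    by parts exploits this: [v - K u] vanishes at 0 and has derivative [- K a v], so [v] is of order
    [d], and then so is the increment of [u], since [u' = a v]. *)
Lemma offdiag_small (R : realType) (a b u v K : R -> R[i]) (w W : R -> R) (C d T : R) :
  0 <= T -> 0 <= C -> 0 <= d ->
  ac_derivative setT u (fun x => a x * v x) -> ac_derivative setT v (fun x => b x * u x) ->
  v 0 = 0 -> ac_derivative setT K b -> K 0 = 0 ->
  (forall x, 0 <= x <= T -> cn (K x) <= d) ->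
  (forall x, 0 <= x <= T -> cn (u x) <= C /\ cn (v x) <= C) ->
  (forall x, cn (a x) <= w x) -> ac setT W w -> W 0 = 0 ->
  cn (u T - u 0) <= 4 * (d * (C * (1 + 2 * W T) * W T)).
Proof.
move=> T0 C0 d0 hu hv v0 hK K0 Kd uvC aw hW W0.
have Wmono x y : x <= y -> W x <= W y.
  move=> xy; apply: (ac_mono xy (@subsetT _ _) hW) => t _.
  exact: le_trans (cn_ge0 _) (aw t).
have WT0 : 0 <= W T by rewrite -W0; exact: Wmono.
pose C1 := C * (1 + 2 * W T).
have vs x : 0 <= x <= T -> cn (v x) <= d * C1.
  move=> x0T; have /andP[x0 xT] := x0T.
  pose k x := v x - K x * u x.
  have hk : ac_derivative setT k (fun x => - (K x * (a x * v x))).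
    by apply: cac_eq (cacD hv (cacN (cacM hK hu))) => // t _; ring.
  have := cac_le x0 (@subsetT _ _) hk (acZ (d * C) hW).
  rewrite /k v0 K0 mul0r subr0 subr0 W0 mulr0 subr0 => H.
  have {}H : cn (v x - K x * u x) <= 2 * (d * C * W T).
    apply: (le_trans (H _)) => [t /andP[t0 tx]|].
      have t0T : 0 <= t <= T by rewrite t0 (le_trans tx xT).
      have [_ vC] := uvC t t0T; have KT := Kd t t0T; have wT := aw t.
      rewrite cnN; apply: le_trans (cnM _ _) _; rewrite -mulrA.
      apply: ler_pM; rewrite ?cn_ge0//; apply: le_trans (cnM _ _) _.
      by rewrite mulrC; apply: ler_pM; rewrite ?cn_ge0.
    by rewrite ler_wpM2l// ler_wpM2l ?mulr_ge0// Wmono.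
  have -> : v x = (v x - K x * u x) + K x * u x by ring.
  apply: le_trans (cnD _ _) _.
  have [uC _] := uvC x x0T.
  have : cn (K x * u x) <= d * C.
    by apply: le_trans (cnM _ _) _; apply: ler_pM; rewrite ?cn_ge0 ?Kd.
  by rewrite /C1; lra.
have := cac_le T0 (@subsetT _ _) hu (acZ (2 * (d * C1)) hW).
rewrite W0 mulr0 subr0 => H; apply: (le_trans (H _)) => [t t0T|].
  apply: le_trans (cnM _ _) _; rewrite mulrC.
  apply: (@le_trans _ _ (d * C1 * w t)).
    by apply: ler_pM; rewrite ?cn_ge0 ?vs.
  apply: ler_wpM2r; first exact: le_trans (cn_ge0 _) (aw t).
  have : 0 <= d * C1 by rewrite /C1 !mulr_ge0// addr_ge0// mulr_ge0.
  lra.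
by rewrite /C1; lra.
Qed.

(** * Comparison of the discriminant with the free one *)

Section Asymptotics.
Context {R : realType}.
Variables (q2 q3 : R -> R[i]).
Hypotheses (lq2 : clocint setT q2) (lq3 : clocint setT q3).
Local Notation Q := (offdiag q2 q3).

Lemma ceD (x y : R) : ce (x + y) = ce x * ce y.
Proof.
by apply: complex_ext; rewrite ?cReM ?cImM /= ?cosD ?sinD; ring.
Qed.

(** The two diagonal entries of the free flow rotate in opposite directions, so conjugation leaves
    the diagonal zero and makes the off-diagonal entries oscillate at frequency [2 l]. *)
Lemma interactionE l x : [/\ interaction q2 q3 l x 0 0 = 0,
  interaction q2 q3 l x 0 1 = (- 'i%C * q2 x) * ce (- 2 * l * x),
  interaction q2 q3 l x 1 0 = ('i%C * q3 x) * ce (2 * l * x) &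
  interaction q2 q3 l x 1 1 = 0].
Proof.
have [a b c d] := adj2E (freeE l x).
have [a1 b1 c1 d1] := @dirac_JE R; have [a2 b2 c2 d2] := offdiagE q2 q3 x.
have [a3 b3 c3 d3] := mx22E (ce (l * x)) 0 0 (ce (- (l * x))).
have -> : - 2 * l * x = - (l * x) + - (l * x) by ring.
have -> : 2 * l * x = l * x + l * x by ring.
split; rewrite /interaction /JQ !mul22E ?a ?b ?c ?d ?a1 ?b1 ?c1 ?d1 ?a2 ?b2 ?c2 ?d2
  /freeE ?a3 ?b3 ?c3 ?d3 ?ceD; ring.
Qed.

(** The trace is [e^(i l pi) U_00 + e^(- i l pi) U_11], and [offdiag_small], applied to each column
    of [U], shows that both diagonal entries tend to 1. *)
Theorem hill_F_asymptotic (eps : R) : 0 < eps -> exists N : R, forall l : R, N < `|l| ->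
  cn (hill_F Q l%:C - (2 * cos (pi * l))%:C) <= eps.
Proof.
move=> eps0; have pi0 := pi_ge0 R.
have [C C0 hC] := interaction_solution lq2 lq3.
pose W x := 16 * mass (JQ q2 q3) x.
have hW : ac setT W (fun x => 16 * mnorm (JQ q2 q3 x)).
  exact: acZ (ac_mass (mlocint_JQ lq2 lq3)).
have W0 : W 0 = 0 by rewrite /W mass0 mulr0.
have WT0 : 0 <= W pi.
  by rewrite /W mulr_ge0// -(mass0 (JQ q2 q3)); exact: mass_mono (mlocint_JQ lq2 lq3) _ _ pi0.
(* The 16 collects the 4 of [offdiag_small], the 2 of [cn_ce] and the two terms of the trace.
   Dividing [eps] by [C2 + 1] below avoids a vanishing denominator. *)
pose C2 := 16 * (C * (1 + 2 * W pi) * W pi).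
have h12 : 0 <= 1 + 2 * W pi by lra.
have C20 : 0 <= C2.
  by apply: mulr_ge0 => //; apply: mulr_ge0 => //; exact: mulr_ge0.
have C21 : 0 < C2 + 1 by rewrite ltr_wpDl.
have d0 : 0 < eps / (C2 + 1) by rewrite divr_gt0.
set d := eps / (C2 + 1) in d0.
have l2 : clocint setT (fun x => - 'i%C * q2 x) by exact: clocintZ.
have l3 : clocint setT (fun x => 'i%C * q3 x) by exact: clocintZ.
have [N2 hN2] := oscillates_locint l2 d0.
have [N3 hN3] := oscillates_locint l3 d0.
exists (Num.max N2 N3) => l; rewrite gt_max => /andP[lN2 lN3].
have l2N : `|l| <= `|2 * l| by rewrite normrM normr_nat ler_peMl// ler1n.
have l2N' : `|l| <= `|- 2 * l| by rewrite mulNr normrN.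
have [U [hU U0 EU bU]] := hC l.
have IE x := interactionE l x.
have hI i j : ac_derivative setT (cprimitive (fun x => interaction q2 q3 l x i j))
    (fun x => interaction q2 q3 l x i j).
  by apply: cac_primitive; exact: mlocint_interaction.
have K01 x : 0 <= x <= pi -> cn (cprimitive (fun x => interaction q2 q3 l x 0 1) x) <= d.
  move=> x0pi; rewrite -[X in cn X]subr0 -(cprimitive0 (fun x => interaction q2 q3 l x 0 1)).
  apply: (hN2 (- 2 * l) _ (lt_le_trans lN2 l2N') _ x x0pi).
  by apply: cac_eq (hI 0 1) => // t _; case: (IE t).
have K10 x : 0 <= x <= pi -> cn (cprimitive (fun x => interaction q2 q3 l x 1 0) x) <= d.
  move=> x0pi; rewrite -[X in cn X]subr0 -(cprimitive0 (fun x => interaction q2 q3 l x 1 0)).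
  apply: (hN3 (2 * l) _ (lt_le_trans lN3 l2N) _ x x0pi).
  by apply: cac_eq (hI 1 0) => // t _; case: (IE t).
have wN i j x : cn (interaction q2 q3 l x i j) <= 16 * mnorm (JQ q2 q3 x).
  exact: le_trans (mnorm_entry _ _ _) (mnorm_interaction _ _ _ _).
have hUe i j : ac_derivative setT (fun x => U x i j)
    (fun x => interaction q2 q3 l x i 0 * U x 0 j + interaction q2 q3 l x i 1 * U x 1 j).
  by apply: cac_eq (hU i j) => // t _; rewrite mul22E.
have bUe i j x : 0 <= x <= pi -> cn (U x i j) <= C.
  by move=> x0pi; apply: le_trans (mnorm_entry _ _ _) (bU x x0pi).
have U0E i j : U 0 i j = (i == j)%:R by rewrite U0 mxE.
have h00 : cn (U pi 0 0 - U 0 0 0) <= 4 * (d * (C * (1 + 2 * W pi) * W pi)).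
  apply: (@offdiag_small _ (fun x => interaction q2 q3 l x 0 1)
    (fun x => interaction q2 q3 l x 1 0) (fun x => U x 0 0) (fun x => U x 1 0)
    _ _ W C d pi pi0 C0 (ltW d0) _ _ _ (hI 1 0) (cprimitive0 _) K10 _ (wN 0 1) hW W0).
  - by apply: cac_eq (hUe 0 0) => // t _; case: (IE t) => -> _ _ _; rewrite mul0r add0r.
  - by apply: cac_eq (hUe 1 0) => // t _; case: (IE t) => _ _ _ ->; rewrite mul0r addr0.
  - by rewrite U0E.
  - by move=> x x0pi; split; exact: bUe.
have h11 : cn (U pi 1 1 - U 0 1 1) <= 4 * (d * (C * (1 + 2 * W pi) * W pi)).
  apply: (@offdiag_small _ (fun x => interaction q2 q3 l x 1 0)
    (fun x => interaction q2 q3 l x 0 1) (fun x => U x 1 1) (fun x => U x 0 1)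
    _ _ W C d pi pi0 C0 (ltW d0) _ _ _ (hI 0 1) (cprimitive0 _) K01 _ (wN 1 0) hW W0).
  - by apply: cac_eq (hUe 1 1) => // t _; case: (IE t) => _ _ _ ->; rewrite mul0r addr0.
  - by apply: cac_eq (hUe 0 1) => // t _; case: (IE t) => -> _ _ _; rewrite mul0r add0r.
  - by rewrite U0E.
  - by move=> x x0pi; split; exact: bUe.
rewrite !U0E /= in h00 h11.
have -> : hill_F Q l%:C - (2 * cos (pi * l))%:C =
    ce (l * pi) * (U pi 0 0 - 1) + ce (- (l * pi)) * (U pi 1 1 - 1).
  have -> : (2 * cos (pi * l))%:C = ce (l * pi) + ce (- (l * pi)) :> R[i].
    by apply: complex_ext; rewrite ?cReD ?cImD /= mulrC ?cosN ?sinN (mulrC pi); ring.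
  have [a3 b3 c3 d3] := mx22E (ce (l * pi)) 0 0 (ce (- (l * pi))).
  by rewrite /hill_F EU tr22E !mul22E /freeE a3 b3 c3 d3; ring.
apply: le_trans (cnD _ _) _.
have e1 := le_trans (cnM (ce (l * pi)) (U pi 0 0 - 1))
  (ler_wpM2r (cn_ge0 _) (cn_ce _)).
have e2 := le_trans (cnM (ce (- (l * pi))) (U pi 1 1 - 1))
  (ler_wpM2r (cn_ge0 _) (cn_ce _)).
apply: (@le_trans _ _ (d * C2)); first by rewrite /C2; lra.
have epsE : eps = d * (C2 + 1) by rewrite /d divfK// gt_eqF.
rewrite epsE; apply: ler_wpM2l; first exact: ltW.
by rewrite lerDl.
Qed.

End Asymptotics.

(** * Complex derivatives of power series *)

Section EntireSeries.
Context {R : realType}.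
Implicit Types (c : nat -> R[i]) (z h : R[i]).

(** Together with [cn_le_norm], this links the l1 norm to the modulus, in which the limit defining a
    complex derivative is taken. *)
Lemma norm_le_cn z : `|z| <= (cn z)%:C.
Proof.
rewrite {1}[z]complexE /cn rmorphD/=; apply: le_trans (ler_normD _ _) _.
rewrite normrM; have -> : `|'i%C| = 1 :> R[i] by rewrite normc_def /= expr0n expr1n add0r sqrtr1.
have e (x : R) : `|x%:C| = `|x|%:C :> R[i] by rewrite normc_def /= expr0n addr0 sqrtr_sqr.
by rewrite !e mul1r.
Qed.

Lemma cn_le_norm z : (cn z)%:C <= 2 * `|z|.
Proof.
have h1 := normc_ge_Re z.
have h2 := normc_ge_Re (z * 'i%C).
rewrite /cn rmorphD/=; rewrite ReiNIm normrN normrM in h2.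
have e : `|'i%C| = 1 :> R[i] by rewrite normc_def /= expr0n expr1n add0r sqrtr1.
rewrite e mulr1 in h2.
have -> : 2 * `|z| = `|z| + `|z| by ring.
exact: lerD.
Qed.

Lemma pow_diff1 z h (r : R) k : 1 <= r -> cn z + cn h <= r ->
  cn ((z + h) ^+ k - z ^+ k) <= cn h * (2 * r) ^+ k.
Proof.
move=> r1 zhr; have cz := cn_ge0 z; have ch := cn_ge0 h.
elim: k => [|k IH]; first by rewrite !expr0 subrr cn0 mulr1.
have -> : (z + h) ^+ k.+1 - z ^+ k.+1 = (z + h) * ((z + h) ^+ k - z ^+ k) + h * z ^+ k.
  by rewrite !exprS; ring.
have r0 : 0 <= r by lra.
apply: le_trans (cnD _ _) _.
have h1 : cn ((z + h) * ((z + h) ^+ k - z ^+ k)) <= r * (cn h * (2 * r) ^+ k).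
  apply: le_trans (cnM _ _) _; apply: ler_pM; rewrite ?cn_ge0//.
  exact: le_trans (cnD _ _) zhr.
have h2 : cn (h * z ^+ k) <= cn h * (r * (2 * r) ^+ k).
  apply: le_trans (cnM _ _) _; apply: ler_wpM2l => //; apply: le_trans (cnX _ _) _.
  apply: (@le_trans _ _ ((2 * r) ^+ k)).
    by rewrite lerXn2r ?nnegrE ?mulr_ge0//; lra.
  by rewrite ler_peMl// exprn_ge0// mulr_ge0.
rewrite exprS; apply: le_trans (lerD h1 h2) _.
by rewrite le_eqVlt; apply/orP; left; apply/eqP; ring.
Qed.

(** A crude [(2 r) ^+ k] replaces the sharp polynomial factor in [k]: it survives the induction, and
    against the coefficients of an [entire] series it still sums to an exponential. *)
Lemma pow_diff2 z h (r : R) k : 1 <= r -> cn z + cn h <= r ->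
  cn ((z + h) ^+ k - z ^+ k - h * (k%:R * z ^+ k.-1)) <= cn h ^+ 2 * (2 * r) ^+ k.
Proof.
move=> r1 zhr; have cz := cn_ge0 z; have ch := cn_ge0 h.
have r0 : 0 <= r by lra.
elim: k => [|k IH].
  by rewrite !expr0 subrr mul0r mulr0 subr0 cn0 mulr1 exprn_ge0.
have -> : (z + h) ^+ k.+1 - z ^+ k.+1 - h * (k.+1%:R * z ^+ k.+1.-1) =
    z * ((z + h) ^+ k - z ^+ k - h * (k%:R * z ^+ k.-1)) +
    h * ((z + h) ^+ k - z ^+ k).
  case: k {IH} => [|k]; first by rewrite /= !expr1 !expr0; ring.
  by rewrite /= -(natr1 k.+1) !exprS; ring.
apply: le_trans (cnD _ _) _.
have h1 : cn (z * ((z + h) ^+ k - z ^+ k - h * (k%:R * z ^+ k.-1))) <=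
    r * (cn h ^+ 2 * (2 * r) ^+ k).
  apply: le_trans (cnM _ _) _; apply: ler_pM; rewrite ?cn_ge0//; lra.
have h2 : cn (h * ((z + h) ^+ k - z ^+ k)) <= cn h * (cn h * (r * (2 * r) ^+ k)).
  apply: le_trans (cnM _ _) _; apply: ler_wpM2l => //.
  apply: le_trans (pow_diff1 k r1 zhr) _; apply: ler_wpM2l => //.
  by rewrite ler_peMl// exprn_ge0// mulr_ge0.
rewrite [(2 * r) ^+ k.+1]exprS; apply: le_trans (lerD h1 h2) _.
by rewrite le_eqVlt; apply/orP; left; apply/eqP; ring.
Qed.

(** Coefficients of a function of exponential type, dominated by the Taylor coefficients of
    [C exp (D z)]; the class is stable under [dcoef]. *)
Definition entire c (C D : R) := [/\ 0 <= C, 0 <= D &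
  forall k, cn (c k) <= C * (D ^+ k / k`!%:R)].

Definition dcoef c (k : nat) : R[i] := k.+1%:R * c k.+1.

Lemma entire_dcoef c C D : entire c C D -> entire (dcoef c) (C * D) D.
Proof.
move=> [C0 D0 h]; split => //; first exact: mulr_ge0.
move=> k; rewrite /dcoef -[k.+1%:R](rmorph_nat (real_complex R)) cn_realM normr_nat.
have k0 : k.+1%:R != 0 :> R by rewrite pnatr_eq0.
have f0 : k`!%:R != 0 :> R by rewrite pnatr_eq0 -lt0n fact_gt0.
apply: (le_trans (ler_wpM2l _ (h k.+1))) => //.
rewrite le_eqVlt; apply/orP; left; apply/eqP.
rewrite factS natrM exprS; move: k0 f0; move: (k.+1%:R : R) (k`!%:R : R) => a b a0 b0.
by field; rewrite a0 b0.
Qed.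

Lemma entire_sum c C D z : entire c C D -> exists s, csums (fun k => c k * z ^+ k) s.
Proof.
move=> [C0 D0 h].
have cv := @exp_series_cvg R C (D * cn z).
apply: (csums_exists _ cv) => k.
apply: le_trans (cnM _ _) _; rewrite exprMn.
have -> : C * (D ^+ k * cn z ^+ k / k`!%:R) = C * (D ^+ k / k`!%:R) * cn z ^+ k by ring.
by apply: ler_pM; rewrite ?cn_ge0// cnX.
Qed.

Lemma entire_diff2 c C D (f f' : R[i] -> R[i]) z h (r : R) : entire c C D ->
  (forall z, csums (fun k => c k * z ^+ k) (f z)) ->
  (forall z, csums (fun k => dcoef c k * z ^+ k) (f' z)) ->
  1 <= r -> cn z + cn h <= r ->
  cn (f (z + h) - f z - h * f' z) <= C * expR (D * (2 * r)) * cn h ^+ 2.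
Proof.
move=> [C0 D0 hc] hf hf' r1 zhr.
have e' : csums (fun k => k%:R * c k * z ^+ k.-1) (f' z).
  have := @csums_shift _ (fun k => k%:R * c k * z ^+ k.-1) (f' z).
  rewrite /= mul0r mul0r add0r; apply; exact: hf'.
have e : csums (fun k => c k * ((z + h) ^+ k - z ^+ k - h * (k%:R * z ^+ k.-1)))
    (f (z + h) - f z - h * f' z).
  have := csumsD (hf (z + h)) (csumsD (csumsZ (-1) (hf z)) (csumsZ (- h) e')).
  have -> : f (z + h) + (-1 * f z + - h * f' z) = f (z + h) - f z - h * f' z by ring.
  by apply: csums_eq => k; ring.
apply: csums_le e _ => N.
have r20 : 0 <= 2 * r by lra.
apply: (@le_trans _ _ (\sum_(k < N) cn h ^+ 2 * (C * ((D * (2 * r)) ^+ k / k`!%:R)))).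
  apply: ler_sum => k _; apply: le_trans (cnM _ _) _.
  have -> : cn h ^+ 2 * (C * ((D * (2 * r)) ^+ k / k`!%:R)) =
    C * (D ^+ k / k`!%:R) * (cn h ^+ 2 * (2 * r) ^+ k) by rewrite exprMn; ring.
  by apply: ler_pM; rewrite ?cn_ge0// pow_diff2.
rewrite -mulr_sumr mulrC; apply: ler_wpM2r; first by rewrite exprn_ge0// cn_ge0.
by apply: exp_series_le => //; rewrite mulr_ge0.
Qed.

(** The quadratic remainder of [entire_diff2], divided by [h], is of order [h]. *)
Lemma entire_derive1 c C D (f f' : R[i] -> R[i]) z0 : entire c C D ->
  (forall z, csums (fun k => c k * z ^+ k) (f (z0 + z))) ->
  (forall z, csums (fun k => dcoef c k * z ^+ k) (f' (z0 + z))) ->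
  derive1 (f : R[i] -> R[i]^o) = f'.
Proof.
move=> ec hf hf'; apply/funext => w.
rewrite /derive1; apply: cvg_lim => //; apply/cvgrPdist_le => eps eps0.
pose z := w - z0; pose r : R := cn z + 1.
have r1 : 1 <= r by rewrite lerDr cn_ge0.
pose K := C * expR (D * (2 * r)).
have [C0 D0 _] := ec.
have K0 : 0 <= K by rewrite mulr_ge0// expR_ge0.
have key h : cn h <= 1 -> cn (f (w + h) - f w - h * f' w) <= K * cn h ^+ 2.
  move=> h1; have zhr : cn z + cn h <= r by rewrite lerD2l.
  have := @entire_diff2 c C D (fun y => f (z0 + y)) (fun y => f' (z0 + y)) z h r ec hf hf' r1 zhr.
  by rewrite addrA /z [z0 + (w - z0)]addrC subrK.
(* The 4 is the square of the constant in [cn_le_norm], and [K + 1] avoids dividing by zero. *)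
have K40 : 0 < 4 * (K + 1)%:C :> R[i].
  by rewrite mulr_gt0// (ltcR 0) ltr_wpDl.
near=> h.
have h0 : h != 0 by near: h; exact: nbhs_dnbhs_neq.
have nh0 : 0 < `|h| by rewrite normr_gt0.
have hle : 4 * (K + 1)%:C * `|h| <= eps.
  rewrite mulrC -ler_pdivlMr//; near: h.
  by apply: dnbhs0_le; rewrite divr_gt0.
have h1 : cn h <= 1.
  rewrite -lecR; apply: le_trans (cn_le_norm h) _.
  rewrite mulrC -ler_pdivlMr//; near: h.
  by apply: dnbhs0_le; rewrite divr_gt0// ltr01.
have {}key := key h h1.
have -> : f' w - h^-1 *: (f (h + w) - f w) = - (h^-1 * (f (w + h) - f w - h * f' w)).
  by rewrite /GRing.scale/= [h + w]addrC; field.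
rewrite normrN normrM normfV mulrC ler_pdivrMr//.
apply: le_trans (norm_le_cn _) _.
apply: (@le_trans _ _ ((K * cn h ^+ 2)%:C)); first by rewrite lecR.
apply: (@le_trans _ _ (4 * (K + 1)%:C * `|h| * `|h|)); last by rewrite ler_wpM2r.
rewrite rmorphM rmorphXn/=.
have cnh : (cn h)%:C ^+ 2 <= (2 * `|h|) ^+ 2.
  by rewrite lerXn2r ?cn_le_norm// nnegrE ?mulr_ge0// ler0c cn_ge0.
apply: (@le_trans _ _ (K%:C * (2 * `|h|) ^+ 2)).
  by apply: ler_wpM2l => //; rewrite ler0c.
have -> : 4 * (K + 1)%:C * `|h| * `|h| = (K + 1)%:C * (2 * `|h|) ^+ 2 by ring.
apply: ler_wpM2r; first by rewrite exprn_ge0// mulr_ge0.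
by rewrite lecR lerDl.
Unshelve. all: by end_near.
Qed.

Lemma csums_at0 c s : csums (fun k => c k * 0 ^+ k) s -> s = c 0%N.
Proof.
move=> h; apply: csums_unique h _.
have := @csums_shift _ (fun k => c k * 0 ^+ k) 0; rewrite expr0 mulr1 addr0; apply.
by apply: ccvg_eq (ccvg_cst 0) => N; rewrite big1// => k _; rewrite expr0n/= mulr0.
Qed.

Theorem entire_derive1n c C D (f : R[i] -> R[i]) z0 : entire c C D ->
  (forall z, csums (fun k => c k * z ^+ k) (f (z0 + z))) ->
  [/\ f z0 = c 0%N, derive1n 1 (f : R[i] -> R[i]^o) z0 = c 1%N &
      derive1n 2 (f : R[i] -> R[i]^o) z0 = 2 * c 2%N].
Proof.
move=> ec hf.
have ec1 := entire_dcoef ec; have ec2 := entire_dcoef ec1.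
have aux c' C' D' : entire c' C' D' ->
    exists f' : R[i] -> R[i], forall z, csums (fun k => c' k * z ^+ k) (f' (z0 + z)).
  move=> ec'; exists (fun y => projT1 (cid (entire_sum (y - z0) ec'))) => z.
  by rewrite addrAC subrr add0r; exact: projT2 (cid _).
have [f1 hf1] := aux _ _ _ ec1; have [f2 hf2] := aux _ _ _ ec2.
have e1 := entire_derive1 ec hf hf1; have e2 := entire_derive1 ec1 hf1 hf2.
have at0 c' (g : R[i] -> R[i]) : (forall z, csums (fun k => c' k * z ^+ k) (g (z0 + z))) ->
    g z0 = c' 0%N.
  by move=> /(_ 0); rewrite addr0; exact: csums_at0.
split; first exact: at0.
- by rewrite derive1n1 e1 (at0 _ _ hf1) /dcoef mul1r.
- by rewrite derive1nS derive1n1 e1 e2 (at0 _ _ hf2) /dcoef mul1r.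
Qed.

End EntireSeries.

(** * Gaps and roots of real entire functions *)

Section FiniteBounded.
Context {R : realType}.

Definition norm_bounded (A : set R) := exists M, forall x, A x -> `|x| <= M.

Lemma finite_norm_bounded (A : set R) : finite_set A -> norm_bounded A.
Proof.
move=> /finite_compact/compact_bounded [M [_ hM]]; exists (M + 1) => x Ax.
by apply: hM => //; rewrite ltrDl.
Qed.

(** Bolzano-Weierstrass: an infinite bounded set has a limit point, possibly outside the set. This
    is why isolation is assumed around every real point. *)
Lemma norm_bounded_finite (A : set R) : (forall l, exists2 e : R, 0 < e &
    forall h, 0 < `|h| < e -> ~ A (l + h)) -> norm_bounded A -> finite_set A.
Proof.
move=> iso [M hM]; apply: contrapT => infA.
have bA : bounded_set A.
  by exists M; split; [exact: num_real|] => y /ltW My x /hM; move=> /le_trans; apply.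
have [l hl] := infinite_bounded_limit_point_nonempty infA bA.
have [e e0 he] := iso l.
have [y [yl Ay /= lye]] := hl _ (nbhsx_ballx l e e0).
apply: (he (y - l)); last by rewrite addrC subrK.
by rewrite normr_gt0 subr_eq0 yl/= distrC.
Qed.

End FiniteBounded.

(** The arithmetic of [far_root_concave], with [g = h ^+ 2], [s = f l], [dh = d l 2 * h ^+ 2],
    [c = cos (pi h)], [c0 = cos (pi l)], [kh = K * h ^+ 3], and [cp], [cm], [fp], [fm] the values of
    the cosine and of [f] at [l + h] and [l - h]. Comparing second differences gives
    [2 dh = 2 s (c - 1)] up to an error of at most [g], while the right-hand side has modulus at
    least [2 g]. *)
Lemma second_difference_sign (R : realType) (s dh g c c0 cp cm fp fm kh : R) :
  0 < g -> s ^+ 2 = 4 -> kh <= g / 4 -> g / 2 <= 1 - c -> -1 <= c ->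
  cp + cm = 2 * c0 * c -> `|s - 2 * c0| <= g / 8 ->
  `|fp - 2 * cp| <= g / 8 -> `|fm - 2 * cm| <= g / 8 ->
  `|fp + fm - 2 * s - 2 * dh| <= 2 * kh -> s * dh < 0.
Proof.
move=> g0 s4 hk q cge cs h0 hp hm ht.
have c1 : `|c| <= 1 by rewrite ler_norml; apply/andP; split=> //; lra.
have k1 : `|(2 * c0 - s) * c| <= g / 8.
  rewrite normrM -[X in _ <= X]mulr1 distrC; exact: ler_pM.
have es : s = 2 \/ s = - 2.
  have : (s - 2) * (s + 2) == 0 by apply/eqP; rewrite -[RHS](subrr 4) -{1}s4; ring.
  by rewrite mulf_eq0 => /orP[/eqP|/eqP] e; [left|right]; lra.
have key : `|2 * dh - 2 * s * (c - 1)| <= g / 2 + 2 * kh.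
  have -> : 2 * dh - 2 * s * (c - 1) = - (fp + fm - 2 * s - 2 * dh) +
    ((fp - 2 * cp) + (fm - 2 * cm)) + 2 * ((2 * c0 - s) * c).
    by rewrite mulrBl -(mulrA 2 c0 c) (mulrA 2 c0 c) -cs; ring.
  apply: le_trans (ler_normD _ _) _; rewrite normrM (ger0_norm (ler0n _ 2)).
  have := ler_normD (- (fp + fm - 2 * s - 2 * dh)) ((fp - 2 * cp) + (fm - 2 * cm)).
  have := ler_normD (fp - 2 * cp) (fm - 2 * cm).
  rewrite normrN; move: hp hm ht k1; clear; lra.
move: key; rewrite ler_norml => /andP[key1 key2].
by case: es => es; rewrite es in key1 key2 *; move: key1 key2 g0 hk q; clear; lra.
Qed.

(** * Roots and gaps of a real function with uniform Taylor bounds *)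

Section RealEntire.
Context {R : realType}.
Variables (f : R -> R) (d : R -> nat -> R) (C D : R).
Hypotheses (C0 : 0 <= C) (D0 : 0 <= D).
Hypothesis hd : forall l k, `|d l k| <= C * (D ^+ k / k`!%:R).
Hypothesis hf : forall l h,
  (fun N => \sum_(k < N) d l k * h ^+ k) @ \oo --> f (l + h).

Let K := C * expR D.

(** For [|h| <= 1] every term of the tail carries a factor of at most [|h| ^+ m], and the remaining
    coefficients sum to at most [K], whatever the point [l]. *)
Lemma taylor_bound l m h : `|h| <= 1 ->
  `|f (l + h) - \sum_(k < m) d l k * h ^+ k| <= K * `|h| ^+ m.
Proof.
move=> h1.
have cv : (fun N => `|\sum_(k < (N + m)) d l k * h ^+ k - \sum_(k < m) d l k * h ^+ k|)
    @ \oo --> `|f (l + h) - \sum_(k < m) d l k * h ^+ k|.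
  apply: cvg_norm; apply: cvgB; last exact: cvg_cst.
  by have := @hf l h; rewrite -(cvg_shiftn m).
rewrite -(cvg_lim _ cv)//; apply: limr_le; first exact: cvgP cv.
apply: nearW => N; rewrite addnC big_split_ord/= addrAC subrr add0r.
apply: le_trans (ler_norm_sum _ _ _) _.
apply: (@le_trans _ _ (\sum_(k < N) C * (D ^+ (m + k) / (m + k)`!%:R) * `|h| ^+ m)).
  apply: ler_sum => k _; rewrite normrM normrX exprD.
  apply: ler_pM; [exact: normr_ge0|by rewrite mulr_ge0// exprn_ge0|exact: hd|].
  by rewrite ler_piMr ?exprn_ge0// exprn_ile1.
rewrite -mulr_suml; apply: ler_wpM2r; first by rewrite exprn_ge0.
apply: le_trans (exp_series_le (m + N) C0 D0).
rewrite big_split_ord/= lerDr; apply: sumr_ge0 => k _.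
by rewrite mulr_ge0// mulr_ge0// ?exprn_ge0// invr_ge0.
Qed.

Lemma f_at l : f l = d l 0%N.
Proof.
have := @taylor_bound l 1 0; rewrite normr0 expr1 mulr0 addr0 big_ord1 expr0 mulr1.
by move=> /(_ ler01); rewrite normr_le0 subr_eq0 => /eqP.
Qed.

Lemma K_ge0 : 0 <= K. Proof. by rewrite mulr_ge0// expR_ge0. Qed.

Lemma f_continuous : continuous f.
Proof.
move=> l; apply/cvgrPdist_le => e e0.
have K1 : 0 < K + 1 by have := K_ge0; lra.
near=> y.
have hy : `|y - l| <= Num.min 1 (e / (K + 1)).
  rewrite distrC; near: y; apply: cvgr_dist_le; first exact: cvg_id.
  by rewrite lt_min ltr01 divr_gt0.
move: hy; rewrite le_min => /andP[y1 ye].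
have := taylor_bound l 1 y1; rewrite big_ord1 expr0 mulr1 expr1 -f_at (addrC l) subrK distrC.
move=> /le_trans; apply; rewrite ler_pdivlMr// in ye; have := normr_ge0 (y - l); lra.
Unshelve. all: by end_near.
Qed.

(* The first non-vanishing Taylor coefficient decides the local behaviour. *)
Lemma leading_term l s m (e := fun k => d l k - (k == 0)%:R * s) :
  (forall j, (j < m)%N -> e j = 0) -> forall h, `|h| <= 1 ->
  `|f (l + h) - s - e m * h ^+ m| <= K * `|h| ^+ m.+1.
Proof.
move=> ej h h1; have := taylor_bound l m.+1 h1.
have -> : \sum_(k < m.+1) d l k * h ^+ k = s + e m * h ^+ m; last by rewrite opprD addrA.
transitivity (\sum_(k < m.+1) ((k == 0%N :> nat)%:R * s + e k * h ^+ k)).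
  apply: eq_bigr => -[[|k] hk] _ /=; rewrite /e /=; last by rewrite !mul0r subr0 add0r.
  by rewrite expr0; ring.
rewrite big_split/=; congr (_ + _).
  by rewrite big_ord_recl/= mul1r big1 ?addr0// => i _; rewrite mul0r.
by rewrite big_ord_recr/= big1 ?add0r// => i _; rewrite ej ?mul0r.
Qed.

Lemma value_isolated s l m : d l m - (m == 0%N)%:R * s != 0 -> exists2 e : R, 0 < e &
  forall h, 0 < `|h| < e -> f (l + h) <> s.
Proof.
pose e k := d l k - (k == 0%N)%:R * s; rewrite -/(e m) => em.
pose m0 := ex_minn (ex_intro (fun k => e k != 0) m em).
have [em0 mmin] : e m0 != 0 /\ forall j, (j < m0)%N -> e j = 0.
  rewrite /m0; case: ex_minnP => k ek kmin; split => // j jk.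
  by apply/eqP; apply: contraTT jk => /kmin; rewrite -leqNgt.
have K1 : 0 < K + 1 by have := K_ge0; lra.
have e0 : 0 < `|e m0| by rewrite normr_gt0.
exists (Num.min 1 (`|e m0| / (K + 1))); first by rewrite lt_min ltr01 divr_gt0.
move=> h /andP[h0]; rewrite lt_min => /andP[h1 he] fs.
have := leading_term mmin (ltW h1); rewrite fs subrr sub0r normrN normrM normrX.
have hm : 0 < `|h| ^+ m0 by rewrite exprn_gt0.
rewrite exprS mulrA ler_pM2r// leNgt => /negP; apply.
rewrite ltr_pdivlMr// in he; lra.
Qed.

(** Serves to show that the Taylor coefficients of the discriminant are real: their imaginary parts
    expand the zero function. *)
Lemma coef_eq0 : (forall x, f x = 0) -> forall l k, d l k = 0.
Proof.
move=> f0 l k; apply/eqP/negPn/negP => dk.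
have [|e e0 he] := @value_isolated 0 l k; first by rewrite mulr0 subr0.
by apply: (he (e / 2)) (f0 _); rewrite gtr0_norm ?divr_gt0//; apply/andP; split; lra.
Qed.

(** If all coefficients of [f - s] at [l] vanished, the series at [l], which represents [f]
    everywhere, would make [f] constant. *)
Lemma root_isolated s : (exists y, f y <> s) -> forall l, exists2 e : R, 0 < e &
  forall h, 0 < `|h| < e -> f (l + h) <> s.
Proof.
move=> [y fy] l; pose e k := d l k - (k == 0)%:R * s.
have [[m em]|ez] := pselect (exists m, e m != 0); first exact: value_isolated em.
exfalso; apply: fy.
have e0 k : e k = 0 by apply/eqP/negPn/negP => ek; apply: ez; exists k.
have := @hf l (y - l); rewrite (addrC l) subrK => cv.
have cv' : (fun N => \sum_(k < N.+1) d l k * (y - l) ^+ k) @ \oo --> f y.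
  by rewrite (cvg_shiftS (fun N => \sum_(k < N) d l k * (y - l) ^+ k)).
apply: cvg_unique cv' _ => //; apply: cvg_near_cst; apply: nearW => N.
rewrite big_ord_recl big1 ?addr0 => [|i _].
  by have := e0 0%N; rewrite /e /= mul1r expr0 mulr1 => /eqP; rewrite subr_eq0 => /eqP.
by have := e0 (lift ord0 i); rewrite /e /= mul0r subr0 => ->; rewrite mul0r.
Qed.

Hypothesis asym : forall eps : R, 0 < eps -> exists N, forall l, N < `|l| ->
  `|f l - 2 * cos (pi * l)| <= eps.

Lemma cos_root z : exists2 y : R, z <= y <= z + 1 & cos (pi * y) = 0.
Proof.
have zz : z <= z + 1 by lra.
have cc : {within `[z, z + 1], continuous (fun y : R => cos (pi * y))}.
  apply: continuous_subspaceT => x.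
  apply: (@continuous_comp _ _ _ (fun y => pi * y) cos); last exact: continuous_cos.
  by apply: cvgM; [exact: cvg_cst|exact: cvg_id].
have e : cos (pi * (z + 1)) = - cos (pi * z) by rewrite mulrDr mulr1 cosDpi.
have [|y yz fy] := @IVT R _ z (z + 1) 0 zz cc.
  rewrite e; case: (leP 0 (cos (pi * z))) => h.
    by rewrite ge_min le_max h oppr_le0 h orbT.
  by rewrite ge_min le_max (ltW h) oppr_ge0 (ltW h) orbT.
by exists y => //; move: yz; rewrite in_itv.
Qed.

(** The cosine has a zero in each unit interval. Far out, every unit interval therefore contains a
    point that lies in no gap; in particular [f] is not constant. *)
Lemma small_value : exists2 N0 : R, 0 <= N0 & forall z, N0 < z \/ z + 1 < - N0 ->
  exists2 y, z <= y <= z + 1 & `|f y| <= 1.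
Proof.
have [N hN] := asym ltr01.
exists `|N| => // z hz; have [y zyz cy] := cos_root z; exists y => //.
have := hN y; rewrite cy mulr0 subr0; apply.
apply: le_lt_trans (ler_norm N) _; move: zyz => /andP[zy yz].
case: hz => hz; first by apply: lt_le_trans (ler_norm y); lra.
by apply: (@lt_le_trans _ _ (- y)); [lra|rewrite -normrN ler_norm].
Qed.

(** With [t = pi h / 2], the right-hand side is [2 sin^2 t]. Near 0 the cosine is at least [1 / 2],
    so [sin t >= t / 2], and [t >= h] because [pi >= 2]. *)
Lemma cos_quadratic : exists2 r : R, 0 < r & forall h, 0 <= h <= r ->
  h ^+ 2 / 2 <= 1 - cos (pi * h).
Proof.
have half0 : 0 < 1 / 2 :> R by rewrite divr_gt0.
have /cvgrPdist_le/(_ _ half0)[r /= r0 hr] := @continuous_cos R 0.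
have pi0 : 0 < pi :> R := pi_gt0 R.
have pi2 : 2 <= pi :> R := pi_ge2 R.
exists (r / pi); first by rewrite divr_gt0.
move=> h /andP[h0 hrp].
pose t := pi * h / 2.
have t0 : 0 <= t by rewrite divr_ge0// mulr_ge0// ltW.
have tr : t < r \/ t = 0.
  move: hrp; rewrite ler_pdivlMr// => hrp.
  have [hz|hn] := eqVneq h 0; [by right; rewrite /t hz mulr0 mul0r|left].
  have : 0 < h by rewrite lt0r hn.
  by move=> hp; have := mulr_gt0 pi0 hp; rewrite /t; lra.
have cost u : 0 <= u <= t -> 1 / 2 <= cos u.
  move=> /andP[u0 ut]; case: tr => [tr|t00].
    have := hr u; rewrite /= sub0r normrN ger0_norm// => /(_ (le_lt_trans ut tr)).
    by rewrite cos0 => h1; have := ler_norm (1 - cos u); lra.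
  have -> : u = 0 by apply/eqP; rewrite eq_le u0 -{1}t00 ut.
  by rewrite cos0; lra.
have sint : t / 2 <= sin t.
  have hs : ac setT (@sin R) (@cos R).
    by apply: ac_derive; exact: continuous_cos.
  have := ac_le t0 (@subsetT _ _) (@ac_linear _ setT (1 / 2)) hs cost.
  by rewrite sin0 mulr0 !subr0 mul1r mulrC.
have -> : pi * h = t *+ 2 by rewrite /t mulr2n; lra.
rewrite cos_mulr2n -[in X in _ <= X](cos2Dsin2 t).
have s2 : (t / 2) ^+ 2 <= sin t ^+ 2.
  have t20 : 0 <= t / 2 by rewrite divr_ge0.
  by rewrite lerXn2r ?nnegrE// (le_trans t20 sint).
have h2t : h ^+ 2 <= t ^+ 2.
  rewrite lerXn2r ?nnegrE//; rewrite /t; have : 2 * h <= pi * h by rewrite ler_wpM2r.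
  lra.
have c2 := cos2Dsin2 t.
have e4 : (t / 2) ^+ 2 = t ^+ 2 / 4 by field.
rewrite e4 in s2; move: s2 h2t; rewrite [cos t ^+ 2 *+ 2]mulr2n.
by move: (h ^+ 2) (t ^+ 2) (cos t ^+ 2) (sin t ^+ 2) => *; lra.
Qed.

(** A limit [h -> 0] at each root would be useless here, since the asymptotics have a fixed error.
    With one step [h] for all roots, that error is below [h ^+ 2 / 8] from some point on, while the
    Taylor remainder is controlled uniformly. *)
Lemma far_root_concave : exists N1 : R, forall l s, N1 < `|l| -> s ^+ 2 = 4 -> f l = s ->
  d l 1%N = 0 -> s * d l 2 < 0.
Proof.
have [r r0 hr] := cos_quadratic.
have K1 : 0 < 4 * (K + 1) by have := K_ge0; lra.
(* The three bounds on [h] serve [taylor_bound], [cos_quadratic] and [K * h ^+ 3 <= h ^+ 2 / 4]. *)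
pose h : R := Num.min (Num.min 1 r) (4 * (K + 1))^-1.
have h0 : 0 < h by rewrite !lt_min ltr01 r0 invr_gt0.
have h1 : h <= 1 by rewrite !ge_min lexx.
have hr' : h <= r by rewrite !ge_min lexx !orbT.
have hK : K * h <= 1 / 4.
  have : h * (4 * (K + 1)) <= 1.
    by rewrite -ler_pdivlMr// mul1r ge_min lexx orbT.
  by have := K_ge0; lra.
have eps0 : 0 < h ^+ 2 / 8 by rewrite divr_gt0// exprn_gt0.
have [N hN] := asym eps0.
(* The extra 1 keeps [l + h] and [l - h] in the range of the asymptotics. *)
exists (N + 1) => l s lN s4 fl d1.
have far u : `|u| <= 1 -> `|f (l + u) - 2 * cos (pi * (l + u))| <= h ^+ 2 / 8.
  move=> u1; apply: hN; have := ler_normB (l + u) u; rewrite addrK.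
  lra.
have a0 := far 0; have ap := far h; have am := far (- h).
rewrite normr0 addr0 in a0; rewrite (gtr0_norm h0) in ap; rewrite normrN (gtr0_norm h0) in am.
have {}a0 := a0 ler01; have {}ap := ap h1; have {}am := am h1.
have nh : `|h| <= 1 by rewrite gtr0_norm.
have nmh : `|- h| <= 1 by rewrite normrN gtr0_norm.
have tp := taylor_bound l 3 nh; have tm := taylor_bound l 3 nmh.
rewrite !big_ord_recr !big_ord0 /= d1 -f_at fl !expr0 (gtr0_norm h0) in tp.
rewrite !big_ord_recr !big_ord0 /= d1 -f_at fl !expr0 normrN (gtr0_norm h0) in tm.
have cs : cos (pi * (l + h)) + cos (pi * (l - h)) = 2 * cos (pi * l) * cos (pi * h).
  by rewrite !mulrDr mulrN cosD cosB; ring.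
have q := hr h; rewrite (ltW h0) hr' in q; have {}q := q isT.
have h2 : 0 < h ^+ 2 by rewrite exprn_gt0.
have h3 : K * h ^+ 3 <= h ^+ 2 / 4.
  rewrite exprS mulrA; have := ler_wpM2r (ltW h2) hK.
  by rewrite mulrC mul1r [4^-1 * _]mulrC.
rewrite fl in a0.
have tpm : `|f (l + h) + f (l - h) - 2 * s - 2 * (d l 2 * h ^+ 2)| <= 2 * (K * h ^+ 3).
  have -> : f (l + h) + f (l - h) - 2 * s - 2 * (d l 2 * h ^+ 2) =
    (f (l + h) - (0 + s * 1 + 0 * h ^+ 1 + d l 2 * h ^+ 2)) +
    (f (l - h) - (0 + s * 1 + 0 * (- h) ^+ 1 + d l 2 * (- h) ^+ 2)) by rewrite sqrrN; ring.
  apply: le_trans (ler_normD _ _) _; apply: le_trans (lerD tp tm) _.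
  by rewrite le_eqVlt; apply/orP; left; apply/eqP; ring.
have := second_difference_sign h2 s4 h3 q (cos_geN1 _) cs a0 ap am tpm.
by rewrite mulrA pmulr_llt0.
Qed.

Let S := [set x : R | 2 < `|f x|].

Let notS x : `|f x| <= 1 -> ~ S x.
Proof. by move=> fx; rewrite /S /= => h; lra. Qed.

Let nonconstant s : s ^+ 2 = 4 -> exists y, f y <> s.
Proof.
have [N0 N00 hN0] := small_value; move=> s4.
have [|y _ fy] := hN0 (N0 + 1); first by left; lra.
exists y => fs; have s1 : `|s| <= 1 by rewrite -fs.
have : `|s| ^+ 2 <= 1 by rewrite exprn_ile1.
by rewrite -normrX s4 ger0_norm//; lra.
Qed.

Lemma component_interval (A : set R) x y z t : connected_component A x y ->
  connected_component A x z -> y <= t <= z -> connected_component A x t.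
Proof.
move=> hy hz ytz.
have /connected_intervalP h : connected (connected_component A x) by exact: component_connected.
exact: h hy hz t ytz.
Qed.

(** A point with [|f| <= 1] far to the left cannot be crossed by the component. This makes the [inf]
    of a gap a true infimum instead of a default value. *)
Lemma component_unbounded_below x : S x -> exists w, forall y,
  connected_component S x y -> w < y.
Proof.
move=> Sx; have [N0 N00 hN0] := small_value.
pose z := - `|x| - N0 - 2.
have [|w /andP[_ wz] fw] := hN0 z; first by right; rewrite /z; have := normr_ge0 x; lra.
exists w => y hy; rewrite ltNge; apply/negP => yw.
apply: (notS fw); apply: (@connected_component_sub _ _ x).
apply: (component_interval hy (connected_component_refl Sx)).
rewrite yw/=; apply: le_trans wz _; rewrite /z.
by have := ler_norm (- x); rewrite normrN; have := normr_ge0 x; lra.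
Qed.

(** Only left end points are studied, since they already determine the gap; see [inf_gap_inj]. *)
Lemma component_inf x (Co := connected_component S x) (a := inf Co) : S x ->
  [/\ `|f a| = 2, forall y, Co y -> a < y & forall y t, Co y -> a < t <= y -> Co t].
Proof.
move=> Sx; have [w hw] := component_unbounded_below Sx.
have Cx : Co x by exact: connected_component_refl.
have hinf : has_inf Co.
  by split; [exists x|exists w => y /hw /ltW].
have aC y : Co y -> a <= y by move=> Cy; apply: ge_inf => //; case: hinf.
have Ct y t : Co y -> a < t <= y -> Co t.
  move=> Cy /andP[at_ ty]; have at0 : 0 < t - a by rewrite subr_gt0.
  have [u Cu] := inf_adherent at0 hinf; rewrite -/a addrC subrK => ut.
  by apply: (component_interval Cu Cy); rewrite (ltW ut).
have near_a (e : R) : 0 < e -> exists2 r : R, 0 < r &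
    forall y, `|a - y| < r -> `|f y| <= `|f a| + e /\ `|f a| - e <= `|f y|.
  move=> e0; have /cvgrPdist_le/(_ _ e0)[r /= r0 hr] := @f_continuous a.
  exists r => // y /hr h; have h1 := ler_normB (f a) (f a - f y).
  have h2 := ler_normB (f y) (f y - f a).
  rewrite opprB addrC subrK in h1; rewrite opprB addrC subrK in h2.
  by rewrite distrC in h2; split; lra.
have close r : 0 < r -> exists2 u, Co u & a <= u < a + r.
  move=> r0; have [u Cu ur] := inf_adherent r0 hinf; exists u => //.
  by rewrite aC.
(* If [a] were in [S], continuity would put an interval reaching to the left of [a] into the same
   component. *)
have nSa : ~ S a.
  move=> Sa; have e0 : 0 < (`|f a| - 2) / 2 by rewrite divr_gt0// subr_gt0.
  have [r r0 hr] := near_a _ e0; have [u Cu /andP[au ur]] := close r r0.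
  have sub : `[a - r / 2, u]%classic `<=` S.
    move=> t /=; rewrite in_itv/= => /andP[t1 t2].
    have [|_ h] := hr t; first by rewrite ltr_norml; apply/andP; split; lra.
    by rewrite /S /=; move: Sa h; rewrite /S /=; lra.
  have uin : `[a - r / 2, u]%classic u by rewrite /= in_itv/= lexx andbT; lra.
  have conn : connected `[a - r / 2, u]%classic.
    by apply/connected_intervalP; exact: interval_is_interval.
  have := connected_component_max uin sub conn.
  rewrite -(same_connected_component Cu) => /(_ (a - r / 2)).
  have ain : `[a - r / 2, u]%classic (a - r / 2) by rewrite /= in_itv/= lexx; lra.
  by move=> /(_ ain)/aC; lra.
split => //.
- apply/eqP; rewrite eq_le; apply/andP; split.
    by rewrite leNgt; apply/negP.
  rewrite leNgt; apply/negP => fa2.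
  have e0 : 0 < (2 - `|f a|) / 2 by rewrite divr_gt0// subr_gt0.
  have [r r0 hr] := near_a _ e0; have [u Cu /andP[au ur]] := close r r0.
  have [|h _] := hr u; first by rewrite ltr_norml; apply/andP; split; lra.
  by have := connected_component_sub Cu; rewrite /S /=; lra.
- move=> y Cy; rewrite lt_neqAle aC// andbT; apply/eqP => ay.
  by apply: nSa; rewrite ay; exact: connected_component_sub Cy.
Qed.

Let gaps := [set connected_component S x | x in S].
Let P := [set inf A | A in gaps].
Let Z := [set x | f x ^+ 2 = 4].

Let P_sub_Z : P `<=` Z.
Proof.
move=> _ [_ [x Sx <-] <-]; have [fa _ _] := component_inf Sx.
by rewrite /Z /= -(real_normK (num_real _)) fa; ring.
Qed.

(** The smaller of a point of [A] and a point of [B] lies to the right of the common infimum, hence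
    in both components. *)
Lemma inf_gap_inj (A B : set R) : gaps A -> gaps B -> inf A = inf B -> A = B.
Proof.
move=> [x Sx <-] [y Sy <-] e.
have [_ h1 k1] := component_inf Sx; have [_ h2 k2] := component_inf Sy.
have Cx := connected_component_refl Sx; have Cy := connected_component_refl Sy.
pose m := Num.min x y.
have mx : connected_component S x m.
  by apply: (k1 x m Cx); rewrite ge_min lexx andbT /m lt_min (h1 _ Cx)/= e (h2 _ Cy).
have my : connected_component S y m.
  by apply: (k2 y m Cy); rewrite ge_min lexx orbT andbT /m lt_min (h2 _ Cy) andbT -e (h1 _ Cx).
by rewrite (same_connected_component mx) (same_connected_component my).
Qed.

Lemma finite_gaps : finite_set gaps <-> finite_set P.
Proof.
split => [|finP]; first exact: finite_image.
(* An inverse of [inf] on gaps without a choice: by injectivity the union has a single member. *)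
pose H a : set R := \bigcup_(A in [set A | gaps A /\ inf A = a]) A.
apply: (@sub_finite_set _ _ (H @` P)); last exact: finite_image.
move=> A gA; exists (inf A); first by exists A.
apply/seteqP; split => [x [B [gB eB] Bx]|x Ax]; last by exists A.
by rewrite (inf_gap_inj gA gB (esym eB)).
Qed.

Lemma Z_finite (A : set R) : A `<=` Z -> finite_set A <-> norm_bounded A.
Proof.
move=> AZ; split; first exact: finite_norm_bounded.
apply: norm_bounded_finite => l.
have [|e1 e10 h1] := @root_isolated 2 (@nonconstant 2 _) l; first by ring.
have [|e2 e20 h2] := @root_isolated (- 2) (@nonconstant (- 2) _) l; first by ring.
exists (Num.min e1 e2); first by rewrite lt_min e10.
move=> h /andP[h0]; rewrite lt_min => /andP[he1 he2] /AZ; rewrite /Z /= => fz.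
have : (f (l + h) - 2) * (f (l + h) + 2) == 0.
  by apply/eqP; rewrite -[RHS](subrr 4) -{1}fz; ring.
rewrite mulf_eq0 => /orP[/eqP|/eqP] e.
  by apply: (h1 h); rewrite ?h0//; lra.
by apply: (h2 h); rewrite ?h0//; lra.
Qed.

Let Z1 := [set x | f x ^+ 2 = 4 /\ d x 1%N <> 0].
Let Z2 := [set x | f x ^+ 2 = 4 /\ ~ (d x 1%N = 0 /\ d x 2%N <> 0)].

(** If [f' a = 0], then [f f'' < 0] at the far point [a] pulls [|f|] below 2 just to the right of
    [a], where the gap begins. *)
Lemma far_inf_simple : exists N, forall a, N < `|a| -> P a -> Z1 a.
Proof.
have [N1 hN1] := far_root_concave; exists N1 => a aN Pa.
have Za : f a ^+ 2 = 4 := P_sub_Z Pa; split => // d1.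
have sd2 := hN1 a (f a) aN Za erefl d1.
have d2 : d a 2 != 0 by apply: contraTneq sd2 => ->; rewrite mulr0 ltxx.
have [A [x Sx AE] Aa] := Pa.
have [_ ha ka] := component_inf Sx; rewrite AE Aa in ha ka.
have Cx : A x by rewrite -AE; exact: connected_component_refl.
have K1 : 0 < K + 1 by have := K_ge0; lra.
have d20 : 0 < `|d a 2| by rewrite normr_gt0.
have q0 : 0 < `|d a 2| + K + 1 by have := K_ge0; lra.
(* The first bound gives [h <= 1] and [|d a 2| * h ^+ 2 <= 1], which keeps [f a * f (a + h)]
   nonnegative; the second keeps [a + h] in the gap; the third makes the quadratic term dominate the
   cubic remainder. *)
pose h := Num.min (Num.min (1 / (`|d a 2| + K + 1)) (x - a)) (`|d a 2| / (K + 1)).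
have ax : a < x by exact: ha.
have h0 : 0 < h by rewrite !lt_min divr_gt0// subr_gt0 ax divr_gt0.
have hq : h * (`|d a 2| + K + 1) <= 1.
  by rewrite -ler_pdivlMr// !ge_min lexx.
have hx : h <= x - a by rewrite !ge_min lexx orbT.
have hK : h * (K + 1) <= `|d a 2|.
  by rewrite -ler_pdivlMr// ge_min lexx orbT.
have h1 : h <= 1.
  apply: le_trans hq; rewrite ler_peMr// ?ltW//; have := K_ge0; lra.
have Sh : S (a + h).
  apply: (@connected_component_sub _ _ x); rewrite AE; apply: (ka x) => //.
  by rewrite ltrDl h0; lra.
have hn : `|h| <= 1 by rewrite gtr0_norm.
have := @leading_term a (f a) 2 _ h hn.
rewrite /= mul0r subr0 (gtr0_norm h0) => T.
have {}T : `|f (a + h) - f a - d a 2 * h ^+ 2| <= K * h ^+ 3.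
  by apply: T => -[|[|//]] _ /=; rewrite ?mul0r ?subr0// mul1r -f_at subrr.
have h2 : 0 < h ^+ 2 by rewrite exprn_gt0.
have h21 : h ^+ 2 <= h by rewrite expr2 ler_piMr// ltW.
have T2 : K * h ^+ 3 < `|d a 2| * h ^+ 2.
  by rewrite exprS mulrA ltr_pM2r// mulrC; lra.
have T3 : `|d a 2| * h ^+ 2 <= 1.
  apply: (@le_trans _ _ (h * (`|d a 2| + K + 1))) => //; rewrite mulrC.
  by apply: ler_pM => //; [exact: ltW|have := K_ge0; lra].
(* [f (a + h) - f a] has the sign of [d a 2], so [|f (a + h)| < 2]. *)
have fa2 : `|f a| = 2.
  by have [fa _ _] := component_inf Sx; rewrite AE Aa in fa.
have e1 : f a * (d a 2 * h ^+ 2) = - (2 * (`|d a 2| * h ^+ 2)).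
  have := ltr0_norm sd2; rewrite normrM fa2 mulrA => e; rewrite -[f a * _]opprK -e.
  by ring.
have e2 : `|f a * (f (a + h) - f a - d a 2 * h ^+ 2)| <= 2 * (K * h ^+ 3).
  by rewrite normrM fa2 ler_wpM2l.
have e3 : f a * f (a + h) = 4 + f a * (d a 2 * h ^+ 2) +
    f a * (f (a + h) - f a - d a 2 * h ^+ 2) by rewrite -Za; ring.
have e4 : `|f a * f (a + h)| = 2 * `|f (a + h)| by rewrite normrM fa2.
move: Sh e2; rewrite /S /= ler_norml => Sh /andP[e5 e6].
have X0 : 0 <= f a * f (a + h) by rewrite e3 e1; lra.
rewrite ger0_norm// e3 e1 in e4; lra.
Qed.

(** On one side of a simple root [|f|] exceeds 2. The root may be the right end of that gap, so only
    a bounded distance to the left end is claimed. *)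
Lemma simple_near_inf : exists N, forall x, N < `|x| -> Z1 x ->
  exists2 a, P a & `|a - x| <= 3.
Proof.
have [N0 N00 hN0] := small_value; exists (N0 + 3) => x xN [Zx d1].
(* The point [w], between [x - 3] and [x - 2], lies in no gap and bounds the left end of the gap
   from below. *)
have [w /andP[w1 w2] fw] : exists2 w, x - 3 <= w <= x - 3 + 1 & `|f w| <= 1.
  apply: hN0; have [x0|x0] := leP 0 x.
    by left; rewrite ger0_norm// in xN; lra.
  by right; rewrite ltr0_norm// in xN; lra.
have K1 : 0 < K + 1 by have := K_ge0; lra.
have d10 : 0 < `|d x 1| by rewrite normr_gt0; exact/eqP.
pose h := Num.min 1 (`|d x 1| / (K + 1)).
have h0 : 0 < h by rewrite lt_min ltr01 divr_gt0.
have h1 : h <= 1 by rewrite ge_min lexx.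
have hK : h * (K + 1) <= `|d x 1| by rewrite -ler_pdivlMr// ge_min lexx orbT.
have fx2 : `|f x| = 2.
  apply/eqP; rewrite -(eqrXn2 (n := 2))// real_normK ?num_real// Zx; apply/eqP; ring.
(* The sign of [u] is that of [f x * f' x], so that [|f|] grows from [x] to [x + u]. *)
pose u := if 0 < f x * d x 1 then h else - h.
have un : `|u| = h by rewrite /u; case: ifP => _; rewrite ?normrN gtr0_norm.
have fdu : f x * (d x 1 * u) = 2 * (`|d x 1| * h).
  rewrite /u; case: ifPn => [fd|]; first by have := gtr0_norm fd; rewrite normrM fx2 => e; rewrite !mulrA e.
  rewrite -leNgt => fd; have := ler0_norm fd; rewrite normrM fx2 => e.
  by rewrite mulrN mulrN !mulrA e; ring.
have := @leading_term x (f x) 1 _ u; rewrite un => /(_ _ h1) /= T.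
have {}T : `|f (x + u) - f x - d x 1 * u| <= K * h ^+ 2.
  have := T; rewrite mul0r subr0 expr1; apply => -[|//] _ /=.
  by rewrite mul1r -f_at subrr.
have Sy : S (x + u).
  have T2 : K * h ^+ 2 < `|d x 1| * h by rewrite expr2 mulrA ltr_pM2r//; lra.
  have e2 : `|f x * (f (x + u) - f x - d x 1 * u)| <= 2 * (K * h ^+ 2).
    by rewrite normrM fx2 ler_wpM2l.
  have e3 : f x * f (x + u) = 4 + f x * (d x 1 * u) +
    f x * (f (x + u) - f x - d x 1 * u) by rewrite -Zx; ring.
  have e4 : `|f x * f (x + u)| = 2 * `|f (x + u)| by rewrite normrM fx2.
  have e5 := ler_norm (f x * f (x + u)); rewrite e4 e3 fdu in e5.
  move: e2; rewrite ler_norml /S /= => /andP[e6 e7]; lra.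
exists (inf (connected_component S (x + u))).
  by exists (connected_component S (x + u)) => //; exists (x + u).
have [_ ha ka] := component_inf Sy; set a := inf _ in ha ka *.
have Cy := connected_component_refl Sy; have ay := ha _ Cy.
have wa : w <= a.
  rewrite leNgt; apply/negP => aw; apply: (notS fw).
  apply: (@connected_component_sub _ _ (x + u)); apply: (ka (x + u)) => //.
  rewrite aw/=; move: un; have := ler_norm (- u); rewrite normrN; lra.
have : u <= h by rewrite -un ler_norm.
by rewrite ler_norml => uh; apply/andP; split; lra.
Qed.

Theorem finite_gaps_simple_roots :
  (finite_set gaps <-> finite_set Z1) /\ (finite_set gaps <-> finite_set Z2).
Proof.
have Z1Z : Z1 `<=` Z by move=> x [].
have Z2Z : Z2 `<=` Z by move=> x [].
have bP1 : norm_bounded P <-> norm_bounded Z1.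
  split=> [[M hM]|[M hM]].
    have [N hN] := simple_near_inf; exists (Num.max N (M + 3)) => x Zx.
    rewrite le_max; have [//|xN] := leP `|x| N; apply/orP; right.
    have [a Pa ax] := hN x xN Zx; have := hM a Pa.
    by have := ler_distD a x 0; rewrite !subr0 distrC; lra.
  have [N hN] := far_inf_simple; exists (Num.max N M) => a Pa.
  by rewrite le_max; have [//|aN] := leP `|a| N; rewrite hM ?orbT//; exact: hN.
(* Far roots with [f' = 0] have [f'' <> 0], hence are double: beyond some radius the two sets
   agree. *)
have b12 : norm_bounded Z1 <-> norm_bounded Z2.
  split=> [[M hM]|[M hM]].
    have [N hN] := far_root_concave; exists (Num.max N M) => a [Za d12].
    rewrite le_max; have [//|aN] := leP `|a| N; rewrite hM ?orbT//; split => // d1.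
    apply: d12; split => // d2; have := hN a (f a) aN Za erefl d1.
    by rewrite d2 mulr0 ltxx.
  by exists M => a [Za d1]; apply: hM; split => // -[].
rewrite finite_gaps (Z_finite P_sub_Z) (Z_finite Z1Z) (Z_finite Z2Z).
by split => //; rewrite bP1.
Qed.

End RealEntire.

(** * Floquet theory *)

Section L2Continuous.
Context {R : realType}.
Local Notation mu := (@lebesgue_measure R).

Lemma sqnorm2E (v : 'cV[R[i]]_2) : sqnorm v =
  complex.Re (v 0 0) ^+ 2 + complex.Im (v 0 0) ^+ 2 +
  (complex.Re (v 1 0) ^+ 2 + complex.Im (v 1 0) ^+ 2).
Proof. exact: sum2. Qed.

Lemma sqnorm_ge0 (v : 'cV[R[i]]_2) : 0 <= sqnorm v.
Proof. by rewrite sqnorm2E !addr_ge0 ?sqr_ge0. Qed.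

Lemma mac_measurable D (y y' : R -> 'cV[R[i]]_2) a b k : a <= b -> `[a, b] `<=` D ->
  mac D y y' -> measurable_complex `[a, b] (fun x => y x k 0).
Proof.
move=> ab abD hy; have /ac_derivativeP[h1 h2] := hy k 0.
by split; [exact: ac_measurable_itv (ac_sub abD h1)|exact: ac_measurable_itv (ac_sub abD h2)].
Qed.

Lemma sqnorm_ac (y y' : R -> 'cV[R[i]]_2) : mac setT y y' ->
  exists g, ac setT (fun x => sqnorm (y x)) g.
Proof.
move=> hy; have /ac_derivativeP[a b] := hy 0 0; have /ac_derivativeP[c d] := hy 1 0.
have := acD (acD (acM a a) (acM b b)) (acD (acM c c) (acM d d)).
set g := (X in ac _ _ X); exists g; apply: ac_eq H => // x _.
by rewrite sqnorm2E !expr2.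
Qed.

Lemma sqnorm_locint (y y' : R -> 'cV[R[i]]_2) : mac setT y y' ->
  locint setT (fun x => sqnorm (y x)).
Proof.
by move=> /sqnorm_ac[g hg]; exact: continuous_locint (ac_continuous hg).
Qed.

Lemma mac_inL2_itv (y y' : R -> 'cV[R[i]]_2) a b : a <= b -> mac setT y y' ->
  inL2 `[a, b] y.
Proof.
move=> ab hy; split; first by move=> k; exact: mac_measurable (@subsetT _ _) hy.
have /integrableP[_] := sqnorm_locint hy ab (@subsetT _ _).
congr (_ < _)%E; apply: eq_integral => x _ /=.
by rewrite ger0_norm// sqnorm_ge0.
Qed.

End L2Continuous.

Section Floquet.
Context {R : realType}.
Local Notation mu := (@lebesgue_measure R).
Variables (q2 q3 : R -> R[i]).
Hypotheses (lq2 : clocint setT q2) (lq3 : clocint setT q3).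
Hypothesis q2_per : forall x : R, q2 (x + pi) = q2 x.
Hypothesis q3_per : forall x : R, q3 (x + pi) = q3 x.
Local Notation Q := (offdiag q2 q3).
Local Notation A := (dirac_A q2 q3).
Local Notation E := (fundamental_matrix Q).

Lemma dirac_A_per l x : A l (x + pi) = A l x.
Proof. by rewrite /dirac_A /offdiag q2_per q3_per. Qed.

Lemma fundamental_per l x : E l (x + pi) = E l x *m E l pi.
Proof.
have [hE E0] := fundamental_matrixP lq2 lq3 l.
have hZ : mac setT (fun x => E l (x + pi)) (fun x => A l x *m E l (x + pi)).
  by apply: mac_eq (mac_shift pi hE) => // t _; rewrite dirac_A_per.
by rewrite (trace_free_repT (tr_dirac_A q2 q3 l) x hE E0 hZ) add0r.
Qed.

Lemma det_fundamental l x : \det (E l x) = 1.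
Proof.
have [hE E0] := fundamental_matrixP lq2 lq3 l.
have dE := trace_free_det (tr_dirac_A q2 q3 l) hE E0; exact: dE.
Qed.

Lemma fundamental_adj2 l x : E l x *m adj2 (E l x) = 1%:M.
Proof. by rewrite mul_adj2 det_fundamental. Qed.

Lemma fundamental_adj2l l x : adj2 (E l x) *m E l x = 1%:M.
Proof. by rewrite adj2_mull det_fundamental. Qed.

Lemma char_poly22 (M : 'M[R[i]]_2) s : \det M = 1 ->
  \det (M - s%:M) = s ^+ 2 - s * \tr M + 1.
Proof.
by rewrite !det22E tr22E !mxE /= !mulr1n !mulr0n => <-; ring.
Qed.

Lemma eigenvector_exists (M : 'M[R[i]]_2) s : \det (M - s%:M) = 0 ->
  exists2 v : 'cV[R[i]]_2, v != 0 & M *m v = s *: v.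
Proof.
rewrite -det_tr => /eqP/det0P[w w0 wM]; exists w^T.
  by apply: contra_neq w0 => wT; rewrite -[w]trmxK wT trmx0.
apply: trmx_inj; rewrite trmx_mul trmxK linearZ/= trmxK.
by move/eqP: wM; rewrite linearB/= tr_scalar_mx mulmxBr mul_mx_scalar subr_eq0 => /eqP.
Qed.

Lemma eigenvector_det (M : 'M[R[i]]_2) s (v : 'cV[R[i]]_2) : v != 0 -> M *m v = s *: v ->
  \det (M - s%:M) = 0.
Proof.
move=> v0 Mv; apply/eqP; rewrite -det_tr; apply/det0P; exists v^T.
  by apply: contra_neq v0 => vT; rewrite -[v]trmxK vT trmx0.
by rewrite -trmx_mul mulmxBl Mv mul_scalar_mx subrr trmx0.
Qed.

Lemma mac_fundamental_col l n (v : 'M[R[i]]_(2, n)) :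
  mac setT (fun x => E l x *m v) (fun x => A l x *m (E l x *m v)).
Proof.
have [hE _] := fundamental_matrixP lq2 lq3 l.
by apply: mac_eq (macMr v hE) => // x _; rewrite mulmxA.
Qed.

Lemma fundamental_col_neq0 l (v : 'cV[R[i]]_2) x : v != 0 -> E l x *m v != 0.
Proof.
apply: contra_neq => Ev; rewrite -[v]mul1mx -(fundamental_adj2l l x) -mulmxA Ev.
exact: mulmx0.
Qed.

Lemma not_ae_zero D (y : R -> 'cV[R[i]]_2) a b : a < b -> `[a, b] `<=` D ->
  (forall x, y x != 0) -> ~ ae_eq_on D y (fun=> 0).
Proof.
move=> ab abD y0 [N [mN N0 hN]].
have sub : `[a, b]%classic `<=` N.
  move=> x xab; apply: hN => /= h; have := y0 x; rewrite h ?eqxx//.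
  exact: abD.
have : (mu `[a, b]%classic <= mu N)%E by apply: le_measure; rewrite ?inE.
rewrite N0 (@lebesgue_measure_itv _ `[a, b]) /= lte_fin ab -EFinD lee_fin.
by lra.
Qed.

(** For [s ^+ 2 = 1] the characteristic polynomial at [s] is [2 - s * tr], so it vanishes exactly
    when the trace is [2 * s]. The periodic and antiperiodic problems are [s = 1] and [s = -1]. *)
Lemma eigenvalue_LtP t (l s : R[i]) : cos (pi * t) +i* sin (pi * t) = s -> s ^+ 2 = 1 ->
  eigenvalue_Lt Q t l <-> hill_F Q l = 2 * s.
Proof.
move=> ts s2; have pi0 : 0 <= pi :> R := pi_ge0 R.
have [hE E0] := fundamental_matrixP lq2 lq3 l.
have key : \det (E l pi - s%:M) = 0 <-> hill_F Q l = 2 * s.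
  rewrite char_poly22 ?det_fundamental// s2 /hill_F; split=> h.
    have e : s * \tr (E l pi) = 2 by move/eqP: h; rewrite addrAC subr_eq0 => /eqP <-; ring.
    by rewrite -e mulrAC -expr2 s2 mul1r.
  by rewrite h mulrCA -expr2 s2; ring.
rewrite -key; split.
  move=> [y [ny [_ _ /(dirac_expr0P lq2 lq3) hy]]]; rewrite ts => ypi.
  have yE x : 0 <= x <= pi -> y x = E l x *m y 0.
    move=> x0pi; apply: (trace_free_rep (tr_dirac_A q2 q3 l) hE E0 _ x0pi hy).
    by rewrite lexx.
  apply: (@eigenvector_det _ _ (y 0)); last by rewrite -yE ?pi0 ?lexx.
  apply/eqP => y0; apply: ny; apply: aeW => x; rewrite /= in_itv/= => x0pi.
  by rewrite yE// y0 mulmx0.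
move=> /eigenvector_exists[v v0 Mv].
have hy := mac_fundamental_col l v.
exists (fun x => E l x *m v); split.
  apply: (@not_ae_zero _ _ 0 pi (pi_gt0 R)) => // x.
  exact: fundamental_col_neq0.
split.
- exact: mac_inL2_itv pi0 hy.
- have hly : mac setT (fun x => l *: (E l x *m v)) _ := macZ (@cac_cst _ _ l) hy.
  exact: mac_inL2_itv pi0 hly.
- by apply/(dirac_expr0P lq2 lq3); exact: mac_sub (@subsetT _ _) hy.
- by rewrite ts Mv E0 mul1mx.
Qed.

Hypothesis q2_PT : forall x : R, q2 (- x) = conjc (q2 x).
Hypothesis q3_PT : forall x : R, q3 (- x) = conjc (q3 x).

Lemma dirac_A_PT (l x : R) : map_mx conjc (- A l%:C (- x)) = A l%:C x.
Proof.
have [a b c d] := dirac_AE q2 q3 l%:C x; have [a' b' c' d'] := dirac_AE q2 q3 l%:C (- x).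
have e (M : 'M[R[i]]_2) i j : map_mx conjc (- M) i j = conjc (- M i j) by rewrite !mxE.
apply: matrix22P; rewrite e ?a ?b ?c ?d ?a' ?b' ?c' ?d' ?q2_PT ?q3_PT.
- by apply: complex_ext; rewrite /=; ring.
- by case: (q2 x) => u v; apply: complex_ext; rewrite /=; ring.
- by case: (q3 x) => u v; apply: complex_ext; rewrite /=; ring.
- by apply: complex_ext; rewrite /=; ring.
Qed.

(** By [dirac_A_PT] the reflected conjugate solves the same equation with the same initial value. *)
Lemma fundamental_PT (l x : R) : E l%:C x = map_mx conjc (E l%:C (- x)).
Proof.
have [hE E0] := fundamental_matrixP lq2 lq3 l%:C.
have hZ : mac setT (fun x => map_mx conjc (E l%:C (- x)))
    (fun x => A l%:C x *m map_mx conjc (E l%:C (- x))).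
  apply: mac_eq (mac_conj (mac_opp hE)) => // t _.
  rewrite -[in RHS]dirac_A_PT -map_mxM; congr map_mx.
  by rewrite mulNmx.
rewrite [RHS](trace_free_repT (tr_dirac_A q2 q3 l%:C) x hE E0 hZ) oppr0 E0.
by rewrite map_mx1 mulmx1.
Qed.

(** Periodicity makes [E (- pi)] the inverse of [E pi], that is its adjugate, which has the same
    trace; by [fundamental_PT] its trace is also the conjugate one. *)
Theorem hill_F_real (l : R) : complex.Im (hill_F Q l%:C) = 0.
Proof.
have [hE E0] := fundamental_matrixP lq2 lq3 l%:C.
have e1 : E l%:C (- pi) = adj2 (E l%:C pi).
  have := fundamental_per l%:C (- pi); rewrite addNr E0 => e.
  by rewrite -[LHS]mulmx1 -(fundamental_adj2 l%:C pi) mulmxA -e mul1mx.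
have e2 : hill_F Q l%:C = conjc (hill_F Q l%:C).
  have e (N : 'M[R[i]]_2) i j : map_mx conjc N i j = conjc (N i j) by rewrite mxE.
  have [a b c d] := adj2E (E l%:C pi).
  rewrite {1}/hill_F fundamental_PT e1 tr22E !e a d.
  by rewrite /hill_F tr22E (rmorphD (@conjc R)) addrC.
by move: e2; case: (hill_F Q l%:C) => u v [] /=; lra.
Qed.

End Floquet.

(** * The resolvent on the line *)

Section ScalarEquation.
Context {R : realType}.
Local Notation mu := (@lebesgue_measure R).
Implicit Types (f g h w : R -> R) (x a b N : R).

Lemma primitiveB g a b : locint setT g -> a <= b ->
  primitive g b - primitive g a = \int[mu]_(x in `[a, b]) g x.
Proof. by move=> hg ab; have [_] := ac_primitive hg ab (@subsetT _ _). Qed.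

Lemma periodic_bounded g : (forall x, g (x + pi) = g x) -> continuous g ->
  exists B, forall x, g x <= B.
Proof.
move=> per cg; have pi0 : 0 < pi :> R := pi_gt0 R.
have [c _ hc] := EVT_max (ltW pi0) (continuous_subspaceT cg).
exists (g c) => x.
have pern (n : nat) y : g (y + n%:R * pi) = g y.
  by elim: n => [|n IH]; rewrite ?mul0r ?addr0// -natr1 mulrDl mul1r addrA per.
have perz (z : int) y : g (y + z%:~R * pi) = g y.
  case: z => n; first exact: pern.
  by rewrite NegzE mulrNz -[LHS](pern n.+1) mulNr subrK.
have fx := floor_itv (x / pi).
rewrite -(perz (- Num.floor (x / pi)) x); apply: hc.
move: fx => /andP[]; rewrite ler_pdivlMr// ltr_pdivrMr// mulrNz mulNr intrD mulrDl mul1r in_itv /=.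
by move=> f1 f2; apply/andP; split; lra.
Qed.

Lemma ac_expR (c : R) : ac setT (fun x => expR (c * x)) (fun x => c * expR (c * x)).
Proof.
apply: ac_derive => [x|x]; first exact: (@is_derive_scale _ (@expR R) (@expR R)).
by apply: cvgM; [exact: cvg_cst|apply: continuous_scale; exact: continuous_expR].
Qed.

Section Energy.
Variables (k : R) (h : R -> R) (N : R).
Hypotheses (k0 : 0 < k) (lh : locint setT h) (lh2 : locint setT (fun x => h x ^+ 2)).
Hypothesis hN : forall a b, a <= b -> \int[mu]_(x in `[a, b]) h x ^+ 2 <= N.

(** The derivative of [w ^+ 2] is [- 2 k w^2 + 2 w h], at most [- k w^2 + h^2 / k]: the difference
    is the square [k (w - h / k)^2]. *)
Lemma energy_le w a b : ac setT w (fun x => - k * w x + h x) -> a <= b ->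
  w b ^+ 2 + k * \int[mu]_(x in `[a, b]) w x ^+ 2 <= w a ^+ 2 + k^-1 * N.
Proof.
move=> hw ab; have lw : locint setT _ := ac_sqr_locint hw.
have h1 := acD (acZ (- k) (ac_primitive lw)) (acZ k^-1 (ac_primitive lh2)).
have h2 := ac_le ab (@subsetT _ _) (acM hw hw) h1.
have : w b * w b - w a * w a <=
    (- k * primitive (fun x => w x ^+ 2) b + k^-1 * primitive (fun x => h x ^+ 2) b) -
    (- k * primitive (fun x => w x ^+ 2) a + k^-1 * primitive (fun x => h x ^+ 2) a).
  apply: h2 => x _; rewrite -subr_ge0.
  have -> : - k * w x ^+ 2 + k^-1 * h x ^+ 2 -
      ((- k * w x + h x) * w x + w x * (- k * w x + h x)) = k * (w x - h x / k) ^+ 2.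
    by field; rewrite gt_eqF.
  by rewrite mulr_ge0 ?sqr_ge0// ltW.
have <- := primitiveB lw ab.
have : k^-1 * (primitive (fun x => h x ^+ 2) b - primitive (fun x => h x ^+ 2) a) <= k^-1 * N.
  by rewrite ler_pM2l ?invr_gt0// (primitiveB lh2 ab) hN.
rewrite !expr2; lra.
Qed.

Let N0 : 0 <= N.
Proof. by apply: le_trans (hN (lexx 0)); apply: Rintegral_ge0 => x _; exact: sqr_ge0. Qed.

(* [inf (c_ n + r n)] is the limit of the constants [c_ n] of the solutions that
   vanish at [- n], since [|c_ m - c_ n| <= r n] for [n <= m]. *)
Lemma bounded_solution : exists2 w, ac setT w (fun x => - k * w x + h x) &
  forall a b, a <= b -> \int[mu]_(x in `[a, b]) w x ^+ 2 <= 2 * N / k ^+ 2.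
Proof.
have lp : locint setT (fun x => expR (k * x) * h x) := locint_acM (ac_expR k) lh.
pose p := primitive (fun x => expR (k * x) * h x).
have hp : ac setT p _ := ac_primitive lp.
pose sol c x := expR (- k * x) * (c + p x).
have hsol c : ac setT (sol c) (fun x => - k * sol c x + h x).
  have h1 := acM (ac_expR (- k)) (acD (@ac_cst _ setT c) hp).
  apply: ac_eq (h1) => // x _.
  have e : expR (- k * x) * expR (k * x) = 1 by rewrite -expRD mulNr addNr expR0.
  by rewrite /sol add0r (mulrA _ (expR (k * x))) e mul1r mulrA.
(* By the energy estimate, a solution is bounded by [B] to the right of any of its zeros. *)
pose B := Num.sqrt (N / k); have B0 : 0 <= B := sqrtr_ge0 _.
have B2 : B ^+ 2 = N / k by rewrite sqr_sqrtr// divr_ge0// ltW.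
pose c_ (n : nat) := - p (- n%:R); pose r (n : nat) := expR (- k * n%:R) * B.
have r0 n : 0 <= r n by rewrite mulr_ge0// expR_ge0.
have close m n : (n <= m)%N -> `|c_ m - c_ n| <= r n.
  move=> nm; have nm' : - m%:R <= - n%:R :> R by rewrite lerN2 ler_nat.
  have := energy_le (hsol (c_ m)) nm'.
  have -> : sol (c_ m) (- m%:R) = 0 by rewrite /sol /c_ addNr mulr0.
  have -> : sol (c_ m) (- n%:R) = expR (k * n%:R) * (c_ m - c_ n).
    by rewrite /sol /c_ opprK mulrNN.
  have i0 : 0 <= \int[mu]_(x in `[(- m%:R), (- n%:R)]) sol (c_ m) x ^+ 2.
    by apply: Rintegral_ge0 => x _; exact: sqr_ge0.
  have := mulr_ge0 (ltW k0) i0; set I := _ * \int[mu]_(x in _) _ => I0.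
  rewrite expr0n/= add0r (mulrC k^-1) -B2 => hB.
  have : `|expR (k * n%:R) * (c_ m - c_ n)| <= B.
    by rewrite -ler_sqr ?nnegrE// real_normK ?num_real//; lra.
  rewrite normrM ger0_norm ?expR_ge0// /r mulNr expRN mulrC ler_pdivlMl ?expR_gt0//.
  by rewrite mulrC.
have le_all m n : c_ m - r m <= c_ n + r n.
  have := r0 m; have := r0 n.
  case: (leqP n m) => [nm|/ltnW mn]; [have := close _ _ nm|have := close _ _ mn];
    rewrite ler_norml => /andP[]; lra.
pose c := inf (range (fun n => c_ n + r n)).
have hc n : `|c - c_ n| <= r n.
  have lb m : lbound (range (fun n => c_ n + r n)) (c_ m - r m) by move=> _ [j _ <-].
  rewrite ler_distl; apply/andP; split.
    by apply: lb_le_inf => //; exists (c_ 0%N + r 0%N), 0%N.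
  by apply: ge_inf; [exists (c_ 0%N - r 0%N)|exists n].
exists (sol c) => // a b ab.
have [n hn] : exists n : nat, - n%:R <= a.
  exists (Num.trunc `|a|).+1; have := truncnS_gt `|a|.
  by have := ler_norm (- a); rewrite normrN; lra.
have na : - n%:R <= b by apply: le_trans ab.
have e := energy_le (hsol c) na.
have ws : sol c (- n%:R) ^+ 2 <= N / k.
  rewrite -B2 -[X in X <= _]real_normK ?num_real// ler_sqr ?nnegrE//.
  have -> : sol c (- n%:R) = expR (k * n%:R) * (c - c_ n).
    by rewrite /sol /c_ opprK mulrNN.
  rewrite normrM ger0_norm ?expR_ge0// mulrC -ler_pdivlMr ?expR_gt0//.
  by have := hc n; rewrite /r mulNr expRN mulrC.
have sub : \int[mu]_(x in `[a, b]) sol c x ^+ 2 <= \int[mu]_(x in `[(- n%:R), b]) sol c x ^+ 2.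
  rewrite -!(primitiveB (ac_sqr_locint (hsol c)))//.
  have : 0 <= \int[mu]_(x in `[(- n%:R), a]) sol c x ^+ 2.
    by apply: Rintegral_ge0 => x _; exact: sqr_ge0.
  by rewrite -(primitiveB (ac_sqr_locint (hsol c)))//; lra.
apply: le_trans sub _.
have := sqr_ge0 (sol c b); rewrite mulrC in e => w0.
have : k * \int[mu]_(x in `[(- n%:R), b]) sol c x ^+ 2 <= 2 * (N / k).
  by move: e ws w0; rewrite mulrC (mulrC k^-1); lra.
rewrite -ler_pdivlMl// => /le_trans; apply; rewrite le_eqVlt; apply/orP; left; apply/eqP.
by field; rewrite gt_eqF.
Qed.

End Energy.

(** Negative [k] reduces to positive [k] by the reflection [x -> - x]. *)
Lemma bounded_solution_neq0 k h N : k != 0 -> locint setT h ->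
  locint setT (fun x => h x ^+ 2) ->
  (forall a b, a <= b -> \int[mu]_(x in `[a, b]) h x ^+ 2 <= N) ->
  exists2 w, ac setT w (fun x => - k * w x + h x) &
  forall a b, a <= b -> \int[mu]_(x in `[a, b]) w x ^+ 2 <= 2 * N / k ^+ 2.
Proof.
move=> k0 lh lh2 hN; case: (ltgtP k 0) k0 => // [kneg _|kpos _]; last exact: bounded_solution.
have kp : 0 < - k by lra.
have lo g : locint setT g -> locint setT (fun x => g (- x)).
  move=> lg a b ab _; have := lg (- b) (- a); rewrite lerN2 => /(_ ab (@subsetT _ _)) i.
  by have [] := integral_opp i; rewrite !opprK.
have lh' := locintZ (-1) (lo _ lh).
have e1 x : (-1 * h (- x)) ^+ 2 = h (- x) ^+ 2 by rewrite mulN1r sqrrN.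
have lh2' : locint setT (fun x => (-1 * h (- x)) ^+ 2).
  by under eq_fun do rewrite e1; exact: lo lh2.
have hN' a b : a <= b -> \int[mu]_(x in `[a, b]) (-1 * h (- x)) ^+ 2 <= N.
  move=> ab; under eq_Rintegral do rewrite e1.
  have ba : - b <= - a by rewrite lerN2.
  by have [_] := integral_opp (lh2 _ _ ba (@subsetT _ _)); rewrite !opprK => ->; exact: hN.
have [w hw wN] := bounded_solution kp lh' lh2' hN'.
exists (fun x => w (- x)).
  by apply: ac_eq (ac_opp hw) => // x _; rewrite (opprK x); ring.
move=> a b ab; have ba : - b <= - a by rewrite lerN2.
rewrite -(sqrrN k); apply: le_trans (wN _ _ ba).
by have [_] := integral_opp (ac_sqr_locint hw ba (@subsetT _ _)); rewrite !opprK => ->.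
Qed.

End ScalarEquation.

(** * Square integrability of vector functions *)

Section L2Line.
Context {R : realType}.
Local Notation mu := (@lebesgue_measure R).
Implicit Types (y z f : R -> 'cV[R[i]]_2) (a b N : R) (u v : 'cV[R[i]]_2).

Lemma sqnormN v : sqnorm (- v) = sqnorm v.
Proof.
have e k : (- v) k 0 = - v k 0 by rewrite mxE.
by rewrite !sqnorm2E !e !cReN !cImN !sqrrN.
Qed.

Lemma sqrD_le2 (p q : R) : (p + q) ^+ 2 <= 2 * (p ^+ 2 + q ^+ 2).
Proof. by have := sqr_ge0 (p - q); nra. Qed.

Lemma sqnormD u v : sqnorm (u + v) <= 2 * (sqnorm u + sqnorm v).
Proof.
have e k : (u + v) k 0 = u k 0 + v k 0 by rewrite mxE.
rewrite !sqnorm2E !e !cReD !cImD.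
have := sqrD_le2 (complex.Re (u 0 0)) (complex.Re (v 0 0)).
have := sqrD_le2 (complex.Im (u 0 0)) (complex.Im (v 0 0)).
have := sqrD_le2 (complex.Re (u 1 0)) (complex.Re (v 1 0)).
have := sqrD_le2 (complex.Im (u 1 0)) (complex.Im (v 1 0)).
by lra.
Qed.

Lemma sqnorm_scale (c : R[i]) v :
  sqnorm (c *: v) = (complex.Re c ^+ 2 + complex.Im c ^+ 2) * sqnorm v.
Proof.
have e k : (c *: v) k 0 = c * v k 0 by rewrite mxE.
by rewrite !sqnorm2E !e !cReM !cImM; ring.
Qed.

Lemma mnorm2E v : mnorm v = cn (v 0 0) + cn (v 1 0).
Proof. by rewrite /mnorm sum2 !big_ord1. Qed.

Lemma sqnorm_le_mnorm v : sqnorm v <= mnorm v ^+ 2.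
Proof.
have s (p q : R) : p ^+ 2 + q ^+ 2 <= (`|p| + `|q|) ^+ 2.
  rewrite sqrrD !real_normK ?num_real// -addrA lerD2l lerDr.
  by rewrite mulrn_wge0// mulr_ge0.
rewrite sqnorm2E mnorm2E.
have s1 := s (complex.Re (v 0 0)) (complex.Im (v 0 0)).
have s2 := s (complex.Re (v 1 0)) (complex.Im (v 1 0)).
apply: le_trans (lerD s1 s2) _; rewrite -/(cn _) -/(cn _).
by have := mulr_ge0 (cn_ge0 (v 0 0)) (cn_ge0 (v 1 0)); nra.
Qed.

Lemma mnorm_le_sqnorm v : mnorm v ^+ 2 <= 4 * sqnorm v.
Proof.
rewrite sqnorm2E mnorm2E.
have := sqrD_le2 (cn (v 0 0)) (cn (v 1 0)).
have := sqrD_le2 `|complex.Re (v 0 0)| `|complex.Im (v 0 0)|.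
have := sqrD_le2 `|complex.Re (v 1 0)| `|complex.Im (v 1 0)|.
rewrite !real_normK ?num_real// -/(cn _) -/(cn _).
by lra.
Qed.

Lemma sqnorm_mul (M : 'M[R[i]]_2) v B : mnorm M <= B ->
  sqnorm (M *m v) <= 4 * B ^+ 2 * sqnorm v.
Proof.
move=> MB; have M0 := mnorm_ge0 M; have v0 := mnorm_ge0 v.
apply: le_trans (sqnorm_le_mnorm _) _.
apply: (@le_trans _ _ (B ^+ 2 * mnorm v ^+ 2)); last first.
  rewrite (mulrC 4) -(mulrA _ 4); apply: ler_wpM2l; first exact: sqr_ge0.
  exact: mnorm_le_sqnorm.
rewrite -exprMn; apply: lerXn2r; rewrite ?nnegrE ?mnorm_ge0// ?mulr_ge0//.
  exact: le_trans MB.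
apply: le_trans (mnormM _ _) _; exact: ler_wpM2r.
Qed.

Lemma sqnorm_eq0 v : sqnorm v <= 0 -> v = 0.
Proof.
rewrite sqnorm2E => h.
have [a b c d] : [/\ complex.Re (v 0 0) = 0, complex.Im (v 0 0) = 0,
    complex.Re (v 1 0) = 0 & complex.Im (v 1 0) = 0].
  have := sqr_ge0 (complex.Re (v 0 0)); have := sqr_ge0 (complex.Im (v 0 0)).
  have := sqr_ge0 (complex.Re (v 1 0)); have := sqr_ge0 (complex.Im (v 1 0)) => *.
  by split; apply/eqP; rewrite -sqrf_eq0; apply/eqP; lra.
apply/matrixP => i j; rewrite (ord1 j) [RHS]mxE.
by move: i; apply: ord2P; apply: complex_ext.
Qed.

Lemma measurable_sqnorm D y : (forall k, measurable_complex D (fun x => y x k 0)) ->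
  measurable_fun D (fun x => sqnorm (y x)).
Proof.
move=> my; under eq_fun do rewrite sqnorm2E.
have [a b] := my 0; have [c d] := my 1.
by do 2? apply: measurable_funD; apply: measurable_funX.
Qed.

Lemma sqnormL2_ge0 D y : (0 <= sqnormL2 D y)%E.
Proof. by apply: integral_ge0 => x _; rewrite lee_fin sqnorm_ge0. Qed.

Lemma inL2T_locint y : inL2 setT y -> locint setT (fun x => sqnorm (y x)).
Proof.
move=> [my fy] a b ab _; apply/integrableP; split.
  apply/measurable_EFinP; apply: measurable_funS (measurable_sqnorm my) => //.
rewrite (_ : (fun x => `|_|)%E = (fun x => (sqnorm (y x))%:E)); last first.
  by apply/funext => x /=; rewrite ger0_norm ?sqnorm_ge0.
apply: le_lt_trans fy; apply: ge0_subset_integral => //.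
  by apply/measurable_EFinP; exact: measurable_sqnorm.
by move=> x _; rewrite lee_fin sqnorm_ge0.
Qed.

Lemma sqnormL2_fine D y : inL2 D y -> sqnormL2 D y = (fine (sqnormL2 D y))%:E.
Proof.
move=> [_ fy]; rewrite fineK//; apply/fin_real; rewrite fy andbT.
by apply: lt_le_trans (sqnormL2_ge0 _ _); rewrite ltNyr.
Qed.

Lemma sqnormL2_itv y a b : locint setT (fun x => sqnorm (y x)) -> a <= b ->
  sqnormL2 `[a, b] y = (\int[mu]_(x in `[a, b]) sqnorm (y x))%:E.
Proof.
move=> ly ab; rewrite /sqnormL2 /Rintegral fineK//.
exact: integrable_fin_num (ly _ _ ab (@subsetT _ _)).
Qed.

Lemma sqnormL2_bound y N : inL2 setT y -> (sqnormL2 setT y <= N%:E)%E ->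
  forall a b, a <= b -> \int[mu]_(x in `[a, b]) sqnorm (y x) <= N.
Proof.
move=> hy yN a b ab; rewrite -lee_fin -sqnormL2_itv//; last exact: inL2T_locint.
apply: le_trans yN; apply: ge0_subset_integral => //.
  by apply/measurable_EFinP; apply: measurable_sqnorm; case: hy.
by move=> x _; rewrite lee_fin sqnorm_ge0.
Qed.

(** Monotone convergence along the intervals [[- n, n]]; it turns bounds on compact intervals into
    membership in [L_2]. *)
Lemma sqnormL2_line_le y N : (forall k, measurable_complex setT (fun x => y x k 0)) ->
  locint setT (fun x => sqnorm (y x)) ->
  (forall a b, a <= b -> \int[mu]_(x in `[a, b]) sqnorm (y x) <= N) ->
  (sqnormL2 setT y <= N%:E)%E.
Proof.
move=> my ly yN.
pose I (n : nat) : set R := `[- n%:R, n%:R]%classic.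
have nd : {homo I : n m / (n <= m)%N >-> (n <= m)%O}.
  by move=> n m nm; apply/subsetPset; apply: itvcc_sub; rewrite ?lerN2 ler_nat.
have -> : sqnormL2 setT y = (\int[mu]_(x in \bigcup_n I n) (sqnorm (y x))%:E)%E.
  congr (integral mu _ _); apply/seteqP; split=> // x _.
  exists (Num.trunc `|x|).+1 => //=; rewrite /I /= in_itv /= -ler_norml.
  by apply: ltW; exact: truncnS_gt.
have h : ((fun n : nat => \int[mu]_(x in I n) (sqnorm (y x))%:E) @ \oo -->
    \int[mu]_(x in \bigcup_n I n) (sqnorm (y x))%:E)%E.
  apply: (ge0_nondecreasing_set_cvg_integral (mu := mu) nd) => [n|n|n x _]; first exact: measurable_itv.
    by apply/measurable_EFinP; apply: measurable_funS (measurable_sqnorm my).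
  by rewrite lee_fin sqnorm_ge0.
rewrite -(cvg_lim _ h)//; apply: lime_le; first by apply/cvg_ex; eexists; exact: h.
near=> n; rewrite -/(sqnormL2 _ _).
have n0 : - n%:R <= n%:R :> R by rewrite -subr_ge0 opprK addr_ge0.
by rewrite sqnormL2_itv// lee_fin yN.
Unshelve. all: by end_near. Qed.

Lemma mac_measurableT y y' : mac setT y y' ->
  forall k, measurable_complex setT (fun x => y x k 0).
Proof.
move=> hy k; have [c1 c2] := cac_continuous (hy k 0).
by split; apply: continuous_measurable_fun.
Qed.

Lemma inL2_mac y y' N : mac setT y y' ->
  (forall a b, a <= b -> \int[mu]_(x in `[a, b]) sqnorm (y x) <= N) ->
  inL2 setT y /\ (sqnormL2 setT y <= N%:E)%E.
Proof.
move=> hy yN.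
have my := mac_measurableT hy.
have h := sqnormL2_line_le my (sqnorm_locint hy) yN.
by split=> //; split=> //; apply: le_lt_trans h _; rewrite ltry.
Qed.

Lemma inL2_le (D : set R) y z (C : R) : measurable D -> inL2 D y ->
  (forall k, measurable_complex D (fun x => z x k 0)) -> 0 <= C ->
  (forall x, sqnorm (z x) <= C * sqnorm (y x)) ->
  inL2 D z /\ (sqnormL2 D z <= C%:E * sqnormL2 D y)%E.
Proof.
move=> mD [my fy] mz C0 h.
suff e : (sqnormL2 D z <= C%:E * sqnormL2 D y)%E.
  split=> //; split=> //; apply: le_lt_trans e _.
  have := sqnormL2_ge0 D y; case: (sqnormL2 D y) fy => // r _ _.
  by rewrite -EFinM ltry.
rewrite -ge0_integralZl//; last 2 first.
- by apply/measurable_EFinP; exact: measurable_sqnorm.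
- by move=> x _; rewrite lee_fin sqnorm_ge0.
apply: ge0_le_integral => //.
- by move=> x _; rewrite lee_fin sqnorm_ge0.
- by apply/measurable_EFinP; exact: measurable_sqnorm.
- apply/measurable_EFinP; apply: measurable_funM => //; exact: measurable_sqnorm.
- by move=> x _; rewrite -EFinM lee_fin.
Qed.

Lemma inL2D (D : set R) y z : measurable D -> inL2 D y -> inL2 D z ->
  inL2 D (fun x => y x + z x).
Proof.
move=> mD [my fy] [mz fz]; split.
  move=> k; have [a b] := my k; have [c d] := mz k.
  have e x : (y x + z x) k 0 = y x k 0 + z x k 0 by rewrite mxE.
  by split; under eq_fun do rewrite e ?cReD ?cImD; apply: measurable_funD.
have : (sqnormL2 D (fun x => (y x + z x)%R) <= 2%:E * (sqnormL2 D y + sqnormL2 D z))%E.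
  rewrite -ge0_integralD//; last 4 first.
  - by move=> x _; rewrite lee_fin sqnorm_ge0.
  - by apply/measurable_EFinP; exact: measurable_sqnorm.
  - by move=> x _; rewrite lee_fin sqnorm_ge0.
  - by apply/measurable_EFinP; exact: measurable_sqnorm.
  rewrite -ge0_integralZl//; last 2 first.
  - apply/measurable_EFinP; apply: measurable_funD; exact: measurable_sqnorm.
  - by move=> x _; rewrite -EFinD lee_fin addr_ge0 ?sqnorm_ge0.
  apply: ge0_le_integral => //.
  - by move=> x _; rewrite lee_fin sqnorm_ge0.
  - apply/measurable_EFinP; apply: measurable_sqnorm => k.
    have [a b] := my k; have [c d] := mz k.
    have e x : (y x + z x) k 0 = y x k 0 + z x k 0 by rewrite mxE.
    by split; under eq_fun do rewrite e ?cReD ?cImD; apply: measurable_funD.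
  - apply/measurable_EFinP; apply: measurable_funM => //.
    by apply: measurable_funD; exact: measurable_sqnorm.
  - by move=> x _; rewrite -EFinD -EFinM lee_fin sqnormD.
move=> /le_lt_trans; apply.
have := sqnormL2_ge0 D y; have := sqnormL2_ge0 D z.
case: (sqnormL2 D y) fy => // p _; case: (sqnormL2 D z) fz => // q _ _ _.
by rewrite -EFinD -EFinM ltry.
Qed.

Lemma inL2Z (D : set R) (c : R[i]) y : measurable D -> inL2 D y ->
  inL2 D (fun x => c *: y x).
Proof.
move=> mD hy; have [my fy] := hy.
have c0 : 0 <= complex.Re c ^+ 2 + complex.Im c ^+ 2 by rewrite addr_ge0 ?sqr_ge0.
have mz k : measurable_complex D (fun x => (c *: y x) k 0).
  have [a b] := my k; have e x : (c *: y x) k 0 = c * y x k 0 by rewrite mxE.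
  split; under eq_fun do rewrite e ?cReM ?cImM.
    by apply: measurable_funB; apply: measurable_funM.
  by apply: measurable_funD; apply: measurable_funM.
have [] := inL2_le mD hy mz c0 => // x.
by rewrite sqnorm_scale.
Qed.

(** Each real component [g] satisfies [|g| <= 1 + g ^+ 2]. *)
Lemma inL2_mlocint f : inL2 setT f -> mlocint setT f.
Proof.
move=> hf; have lf := inL2T_locint hf; have [mf _] := hf.
have key (g : R -> R) : measurable_fun setT g ->
    (forall x, g x ^+ 2 <= sqnorm (f x)) -> locint setT g.
  move=> mg gf a b ab _; have lB := locintD (@locint_cst _ setT 1) lf.
  apply: le_integrable (lB a b ab (@subsetT _ _)) => //.
    by apply/measurable_EFinP; apply: measurable_funS mg.
  move=> x _ /=; rewrite lee_fin [X in _ <= X]ger0_norm ?addr_ge0 ?sqnorm_ge0//.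
  apply: (@le_trans _ _ (1 + `|g x| ^+ 2)); last by rewrite lerD2l real_normK ?num_real.
  by have := sqr_ge0 (`|g x| - 1); rewrite sqrrB1; have := normr_ge0 (g x); lra.
have le k x : complex.Re (f x k 0) ^+ 2 + complex.Im (f x k 0) ^+ 2 <= sqnorm (f x).
  rewrite sqnorm2E; move: k; apply: ord2P; rewrite ?lerDl ?lerDr addr_ge0 ?sqr_ge0//.
move=> k j; rewrite (ord1 j); have [a b] := mf k; apply/clocintP; split; apply: key => // x.
  by apply: le_trans (le k x); rewrite lerDl sqr_ge0.
by apply: le_trans (le k x); rewrite lerDr sqr_ge0.
Qed.

End L2Line.

Section IntegralBounds.
Context {R : realType}.
Local Notation mu := (@lebesgue_measure R).

Lemma locint_dominated (f g : R -> R) : locint setT g ->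
  (forall a b : R, a <= b -> measurable_fun `[a, b] f) -> (forall x, 0 <= f x <= g x) ->
  locint setT f.
Proof.
move=> lg mf fg a b ab _.
apply: le_integrable (lg a b ab (@subsetT _ _)) => //.
  by apply/measurable_EFinP; exact: mf.
move=> x _ /=; have /andP[f0 fgx] := fg x.
by rewrite lee_fin !ger0_norm//; apply: le_trans f0 fgx.
Qed.

Lemma Rintegral_mono (f g : R -> R) a b : a <= b -> locint setT f -> locint setT g ->
  (forall x, a <= x <= b -> f x <= g x) ->
  \int[mu]_(x in `[a, b]) f x <= \int[mu]_(x in `[a, b]) g x.
Proof.
move=> ab lf lg fg; rewrite -!primitiveB//.
exact: ac_le ab (@subsetT _ _) (ac_primitive lf) (ac_primitive lg) fg.
Qed.

Lemma Rintegral_linear (f g : R -> R) p q a b : a <= b -> locint setT f -> locint setT g ->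
  \int[mu]_(x in `[a, b]) (p * f x + q * g x) =
  p * \int[mu]_(x in `[a, b]) f x + q * \int[mu]_(x in `[a, b]) g x.
Proof.
move=> ab lf lg.
have [_ <-] := acD (acZ p (ac_primitive lf)) (acZ q (ac_primitive lg)) ab (@subsetT _ _).
by rewrite -!primitiveB//; ring.
Qed.

Lemma Rintegral_cst_itv (c a b : R) : a <= b ->
  \int[mu]_(x in `[a, b]) (fun=> c) x = c * (b - a).
Proof.
by move=> ab; have [_ <-] := @ac_linear _ setT c _ _ ab (@subsetT _ _); rewrite mulrBr.
Qed.

Lemma measurable_sqnorm_locint (h : R -> 'cV[R[i]]_2) (a b : R) : mlocint setT h -> a <= b ->
  measurable_fun `[a, b] (fun x => sqnorm (h x)).
Proof.
move=> lh ab; apply: measurable_sqnorm => k.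
exact: clocint_measurable (lh k 0) ab (@subsetT _ _).
Qed.

Lemma sqnorm_integral_le (h g : R -> 'cV[R[i]]_2) C N : 0 <= C -> mlocint setT h ->
  locint setT (fun x => sqnorm (g x)) -> (forall x, sqnorm (h x) <= C * sqnorm (g x)) ->
  (forall a b, a <= b -> \int[mu]_(x in `[a, b]) sqnorm (g x) <= N) ->
  locint setT (fun x => sqnorm (h x)) /\
  (forall a b, a <= b -> \int[mu]_(x in `[a, b]) sqnorm (h x) <= C * N).
Proof.
move=> C0 lh lg hg gN; have lCg := locintZ C lg.
have lsh : locint setT (fun x => sqnorm (h x)).
  apply: locint_dominated lCg _ _ => [a b|x]; first exact: measurable_sqnorm_locint.
  by rewrite sqnorm_ge0 hg.
split=> // a b ab; apply: le_trans (Rintegral_mono ab lsh lCg (fun x _ => hg x)) _.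
have [_ <-] := acZ C (ac_primitive lg) ab (@subsetT _ _).
rewrite -mulrBr primitiveB//; apply: ler_wpM2l; first exact: C0.
exact: gN.
Qed.

(** As [k] is real, the system splits into four real equations, each contributing
    [2 * N / k ^+ 2]. *)
Lemma vector_bounded_solution k (h : R -> 'cV[R[i]]_2) N : k != 0 -> mlocint setT h ->
  locint setT (fun x => sqnorm (h x)) ->
  (forall a b, a <= b -> \int[mu]_(x in `[a, b]) sqnorm (h x) <= N) ->
  exists2 w : R -> 'cV[R[i]]_2, mac setT w (fun x => (- k)%:C *: w x + h x) &
  forall a b, a <= b -> \int[mu]_(x in `[a, b]) sqnorm (w x) <= 8 * N / k ^+ 2.
Proof.
move=> k0 lh lsh hN.
have key (g : R -> R) : locint setT g -> (forall x, g x ^+ 2 <= sqnorm (h x)) ->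
    exists2 w, ac setT w (fun x => - k * w x + g x) &
    forall a b, a <= b -> \int[mu]_(x in `[a, b]) w x ^+ 2 <= 2 * N / k ^+ 2.
  move=> lg gh.
  have lg2 : locint setT (fun x => g x ^+ 2).
    apply: locint_dominated lsh _ _ => [a b ab|x]; last by rewrite sqr_ge0 gh.
    have /integrableP[/measurable_EFinP mg _] := lg a b ab (@subsetT _ _).
    exact: measurable_funX.
  apply: bounded_solution_neq0 => // a b ab.
  by apply: le_trans (hN _ _ ab); apply: Rintegral_mono.
have [/clocintP[l1 l2] /clocintP[l3 l4]] := (lh 0 0, lh 1 0).
have hs x := sqnorm2E (h x).
have pos (p : R) := sqr_ge0 p.
have [|u1 a1 b1] := key _ l1; first by move=> x; rewrite hs -addrA lerDl !addr_ge0.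
have [|u2 a2 b2] := key _ l2; first by move=> x; rewrite hs addrAC lerDr !addr_ge0.
have [|u3 a3 b3] := key _ l3; first by move=> x; rewrite hs addrCA lerDl !addr_ge0.
have [|u4 a4 b4] := key _ l4; first by move=> x; rewrite hs addrA lerDr !addr_ge0.
pose w x : 'cV[R[i]]_2 := \col_i (if i == 0 then u1 x +i* u2 x else u3 x +i* u4 x).
have w0 x : w x 0 0 = u1 x +i* u2 x by rewrite mxE.
have w1 x : w x 1 0 = u3 x +i* u4 x by rewrite mxE.
have e (v z : 'cV[R[i]]_2) i : ((- k)%:C *: v + z) i 0 = (- k)%:C * v i 0 + z i 0 by rewrite !mxE.
exists w.
  move=> i j; rewrite (ord1 j); apply/ac_derivativeP; move: i; apply: ord2P; split.
  - by apply: ac_eq a1 => x _; rewrite ?e w0 ?cReD ?cReM/= ?mul0r ?subr0.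
  - by apply: ac_eq a2 => x _; rewrite ?e w0 ?cImD ?cImM/= ?mul0r ?addr0.
  - by apply: ac_eq a3 => x _; rewrite ?e w1 ?cReD ?cReM/= ?mul0r ?subr0.
  - by apply: ac_eq a4 => x _; rewrite ?e w1 ?cImD ?cImM/= ?mul0r ?addr0.
move=> a b ab.
have -> : \int[mu]_(x in `[a, b]) sqnorm (w x) =
    \int[mu]_(x in `[a, b]) (1 * (1 * u1 x ^+ 2 + 1 * u2 x ^+ 2) +
                             1 * (1 * u3 x ^+ 2 + 1 * u4 x ^+ 2)).
  by apply: eq_Rintegral => x _; rewrite sqnorm2E w0 w1 /= !mul1r.
have lin f F g G : ac setT f F -> ac setT g G ->
    locint setT (fun x => 1 * f x ^+ 2 + 1 * g x ^+ 2).
  by move=> hf hg; apply: locintD; apply: locintZ; [exact: ac_sqr_locint hf|exact: ac_sqr_locint hg].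
rewrite Rintegral_linear//; [|exact: lin a1 a2|exact: lin a3 a4].
rewrite !Rintegral_linear//;
  [|exact: ac_sqr_locint a3|exact: ac_sqr_locint a4|exact: ac_sqr_locint a1|exact: ac_sqr_locint a2].
have := b1 _ _ ab; have := b2 _ _ ab; have := b3 _ _ ab; have := b4 _ _ ab.
by rewrite -!mulrA; lra.
Qed.

(** The condition on [c] means [c = 1] or [c = -1], which leaves [cn] invariant; the norm is then
    periodic and continuous. *)
Lemma periodic_mnorm_bounded m n (F f : R -> 'M[R[i]]_(m, n)) (c : R[i]) : mac setT F f ->
  c ^+ 2 = 1 -> (forall x, F (x + pi) = c *: F x) ->
  exists2 B : R, 0 <= B & forall x, mnorm (F x) <= B.
Proof.
move=> hF c1 Fper.
have cM z : cn (c * z) = cn z.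
  by move/eqP: c1; rewrite sqrf_eq1 => /orP[/eqP->|/eqP->]; rewrite ?mul1r ?mulN1r ?cnN.
have [B hB] : exists B, forall x, mnorm (F x) <= B.
  apply: periodic_bounded => [x|].
    rewrite Fper; apply: eq_bigr => i _; apply: eq_bigr => j _.
    by rewrite mxE cM.
  have cF i j : continuous (fun x => cn (F x i j)).
    have [cr ci] := cac_continuous (hF i j) => x.
    by apply: cvgD; apply: cvg_norm; [exact: cr|exact: ci].
  apply: continuous_big => [|i _]; first exact: add_continuous.
  by apply: continuous_big => //; exact: add_continuous.
by exists B => //; apply: le_trans (hB 0); exact: mnorm_ge0.
Qed.

End IntegralBounds.

Section SpectralProjection.
Context {K : fieldType}.
Variables (M : 'M[K]_2) (r s : K).
Hypotheses (detM : \det M = 1) (rs : r * s = 1) (trM : r + s = \tr M) (r_s : r != s).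

(** The spectral projection of [M] for the eigenvalue [r], by Lagrange interpolation; [s] is the
    other eigenvalue. *)
Definition floquet_proj : 'M[K]_2 := (r - s)^-1 *: (M - s%:M).

Lemma sqr_trace : M *m M = (r + s) *: M - 1%:M.
Proof.
have : M *m adj2 M = 1%:M by rewrite mul_adj2 detM.
rewrite /adj2 -trM mulmxBr mul_mx_scalar => <-.
by rewrite opprB addrC subrK.
Qed.

Lemma floquet_projl : M *m floquet_proj = r *: floquet_proj.
Proof.
rewrite /floquet_proj -scalemxAr scalerA mulrC -scalerA; congr (_ *: _).
rewrite mulmxBr sqr_trace mul_mx_scalar scalerBr scale_scalar_mx rs scalerDl.
by rewrite addrAC addrK.
Qed.

Lemma floquet_projr : floquet_proj *m M = r *: floquet_proj.
Proof.
rewrite -floquet_projl /floquet_proj -scalemxAr -scalemxAl; congr (_ *: _).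
by rewrite mulmxBl mulmxBr mul_mx_scalar mul_scalar_mx.
Qed.

Lemma floquet_proj_idem : floquet_proj *m floquet_proj = floquet_proj.
Proof.
rewrite {1}/floquet_proj -scalemxAl mulmxBl floquet_projl mul_scalar_mx -scalerBl.
by rewrite scalerA mulVf ?scale1r// subr_eq0.
Qed.

Lemma floquet_proj_adj2 : floquet_proj *m adj2 M = s *: floquet_proj.
Proof.
rewrite /adj2 mulmxBr floquet_projr mul_mx_scalar -trM -scalerBl.
by rewrite addrAC subrr add0r.
Qed.

End SpectralProjection.

Lemma floquet_proj_sum (K : fieldType) (M : 'M[K]_2) r s : r != s ->
  floquet_proj M r s + floquet_proj M s r = 1%:M.
Proof.
move=> rs; rewrite /floquet_proj -(opprB s r) invrN scaleNr addrC -scalerBr.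
have -> : M - r%:M - (M - s%:M) = (s - r)%:M.
  have -> : (s - r)%:M = s%:M - r%:M :> 'M[K]_2 by rewrite raddfB.
  by rewrite opprB addrC addrA subrK.
by rewrite scale_scalar_mx mulVf// subr_eq0 eq_sym.
Qed.

(** The two roots are real with product 1 and differ in modulus; the smaller one is taken. *)
Lemma floquet_multiplier (R : realType) (F : R) : 2 < `|F| ->
  exists2 p : R, 0 < `|p| < 1 & p ^+ 2 - F * p + 1 = 0.
Proof.
move=> F2; have d0 : 0 <= F ^+ 2 - 4.
  by rewrite -(real_normK (num_real F)); nra.
pose t := Num.sqrt (F ^+ 2 - 4); have t0 : 0 <= t := sqrtr_ge0 _.
have t2 : t ^+ 2 = F ^+ 2 - 4 by rewrite sqr_sqrtr.
case: (leP 0 F) F2 => F0; [rewrite ger0_norm//|rewrite ltr0_norm//] => F2.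
  have tF : t < F by nra.
  have tF2 : F - 2 < t by nra.
  exists ((F - t) / 2); last by nra.
  by rewrite ger0_norm; [apply/andP; split; lra|lra].
have tF : t < - F by nra.
have tF2 : - F - 2 < t by nra.
exists ((F + t) / 2); last by nra.
by rewrite ltr0_norm; [apply/andP; split; lra|lra].
Qed.

Section Resolvent.
Context {R : realType}.
Local Notation mu := (@lebesgue_measure R).
Local Notation J := (@dirac_J R).
Variables (q2 q3 : R -> R[i]).
Hypotheses (lq2 : clocint setT q2) (lq3 : clocint setT q3).
Hypothesis q2_per : forall x : R, q2 (x + pi) = q2 x.
Hypothesis q3_per : forall x : R, q3 (x + pi) = q3 x.
Local Notation Q := (offdiag q2 q3).
Local Notation A := (dirac_A q2 q3).
Local Notation E := (fundamental_matrix Q).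

Lemma sqnorm_J (v : 'cV[R[i]]_2) : sqnorm (J *m v) = sqnorm v.
Proof.
rewrite !sqnorm2E !mul22E; have [-> -> -> ->] := @dirac_JE R.
by rewrite !mul0r addr0 add0r !cReM !cImM /=; ring.
Qed.

Section OneMultiplier.
Variables (l r s : R[i]) (k : R).
Hypotheses (rs : r * s = 1) (trM : r + s = hill_F Q l) (r_s : r != s) (k0 : k != 0).
Hypothesis hk : ((expR (k * pi))%:C * r) ^+ 2 = 1.
Local Notation M := (E l pi).
Local Notation P := (floquet_proj M r s).

Let dM : \det M = 1 := det_fundamental lq2 lq3 l pi.

Let exp_shift (c x : R) : (expR (c * (x + pi)))%:C = (expR (c * pi))%:C * (expR (c * x))%:C.
Proof. by rewrite -rmorphM/= mulrDr expRD mulrC. Qed.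

Let hk' : ((expR (- k * pi))%:C * s) ^+ 2 = 1.
Proof.
have e : (expR (- k * pi))%:C * s * ((expR (k * pi))%:C * r) = 1.
  by rewrite mulrACA -rmorphM/= -expRD mulNr addNr expR0 rmorph1 mul1r mulrC.
by have := congr1 (fun z => z ^+ 2) e; rewrite /= exprMn hk mulr1 expr1n.
Qed.

(** A shift by [pi] multiplies [E *m P] by [r], and [hk] says that the exponential compensates this
    up to sign, so the product is periodic or antiperiodic. *)
Lemma floquet_decaying_bounded : exists2 B : R, 0 <= B &
  forall x, mnorm ((expR (k * x))%:C *: (E l x *m P)) <= B.
Proof.
have [hE E0] := fundamental_matrixP lq2 lq3 l.
apply: (periodic_mnorm_bounded (macZ (cac_real (ac_expR k)) (macMr P hE)) hk) => x.
rewrite (fundamental_per lq2 lq3 q2_per q3_per) -mulmxA floquet_projl//.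
by rewrite -scalemxAr !scalerA exp_shift mulrAC.
Qed.

Lemma floquet_dual_bounded : exists2 B : R, 0 <= B &
  forall x, mnorm ((expR (- k * x))%:C *: (P *m adj2 (E l x))) <= B.
Proof.
have [hE E0] := fundamental_matrixP lq2 lq3 l.
apply: (periodic_mnorm_bounded
  (macZ (cac_real (ac_expR (- k))) (macMl P (mac_adj2 hE))) hk') => x.
rewrite (fundamental_per lq2 lq3 q2_per q3_per) adj2_mul mulmxA floquet_proj_adj2//.
by rewrite -scalemxAl !scalerA exp_shift mulrAC.
Qed.

(** Variation of constants in one Floquet direction. The ansatz [u = e^(k x) P w] reduces it to
    [w' = - k w + h] with [h = e^(- k x) P E^(-1) g]; by the two preceding bounds, [h] is controlled
    by [g], and [E u] by [w]. *)
Lemma half_line_solution : exists2 C : R, 0 <= C &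
  forall (g : R -> 'cV[R[i]]_2) N, mlocint setT g -> locint setT (fun x => sqnorm (g x)) ->
  (forall a b, a <= b -> \int[mu]_(x in `[a, b]) sqnorm (g x) <= N) ->
  exists u : R -> 'cV[R[i]]_2, mac setT u (fun x => P *m (adj2 (E l x) *m g x)) /\
  forall a b, a <= b -> \int[mu]_(x in `[a, b]) sqnorm (E l x *m u x) <= C * N.
Proof.
have [hE E0] := fundamental_matrixP lq2 lq3 l.
have [B B0 hB] := floquet_decaying_bounded; have [B' B'0 hB'] := floquet_dual_bounded.
have C0 : 0 <= 4 * B' ^+ 2 by rewrite mulr_ge0 ?sqr_ge0.
have D0 : 0 <= 4 * B ^+ 2 by rewrite mulr_ge0 ?sqr_ge0.
exists (4 * B ^+ 2 * (8 * (4 * B' ^+ 2) / k ^+ 2)).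
  by rewrite mulr_ge0// mulr_ge0 ?invr_ge0 ?sqr_ge0// mulr_ge0.
move=> g N lg lsg gN.
pose h x := ((expR (- k * x))%:C *: (P *m adj2 (E l x))) *m g x.
have lh : mlocint setT h.
  exact: (mlocintMr lg (macZ (cac_real (ac_expR (- k))) (macMl P (mac_adj2 hE)))).
have [lsh hN] := sqnorm_integral_le C0 lh lsg (fun x => sqnorm_mul (g x) (hB' x)) gN.
have [w hw wN] := vector_bounded_solution k0 lh lsh hN.
exists (fun x => (expR (k * x))%:C *: (P *m w x)); split.
  apply: mac_eq (macZ (cac_real (ac_expR k)) (macMl P hw)) => // x _.
  have e : (expR (k * x))%:C * (expR (- k * x))%:C = 1.
    by rewrite -rmorphM/= -expRD mulNr subrr expR0.
  rewrite mulmxDr -scalemxAr scalerDr scalerA addrA -scalerDl.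
  rewrite rmorphM/= rmorphN/= mulrN (mulrC _ k%:C) subrr scale0r add0r.
  by rewrite /h -scalemxAl -scalemxAr scalerA e scale1r !mulmxA floquet_proj_idem.
have lsw := sqnorm_locint hw.
have hu : mac setT (fun x => E l x *m ((expR (k * x))%:C *: (P *m w x))) _ :=
  macM hE (macZ (cac_real (ac_expR k)) (macMl P hw)).
have le x : sqnorm (E l x *m ((expR (k * x))%:C *: (P *m w x))) <= 4 * B ^+ 2 * sqnorm (w x).
  by rewrite -scalemxAr scalemxAl mulmxA -scalemxAl; exact: sqnorm_mul.
have [_ fin] := sqnorm_integral_le D0 (mlocint_mac hu) lsw le wN.
move=> a b ab; apply: le_trans (fin a b ab) _.
by rewrite le_eqVlt; apply/orP; left; apply/eqP; ring.
Qed.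

(** On the half-line where [e^(- k x) >= 1], the dual bound keeps [E v] away from zero by a multiple
    of [P v]; integrating over intervals of growing length contradicts the bound [N] unless
    [P v = 0]. *)
Lemma floquet_injective (v : 'cV[R[i]]_2) N :
  (forall a b, a <= b -> \int[mu]_(x in `[a, b]) sqnorm (E l x *m v) <= N) -> P *m v = 0.
Proof.
move=> vN; have [B B0 hB] := floquet_dual_bounded.
have D0 : 0 <= 4 * B ^+ 2 by rewrite mulr_ge0 ?sqr_ge0.
have hv := mac_fundamental_col lq2 lq3 l v.
have lv := locintZ (4 * B ^+ 2) (sqnorm_locint hv).
set c := sqnorm (P *m v).
have le x : 0 <= - k * x -> c <= 4 * B ^+ 2 * sqnorm (E l x *m v).
  move=> kx; apply: le_trans (sqnorm_mul _ (hB x)).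
  rewrite -scalemxAl -mulmxA (mulmxA (adj2 _)) (fundamental_adj2l lq2 lq3) mul1mx.
  rewrite sqnorm_scale /= expr0n/= addr0 -/c ler_peMl ?sqnorm_ge0//.
  by rewrite expr_ge1// ?expR_ge0// -expR0 ler_expR.
have bound (n : nat) : c * n%:R <= 4 * B ^+ 2 * N.
  have key a b : a <= b -> b - a = n%:R -> (forall x, a <= x <= b -> 0 <= - k * x) ->
      c * n%:R <= 4 * B ^+ 2 * N.
    move=> ab <- abk; rewrite -Rintegral_cst_itv//.
    apply: le_trans (Rintegral_mono ab (@locint_cst _ setT c) lv (fun x hx => le x (abk x hx))) _.
    have [_ <-] := acZ (4 * B ^+ 2) (ac_primitive (sqnorm_locint hv)) ab (@subsetT _ _).
    rewrite -mulrBr primitiveB//; last exact: sqnorm_locint hv.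
    by apply: ler_wpM2l; [exact: D0|exact: vN].
  case: (ltgtP k 0) k0 => // hk0 _.
    apply: (key 0 n%:R) => //; first by rewrite subr0.
    by move=> x /andP[x0 _]; rewrite mulr_ge0// oppr_ge0 ltW.
  apply: (key (- n%:R) 0); first by rewrite oppr_le0.
    by rewrite sub0r opprK.
  by move=> x /andP[_ x0]; rewrite mulNr -mulrN mulr_ge0 ?oppr_ge0// ltW.
apply: sqnorm_eq0; rewrite leNgt; apply/negP; rewrite -/c => c0.
have := bound (Num.trunc (4 * B ^+ 2 * N / c)).+1.
by have t := truncnS_gt (4 * B ^+ 2 * N / c); rewrite ltr_pdivrMr// in t; rewrite (mulrC c) leNgt t.
Qed.

End OneMultiplier.

(** The multipliers [p] and [1 / p] are treated with exponents [k] and [- k]. Their projections add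
    up to the identity, so the two partial solutions add up to a solution, and a square integrable
    solution of the homogeneous equation has no component in either direction. *)
Theorem resolvent_line (l : R[i]) (F : R) : hill_F Q l = F%:C -> 2 < `|F| ->
  resolvent_set setT (L_line Q) l.
Proof.
move=> hF /floquet_multiplier[p /andP[p0 p1] pF].
have [hE E0] := fundamental_matrixP lq2 lq3 l.
have pn0 : p != 0 by rewrite -normr_gt0.
have pi0 : 0 < pi :> R := pi_gt0 R.
(* The rate at which solutions with multiplier [p] decay: [e^(k pi)] is the inverse of [|p|]. *)
pose k := - ln `|p| / pi.
have kp : 0 < k by rewrite divr_gt0// oppr_gt0 ln_lt0// p0.
have k0 : k != 0 by rewrite gt_eqF.
have nk0 : - k != 0 by rewrite oppr_eq0.
have kpi : k * pi = - ln `|p| by rewrite /k divfK ?gt_eqF.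
have ek : expR (k * pi) = `|p|^-1 by rewrite kpi expRN lnK.
have enk : expR (- k * pi) = `|p| by rewrite mulNr kpi opprK lnK.
have rs : p%:C * p^-1%:C = 1 by rewrite -rmorphM/= divff.
have sr : p^-1%:C * p%:C = 1 by rewrite mulrC.
have trM : p%:C + p^-1%:C = hill_F Q l.
  rewrite hF -rmorphD/=; congr (_%:C); apply: (mulIf pn0).
  rewrite mulrDl mulVf// -expr2; move: pF; lra.
have trM' : p^-1%:C + p%:C = hill_F Q l by rewrite addrC.
have r_s : p%:C != p^-1%:C.
  apply/eqP => /complexI e; have : p ^+ 2 = 1 by rewrite expr2 {2}e divff.
  rewrite -(real_normK (num_real p)); nra.
have s_r : p^-1%:C != p%:C by rewrite eq_sym.
have h1 : ((expR (k * pi))%:C * p%:C) ^+ 2 = 1.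
  rewrite -rmorphM -rmorphXn/= ek exprMn exprVn real_normK ?num_real// mulVf//.
  by rewrite sqrf_eq0.
have h2 : ((expR (- k * pi))%:C * p^-1%:C) ^+ 2 = 1.
  rewrite -rmorphM -rmorphXn/= enk exprMn exprVn real_normK ?num_real// mulfV//.
  by rewrite sqrf_eq0.
have sumP := floquet_proj_sum (E l pi) r_s.
split=> [y [hy _ /(dirac_expr0P lq2 lq3) my]|].
  have yE x : y x = E l x *m y 0.
    have e := trace_free_repT (tr_dirac_A q2 q3 l) x hE E0 my; exact: e.
  have fy : (sqnormL2 setT y <= (fine (sqnormL2 setT y))%:E)%E by rewrite -sqnormL2_fine.
  have yN a b : a <= b -> \int[mu]_(x in `[a, b]) sqnorm (E l x *m y 0) <= fine (sqnormL2 setT y).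
    by move=> ab; under eq_Rintegral do rewrite -yE; exact: sqnormL2_bound.
  have e0 : y 0 = 0.
    rewrite -[y 0]mul1mx -sumP mulmxDl.
    rewrite (floquet_injective rs trM k0 h1 yN) (floquet_injective sr trM' nk0 h2 yN).
    exact: addr0.
  by apply: aeW => x _; rewrite yE e0 mulmx0.
have [C1 C10 sol1] := half_line_solution rs trM r_s k0 h1.
have [C2 C20 sol2] := half_line_solution sr trM' s_r nk0 h2.
exists (2 * (C1 + C2)) => f hf.
pose N := fine (sqnormL2 setT f).
have fN : sqnormL2 setT f = N%:E := sqnormL2_fine hf.
have lf := inL2_mlocint hf; have lsf := inL2T_locint hf.
have fb : forall a b, a <= b -> \int[mu]_(x in `[a, b]) sqnorm (f x) <= N.
  by apply: sqnormL2_bound => //; rewrite fN.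
pose g x := - (J *m f x).
have sg x : sqnorm (g x) = sqnorm (f x).
  by rewrite /g sqnormN sqnorm_J.
have lg : mlocint setT g.
  apply: (@eq_ind _ (fun x => (- J) *m f x) (mlocint setT) (mlocintMc (- J) lf)).
  by apply/funext => x; rewrite mulNmx.
have gb a b : a <= b -> \int[mu]_(x in `[a, b]) sqnorm (g x) <= N.
  by move=> ab; under eq_Rintegral do rewrite sg; exact: fb.
have lsg : locint setT (fun x => sqnorm (g x)) by under eq_fun do rewrite sg.
have [u1 [m1 b1]] := sol1 g N lg lsg gb; have [u2 [m2 b2]] := sol2 g N lg lsg gb.
pose y x := E l x *m (u1 x + u2 x).
have my : mac setT y (fun x => A l x *m y x - J *m f x).
  apply: mac_eq (macM hE (macD m1 m2)) => // x _.
  rewrite -mulmxDl sumP mul1mx [X in _ + X]mulmxA (fundamental_adj2 lq2 lq3) mul1mx.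
  by rewrite /y mulmxA.
have hu1 := macM hE m1; have hu2 := macM hE m2.
have [hy yN] : inL2 setT y /\ (sqnormL2 setT y <= (2 * (C1 + C2) * N)%:E)%E.
  apply: (inL2_mac my) => a b ab.
  have l1 := sqnorm_locint hu1; have l2 := sqnorm_locint hu2.
  apply: (@le_trans _ _ (\int[mu]_(x in `[a, b])
      (2 * sqnorm (E l x *m u1 x) + 2 * sqnorm (E l x *m u2 x)))).
    apply: Rintegral_mono ab (sqnorm_locint my) (locintD (locintZ 2 l1) (locintZ 2 l2)) _ => x _.
    by rewrite /y mulmxDr -mulrDr; exact: sqnormD.
  rewrite Rintegral_linear//; have := b1 _ _ ab; have := b2 _ _ ab; nra.
exists y; split; last by rewrite fN -EFinM.
split=> //; first by apply: inL2D => //; apply: inL2Z.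
by apply/(dirac_exprP lq2 lq3).
Qed.

End Resolvent.

(** * The spectrum on the line *)

Section Spectrum.
Context {R : realType}.
Local Notation mu := (@lebesgue_measure R).
Local Notation J := (@dirac_J R).

(** The function [1 / (1 + (e x)^2)]: its logarithmic derivative is at most [e] because
    [2 |e x| <= 1 + (e x)^2], and its integral is given by the arctangent. Being positive
    everywhere, it keeps the product with a Bloch solution nonzero. *)
Lemma cutoff (e : R) : 0 < e -> exists chi chi' chi'' : R -> R,
  [/\ ac setT chi chi', ac setT chi' chi'', forall x, 0 < chi x,
      forall x, `|chi' x| <= e * chi x &
      forall a b, a <= b -> \int[mu]_(x in `[a, b]) chi x ^+ 2 <= pi / e].
Proof.
move=> e0; pose d x : R := 1 + (e * x) ^+ 2; pose chi x := (d x)^-1.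
have d1 x : 1 <= d x by rewrite lerDl sqr_ge0.
have d0 x : 0 < d x := lt_le_trans ltr01 (d1 x).
have chi0 x : 0 < chi x by rewrite invr_gt0.
have dd x : is_derive x (1 : R) d (2 * e ^+ 2 * x).
  have h2 := is_deriveD (is_derive_cst (1 : R) x (1 : R)) (@is_derive_scale _ _
    (fun y => (2 * y ^+ 1)%:A) _ _ (is_deriveX 2 (is_derive_id (e * x) (1 : R)))).
  by apply: (is_derive_eq h2); rewrite /GRing.scale/= expr1; ring.
have cd : continuous d.
  by move=> x; have [/derivable1_diffP/differentiable_continuous] := dd x.
have cchi : continuous chi by move=> x; apply: cvgV; [rewrite gt_eqF|exact: cd].
pose chi' x : R := - 2 * e ^+ 2 * x * (chi x * chi x).
have hchi : ac setT chi chi'.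
  apply: ac_derive => [x|]; last first.
    move=> x; apply: cvgM; last by apply: cvgM; exact: cchi.
    by apply: cvgM; [exact: cvg_cst|exact: cvg_id].
  have dn0 : d x != 0 by rewrite gt_eqF.
  have h := is_deriveV dn0 (dd x); apply: (is_derive_eq h).
  by rewrite /chi' /chi /GRing.scale/= -expr2 exprVn; ring.
exists chi, chi'; eexists; split=> //.
- exact: (acM (@ac_linear _ setT (- 2 * e ^+ 2)) (acM hchi hchi)).
- move=> x; rewrite /chi' normrM (ger0_norm (mulr_ge0 (ltW (chi0 x)) (ltW (chi0 x)))) mulrA.
  apply: ler_wpM2r; first exact: ltW.
  rewrite -[X in _ * X]invrK -/(chi x) /chi invrK ler_pdivrMr//.
  rewrite ler_norml /d; have := sqr_ge0 (e * x - 1); have := sqr_ge0 (e * x + 1) => s1 s2.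
  by apply/andP; split; nra.
- move=> a b ab.
  have lchi : locint setT chi := continuous_locint cchi.
  have lchi2 := @ac_sqr_locint _ setT _ _ hchi.
  apply: (@le_trans _ _ (\int[mu]_(x in `[a, b]) chi x)).
    apply: Rintegral_mono => // x _; rewrite expr2; apply: ler_piMl; first exact: ltW.
    by rewrite /chi invf_cp1.
  have hat : ac setT (fun x => e^-1 * atan (e * x)) chi.
    apply: ac_derive => // x.
    have h2 := is_deriveZ e^-1 (@is_derive_scale _ _ (fun y => (1 + y ^+ 2)^-1) _ _
      (is_derive1_atan (e * x))).
    apply: (is_derive_eq h2); rewrite /chi /d /GRing.scale/= mulrA mulVf ?mul1r//.
    by rewrite gt_eqF.
  have [_ <-] := hat a b ab (@subsetT _ _).
  rewrite -mulrBr mulrC ler_pM2r ?invr_gt0//.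
  have := atan_ltpi2 (e * b); have := atan_gtNpi2 (e * a); lra.
Qed.

Variables (q2 q3 : R -> R[i]).
Hypotheses (lq2 : clocint setT q2) (lq3 : clocint setT q3).
Hypothesis q2_per : forall x : R, q2 (x + pi) = q2 x.
Hypothesis q3_per : forall x : R, q3 (x + pi) = q3 x.
Local Notation Q := (offdiag q2 q3).
Local Notation A := (dirac_A q2 q3).
Local Notation E := (fundamental_matrix Q).

Lemma bloch_solution (l : R[i]) (F : R) : hill_F Q l = F%:C -> `|F| <= 2 ->
  exists psi : R -> 'cV[R[i]]_2,
  [/\ mac setT psi (fun x => A l x *m psi x), forall x, psi x != 0 &
      exists2 B : R, 0 <= B & forall x, sqnorm (psi x) <= B].
Proof.
move=> hF F2; have dM := det_fundamental lq2 lq3 l pi.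
have F4 : 0 <= 1 - F ^+ 2 / 4.
  by have := lerXn2r 2 (normr_ge0 F) (ler0n _ 2) F2; rewrite real_normK ?num_real//; lra.
(* For [|F| <= 2] the multiplier [F / 2 + i t] has modulus 1, so [sqnorm] of the eigensolution is
   periodic and thus bounded. *)
pose t := Num.sqrt (1 - F ^+ 2 / 4); have t2 : t ^+ 2 = 1 - F ^+ 2 / 4 by rewrite sqr_sqrtr.
pose r : R[i] := (F / 2) +i* t.
have : \det (E l pi - r%:M) = 0.
  rewrite char_poly22// -/(hill_F Q l) hF; apply: complex_ext.
    by rewrite !cReD cReN !cReM /=; move: t2; rewrite !expr2; lra.
  by rewrite !cImD cImN !cImM /=; lra.
move=> /eigenvector_exists[v v0 Mv].
have hy := mac_fundamental_col lq2 lq3 l v.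
exists (fun x => E l x *m v); split=> //.
  by move=> x; exact: fundamental_col_neq0.
have [g hg] := sqnorm_ac hy.
have [x|B hB] := @periodic_bounded _ (fun x => sqnorm (E l x *m v)) _ (ac_continuous hg).
  rewrite (fundamental_per lq2 lq3 q2_per q3_per) -mulmxA Mv -scalemxAr sqnorm_scale /=.
  have -> : (F / 2) ^+ 2 + t ^+ 2 = 1 by rewrite t2; field.
  exact: mul1r.
by exists B => //; apply: le_trans (hB 0); exact: sqnorm_ge0.
Qed.

(* The slowly cut off Bloch solution [y] satisfies [|(L - l) y| <= e |y|]. *)
Theorem spectrum_line_bloch (l : R[i]) (F : R) : hill_F Q l = F%:C -> `|F| <= 2 ->
  spectrum_of setT (L_line Q) l.
Proof.
move=> hF F2 [inj [K hK]]; have [psi [hpsi psi0 [B B0 psiB]]] := bloch_solution hF F2.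
(* Chosen so that [|K| * e ^+ 2 < 1], where [K] bounds the squared norm of the supposed
   resolvent. *)
pose e : R := (1 + `|K|)^-1.
have K1 : 0 < 1 + `|K| by rewrite ltr_pwDl.
have e0 : 0 < e by rewrite invr_gt0.
have eK : `|K| * e ^+ 2 < 1.
  rewrite /e exprVn ltr_pdivrMr ?exprn_gt0// mul1r.
  by have := normr_ge0 K; nra.
have [chi [chi' [chi'' [hchi hchi' chi0 chi'B chiN]]]] := cutoff e0.
pose y x := (chi x)%:C *: psi x; pose f x := J *m ((chi' x)%:C *: psi x).
have Jf x : - (J *m f x) = (chi' x)%:C *: psi x.
  by rewrite /f mulmxA dirac_JJ mulNmx mul1mx opprK.
have my : mac setT y (fun x => A l x *m y x - J *m f x).
  apply: mac_eq (macZ (cac_real hchi) hpsi) => // x _.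
  by rewrite Jf /y -scalemxAr addrC.
have mf := macMl J (macZ (cac_real hchi') hpsi).
have sy x : sqnorm (y x) = chi x ^+ 2 * sqnorm (psi x).
  by rewrite sqnorm_scale /= expr0n/= addr0.
have sf x : sqnorm (f x) <= e ^+ 2 * sqnorm (y x).
  rewrite sqnorm_J sqnorm_scale /= expr0n/= addr0 sy mulrA -exprMn.
  apply: ler_wpM2r; first exact: sqnorm_ge0.
  rewrite -(real_normK (num_real (chi' x))); apply: lerXn2r; rewrite ?nnegrE//.
  by rewrite mulr_ge0// ltW.
have lsy := sqnorm_locint my.
have [hy _] : inL2 setT y /\ (sqnormL2 setT y <= (B * (pi / e))%:E)%E.
  apply: (inL2_mac my) => a b ab.
  have lchi2 := @ac_sqr_locint _ setT _ _ hchi.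
  apply: (@le_trans _ _ (B * \int[mu]_(x in `[a, b]) chi x ^+ 2)); last first.
    by apply: ler_wpM2l; [exact: B0|exact: chiN].
  have [_ e1] := acZ B (ac_primitive lchi2) ab (@subsetT _ _).
  rewrite -(primitiveB lchi2)// mulrBr e1; apply: Rintegral_mono => //.
    exact: locintZ.
  by move=> x _; rewrite sy mulrC; apply: ler_wpM2r; [exact: sqr_ge0|exact: psiB].
have mT : measurable (setT : set R) by [].
have [hf fy] := inL2_le mT hy (mac_measurableT mf) (sqr_ge0 e) sf.
have [z [[hz _ dz] zf]] := hK f hf.
have mz : mac setT z (fun x => A l x *m z x - J *m f x).
  have lf : mlocint setT f := inL2_mlocint hf.
  exact: (iffLR (dirac_exprP lq2 lq3 l z lf) dz).
have mNz := macMl (- 1%:M) mz.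
(* The cut-off function [y] and the solution [z] supplied by the resolvent have the same image [f].
   Their difference solves the homogeneous equation, and injectivity identifies them a.e. *)
have md : mac setT (fun x => y x + (-1) *: z x) (fun x => A l x *m (y x + (-1) *: z x)).
  apply: mac_eq (macD my mNz) => x _; first by rewrite mulNmx mul1mx scaleN1r.
  rewrite mulNmx mul1mx scaleN1r mulmxDr mulmxN opprB addrA subrK.
  by [].
have hd : inL2 setT (fun x => y x + (-1) *: z x) by apply: inL2D => //; exact: inL2Z.
have yz : sqnormL2 setT y = sqnormL2 setT z.
  apply: ae_eq_integral => //.
  - by apply/measurable_EFinP; apply: measurable_sqnorm; case: hy.
  - by apply/measurable_EFinP; apply: measurable_sqnorm; case: hz.
  have d0 : ae_eq_on setT (fun x => y x + (-1) *: z x) (fun=> 0).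
    apply: inj; split=> //; first exact: inL2Z.
    by apply/(dirac_expr0P lq2 lq3).
  apply: ae_mono d0 _ => x h xT.
  by have := h xT; rewrite scaleN1r => /eqP; rewrite subr_eq0 => /eqP ->.
(* The continuous function [sqnorm (y x)] has no zero, so its minimum over [[0, 1]] bounds the norm
   from below. Without this the final inequality could be [0 <= 0]. *)
have N0 : 0 < fine (sqnormL2 setT y).
  have [g hg] := sqnorm_ac my.
  have [c _ hc] := EVT_min ler01 (continuous_subspaceT (ac_continuous hg)).
  have c0 : 0 < sqnorm (y c).
    rewrite sy mulr_gt0 ?exprn_gt0// lt0r sqnorm_ge0 andbT.
    by apply: contra_neq (psi0 c) => h; apply: sqnorm_eq0; rewrite h.
  apply: (lt_le_trans c0).
  have yN := sqnormL2_bound hy (eqbRL (f_equal (fun t => t <= _)%E (sqnormL2_fine hy)) (lexx _)).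
  apply: le_trans (yN 0 1 ler01).
  have := Rintegral_cst_itv (sqnorm (y c)) (@ler01 R); rewrite subr0 mulr1 => {1}<-.
  apply: (Rintegral_mono ler01 (@locint_cst _ setT (sqnorm (y c))) lsy) => x x01.
  by apply: hc; rewrite in_itv.
move: zf fy; rewrite -yz (sqnormL2_fine hy) (sqnormL2_fine hf) -!EFinM !lee_fin => zf fy.
have f0 : 0 <= fine (sqnormL2 setT f) by apply: fine_ge0; exact: sqnormL2_ge0.
move: zf fy N0 f0; set n := fine (sqnormL2 setT y); set m := fine (sqnormL2 setT f) => zf fy N0 f0.
have h1 : n <= `|K| * m by apply: le_trans zf _; apply: ler_wpM2r => //; exact: ler_norm.
have h2 : `|K| * m <= `|K| * (e ^+ 2 * n) by apply: ler_wpM2l => //; exact: normr_ge0.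
have : n < n.
  by apply: le_lt_trans (le_trans h1 h2) _; rewrite mulrA -[X in _ < X]mul1r ltr_pM2r.
by rewrite ltxx.
Qed.

End Spectrum.

Section Multiplicity.
Context {R : realType}.

Lemma derive1_subC (f : R[i] -> R[i]) (s : R[i]) :
  derive1 ((fun z => f z - s) : R[i] -> R[i]^o) = derive1 (f : R[i] -> R[i]^o).
Proof.
apply/funext => z; rewrite /derive1.
suff -> : (fun h => h^-1 *: ((f (h + z) - s : R[i]^o) - (f z - s))) =
    (fun h => h^-1 *: ((f (h + z) : R[i]^o) - f z)) by [].
by apply/funext => h; rewrite opprB addrA subrK.
Qed.

(** Subtracting the constant [s] leaves the derivatives unchanged, and the second one is [2 * c 2],
    so Taylor coefficients may replace derivatives. *)
Lemma root_multiplicityP (c : nat -> R[i]) C D (f : R[i] -> R[i]) z s : entire c C D ->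
  (forall h, csums (fun k => c k * h ^+ k) (f (z + h))) ->
  (root_multiplicity (fun w => f w - s) z 1 <-> f z = s /\ c 1%N <> 0) /\
  (root_multiplicity (fun w => f w - s) z 2 <-> f z = s /\ c 1%N = 0 /\ c 2 <> 0).
Proof.
move=> ec hf; have [_ e1 e2] := entire_derive1n ec hf.
have d1 : derive1n 1 ((fun w => f w - s) : R[i] -> R[i]^o) z = c 1%N.
  by rewrite -e1 /derive1n/= derive1_subC.
have d2 : derive1n 2 ((fun w => f w - s) : R[i] -> R[i]^o) z = 2 * c 2%N.
  by rewrite -e2 /derive1n/= derive1_subC.
have f0 : f z = s <-> f z - s = 0.
  by split=> [->|/eqP]; rewrite ?subrr// subr_eq0 => /eqP.
split; split.
- move=> [h h1]; split; first by apply/f0; exact: (h 0%N isT).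
  by move=> c1; apply: h1; rewrite -c1; exact: d1.
- move=> [/f0 fz c1]; split; first by case.
  by move=> h; apply: c1; rewrite -d1; exact: h.
- move=> [h h2]; split; first by apply/f0; exact: (h 0%N isT).
  split; first by rewrite -d1; exact: (h 1%N isT).
  by move=> c2; apply: h2; apply: etrans d2 _; rewrite c2 mulr0.
- move=> [/f0 fz [c1 c2]]; split.
    by move=> [|[|//]] _; [exact: fz|exact: etrans d1 c1].
  move=> h; apply: c2; have := etrans (esym d2) h.
  by move=> /eqP; rewrite mulf_eq0 pnatr_eq0 /= => /eqP.
Qed.

Lemma finite_set_real (A : set R) : finite_set [set x%:C | x in A] <-> finite_set A.
Proof.
split=> h; last exact: finite_image.
have := finite_image (@complex.Re R) h; apply: sub_finite_set => x Ax.
by exists x%:C => //; exists x.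
Qed.

End Multiplicity.

Theorem theorem8 (R : realType) (q2 q3 : R -> R[i])
  (q2_L1 : integrable_complex `[0, pi] q2)
  (q3_L1 : integrable_complex `[0, pi] q3)
  (q2_per : forall x : R, q2 (x + pi) = q2 x)
  (q3_per : forall x : R, q3 (x + pi) = q3 x)
  (q2_PT : forall x : R, q2 (- x) = conjc (q2 x))
  (q3_PT : forall x : R, q3 (- x) = conjc (q3 x)) :
  (finite_set (spectral_gaps (offdiag q2 q3)) <->
   finite_set [set l : R[i] | eigenvalue_2pi (offdiag q2 q3) l /\
                 mult_2pi (offdiag q2 q3) l 1 /\ complex.Im l = 0])
  /\
  (finite_set (spectral_gaps (offdiag q2 q3)) <->
   finite_set [set l : R[i] | eigenvalue_2pi (offdiag q2 q3) l /\
                 ~ (mult_2pi (offdiag q2 q3) l 2 \/ complex.Im l <> 0)]).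
Proof.
have lq2 := clocint_periodic q2_L1 q2_per; have lq3 := clocint_periodic q3_L1 q3_per.
set Q := offdiag q2 q3; pose f (x : R) := complex.Re (hill_F Q x%:C).
have imF x : complex.Im (hill_F Q x%:C) = 0.
  exact: (hill_F_real lq2 lq3 q2_per q3_per q2_PT q3_PT).
have fE x : hill_F Q x%:C = (f x)%:C by apply: complex_ext; rewrite ?imF.
have [C [D [C0 D0 /choice[c hc]]]] := hill_F_expansion lq2 lq3.
have cC l : entire (c l) C D by split=> // k; have [_] := hc l.
have hre l h N : \sum_(k < N) complex.Re (c l k) * h ^+ k =
    complex.Re (\sum_(k < N) c l k * h%:C ^+ k).
  by rewrite Re_sum; apply: eq_bigr => k _; rewrite -rmorphXn/= cReM/= mulr0 subr0.
have him l h N : \sum_(k < N) complex.Im (c l k) * h ^+ k =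
    complex.Im (\sum_(k < N) c l k * h%:C ^+ k).
  by rewrite Im_sum; apply: eq_bigr => k _; rewrite -rmorphXn/= cImM/= mulr0 add0r.
(* The imaginary parts of the coefficients expand the imaginary part of the discriminant, which is
   zero on the real line. *)
have cim l k : complex.Im (c l k) = 0.
  apply: (@coef_eq0 _ (fun=> 0) (fun l k => complex.Im (c l k)) C D) => //.
    by move=> x j; apply: le_trans (cn_Im _) _; have [_] := hc x.
  move=> x h; have [/(_ h%:C) [_ +] _] := hc x.
  by rewrite -rmorphD/= imF; apply: eq_cvgn => N; rewrite him.
pose d l k := complex.Re (c l k).
have cd l k : c l k = (d l k)%:C by apply: complex_ext; rewrite ?cim.
have hd l k : `|d l k| <= C * (D ^+ k / k`!%:R).
  by apply: le_trans (cn_Re _) _; have [_] := hc l.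
have hf l h : (fun N => \sum_(k < N) d l k * h ^+ k) @ \oo --> f (l + h).
  have [/(_ h%:C) [+ _] _] := hc l.
  by rewrite -rmorphD/=; apply: eq_cvgn => N; rewrite hre.
have asym eps : 0 < eps -> exists N, forall l, N < `|l| -> `|f l - 2 * cos (pi * l)| <= eps.
  move=> e0; have [N hN] := hill_F_asymptotic lq2 lq3 e0; exists N => l /hN.
  by apply: le_trans; apply: le_trans (cn_Re _); rewrite cReD cReN.
have [main1 main2] := finite_gaps_simple_roots C0 D0 hd hf asym.
have czero (x : R) : x%:C = 0 <-> x = 0.
  by split=> [/(congr1 (@complex.Re R))//|->].
have [t0 t1] : cos (pi * 0) = 1 :> R /\ cos (pi * 1) = -1 :> R.
  by rewrite mulr0 mulr1 cos0 cospi.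
have eig0 x : eigenvalue_Lt Q 0 x%:C <-> f x = 2.
  have h := @eigenvalue_LtP _ _ _ lq2 lq3 0 x%:C 1.
  have -> : eigenvalue_Lt Q 0 x%:C <-> hill_F Q x%:C = 2 * 1.
    by apply: h; rewrite ?expr1n// t0 mulr0 sin0.
  rewrite mulr1 fE; split=> [/(congr1 (@complex.Re R))|->] //.
  by rewrite rmorphMn.
have eig1 x : eigenvalue_Lt Q 1 x%:C <-> f x = - 2.
  have h := @eigenvalue_LtP _ _ _ lq2 lq3 1 x%:C (-1).
  have -> : eigenvalue_Lt Q 1 x%:C <-> hill_F Q x%:C = 2 * (-1).
    by apply: h; rewrite ?sqrrN ?expr1n// t1 mulr1 sinpi; apply: complex_ext; rewrite /= ?oppr0.
  have e2 : - 2 = (- 2)%:C :> R[i] by rewrite rmorphN rmorph_nat.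
  by rewrite mulrN1 fE e2; split=> [/complexI|->].
have eig x : eigenvalue_2pi Q x%:C <-> f x ^+ 2 = 4.
  rewrite /eigenvalue_2pi /= eig0 eig1; have -> : 4 = 2 ^+ 2 :> R by ring.
  split=> [[->|->]|/eqP]; rewrite ?sqrrN//.
  by rewrite eqf_sqr => /orP[/eqP|/eqP]; [left|right].
have mult x := fun s => @root_multiplicityP _ (c x) C D (hill_F Q) x%:C s (cC x) (hc x).1.
have mult1 x : mult_2pi Q x%:C 1 <-> f x ^+ 2 = 4 /\ d x 1%N <> 0.
  rewrite -eig /mult_2pi /eigenvalue_mult t0 t1 !(mult x _).1 eig0 eig1.
  rewrite /eigenvalue_2pi/= eig0 eig1 mulr1 mulrN1 fE cd.
  have cz := czero (d x 1%N).
  split=> [[[h [_ h1]]|[h [_ h1]]]|[[h|h] h1]].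
  - by split; [left|move=> e; apply: h1; rewrite e].
  - by split; [right|move=> e; apply: h1; rewrite e].
  - by left; split=> //; split; [rewrite h|move/cz].
  - by right; split=> //; split; [rewrite h|move/cz].
have mult2 x : mult_2pi Q x%:C 2 <-> f x ^+ 2 = 4 /\ (d x 1%N = 0 /\ d x 2 <> 0).
  rewrite -eig /mult_2pi /eigenvalue_mult t0 t1 !(mult x _).2 eig0 eig1.
  rewrite /eigenvalue_2pi/= eig0 eig1 mulr1 mulrN1 fE !cd !czero.
  split=> [[[h [_ h1]]|[h [_ h1]]]|[[h|h] h1]].
  - by split=> //; left.
  - by split=> //; right.
  - by left; split=> //; split=> //; rewrite h.
  - by right; split=> //; split=> //; rewrite h.
(* The two halves of the spectral criterion, [spectrum_line_bloch] and [resolvent_line], identify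
   the complement of the spectrum with [|f| > 2]. *)
have gapsE : spectral_gaps Q = [set connected_component [set x | 2 < `|f x|] x | x in [set x | 2 < `|f x|]].
  rewrite /spectral_gaps; have -> // : [set x | ~ spectrum_of setT (L_line Q) x%:C] = [set x | 2 < `|f x|].
  apply/seteqP; split=> x /= h.
    rewrite ltNge; apply/negP => f2; apply: h.
    exact: (spectrum_line_bloch lq2 lq3 q2_per q3_per (fE x)).
  by apply; exact: (resolvent_line lq2 lq3 q2_per q3_per (fE x)).
have realE (l : R[i]) : complex.Im l = 0 -> l = (complex.Re l)%:C.
  by move=> h; apply: complex_ext; rewrite ?h.
have -> : [set l : R[i] | eigenvalue_2pi Q l /\ mult_2pi Q l 1 /\ complex.Im l = 0] =
    [set x%:C | x in [set x | f x ^+ 2 = 4 /\ d x 1%N <> 0]].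
  apply/seteqP; split=> [l /= [_ [ml /realE le]]|_ [x /= hx <-] /=].
    by exists (complex.Re l) => //; apply/mult1; rewrite -le.
  by split; [apply/eig; case: hx|split=> //; exact/mult1].
(* Nonreal eigenvalues are excluded from this set too, so both sets are images of sets of real
   roots. *)
have -> : [set l : R[i] | eigenvalue_2pi Q l /\ ~ (mult_2pi Q l 2 \/ complex.Im l <> 0)] =
    [set x%:C | x in [set x | f x ^+ 2 = 4 /\ ~ (d x 1%N = 0 /\ d x 2 <> 0)]].
  apply/seteqP; split=> [l /= [el nl]|_ [x /= [hx nx] <-] /=].
    have /realE le : complex.Im l = 0 by apply: contrapT => h; apply: nl; right.
    have hx : f (complex.Re l) ^+ 2 = 4 by apply/eig; rewrite -le.
    exists (complex.Re l) => //; split=> // h; apply: nl; left.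
    by rewrite le; apply/mult2.
  by split; [exact/eig|move=> [/mult2[_ /nx]//|]].
by rewrite gapsE !finite_set_real.
Qed.
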